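(* There exist universal positive constants $D,K_2,K_2'$, and $K_3$ such that the following holds. Let $p,n\in\mathbb{N}$. For $\nu\in\mathscr{V}_{\mathcal{H}}$ and $s\in[p]$, set $d_\nu=\nu\vee\lceil D\rceil$ and $$r_{\nu,s}:=K_2\left(d_\nu\log\left(1+\frac{p\mathscr{A}_{\mathcal{H}}}{s^2}\right)\right)^{1/4},\qquad r_s':=K_2'\sqrt{\log\left(1+\frac{p\mathscr{A}_{\mathcal{H}}}{s^2}\right)}.$$ If $\eta\in(0,1)$, then there exists $C_\eta>0$ depending only on $\eta$ such that for all $C>C_\eta$ we have $$P_0\left\{\max_{\nu\in\mathscr{V}_{\mathcal{H}}}\max_{s\in\mathscr{S}}\varphi_{\nu,s}\ne0\right\}+\max_{1\le s^*\le p}\ \sup_{\substack{f\in\mathcal{F}_{s^*},\\ \|f\|_2\ge C\tau_{\text{adapt}}(p,s^*,n)}}P_f\left\{\max_{\nu\in\mathscr{V}_{\mathcal{H}}}\max_{s\in\mathscr{S}}\varphi_{\nu,s}\ne1\right\}\le\eta,$$ where $$\tau_{\text{adapt}}^2(p,s,n)=\begin{cases}\left(\frac sn\log\left(1+\frac{p\mathscr{A}_{\mathcal{H}}}{s^2}\right)\right)\vee\left(\frac sn\sqrt{\nu_{\mathcal{H}}(s,\mathscr{A}_{\mathcal{H}})\log\left(1+\frac{p\mathscr{A}_{\mathcal{H}}}{s^2}\right)}\right)&\text{if }s<\sqrt{p\mathscr{A}_{\mathcal{H}}},\\ \frac sn\sqrt{\nu_{\mathcal{H}}(s,\mathscr{A}_{\mathcal{H}})\log\left(1+\frac{p\mathscr{A}_{\mathcal{H}}}{s^2}\right)}&\text{if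 }s\ge\sqrt{p\mathscr{A}_{\mathcal{H}}},\end{cases}$$ and $$\varphi_{\nu,s}:=\begin{cases}\mathbbm{1}_{\left\{T_{r_{\nu,s}}(d_\nu)>Cs\sqrt{\nu\log\left(1+\frac{p\mathscr{A}_{\mathcal{H}}}{s^2}\right)}\right\}}&\text{if }s<\sqrt{p\mathscr{A}_{\mathcal{H}}}\text{ and }\sqrt{\log\left(1+\frac{p\mathscr{A}_{\mathcal{H}}}{s^2}\right)}\le K_3\sqrt{d_\nu},\\ \mathbbm{1}_{\left\{T_{r_s'}(d_\nu)>Cs\log\left(1+\frac{p\mathscr{A}_{\mathcal{H}}}{s^2}\right)\right\}}&\text{if }s<\sqrt{p\mathscr{A}_{\mathcal{H}}}\text{ and }\sqrt{\log\left(1+\frac{p\mathscr{A}_{\mathcal{H}}}{s^2}\right)}>K_3\sqrt{d_\nu},\\ \mathbbm{1}_{\left\{n\sum_{j=1}^p\sum_{k\le\nu}X_{k,j}^2>\nu p+C\sqrt{\nu p\mathscr{A}_{\mathcal{H}}}\right\}}&\text{if }s\ge\sqrt{p\mathscr{A}_{\mathcal{H}}}.\end{cases}$$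
   Context: Notation: $[p]=\{1,\dots,p\}$, $a\vee b=\max\{a,b\}$; $|A|$ is the cardinality of a finite set $A$. A universal constant is an absolute constant not depending on any problem parameter. Model: one observes the $p$-dimensional Gaussian white noise model $dY_x = f(x)\,dx + \frac{1}{\sqrt n}\,dB_x$, $x\in[0,1]^p$. $P_f$ denotes the law of the observation when the signal is $f$, and $P_0$ the law when $f\equiv 0$. $\|\cdot\|_2$ is the $L^2([0,1]^p)$ norm. Function space: $\mathcal{H}\subset L^2([0,1])$ is a reproducing kernel Hilbert space (RKHS) whose kernel admits a Mercer expansion. Let $\mathbf 1$ be the constant function one and $\mathcal{H}_0 := \mathcal{H}\cap \mathrm{span}\{\mathbf 1\}^\perp$ (orthogonality in $L^2([0,1])$), also an RKHS, with eigenfunctions $\{\psi_k\}_{k\ge1}$ orthonormal in $L^2([0,1])$ and corresponding eigenvalues $\mu_1\ge\mu_2\ge\dots\ge0$ in the Mercer expansion of its kernel, so that $\|g\|_{\mathcal{H}_0}^2=\sum_{k\ge1}\mu_k^{-1}\langle g,\psi_k\rangle_{L^2}^2$. It is assumed that $\mu_1=1$. Parameter space: for $S\subset[p]$, $\mathcal{H}_S := \{f(x)=\sum_{j\in S} f_j(x_j): f_j\in\mathcal{H}_0,\ \|f_j\|_{\mathcal{H}_0}\le 1 \text{ for all } j\in S\}$, and $\mathcal{F}_s := \bigcup_{S\subset[p],\,|S|\le s}\mathcal{H}_S$. Test statistics: for $k\in\mathbb{N}$, $j\in[p]$ let $X_{k,j} := \int_{[0,1]^p}\psi_k(x_j)\,dY_x$;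 under $P_f$ these are independent with $X_{k,j}\sim N(\theta_{k,j}, n^{-1})$, $\theta_{k,j}=\int_0^1\psi_k(t)f_j(t)\,dt$. For $d\in\mathbb{N}$ and $r\ge0$, let $E_j(d):= n\sum_{k\le d}X_{k,j}^2$, $$T_r(d) := \sum_{j=1}^p (E_j(d)-\alpha_r(d))\mathbbm{1}_{\{E_j(d)\ge d+r^2\}},\qquad \alpha_r(d):=\frac{E\left(\|g\|^2\mathbbm{1}_{\{\|g\|^2\ge d+r^2\}}\right)}{P\{\|g\|^2\ge d+r^2\}},\quad g\sim N(0,I_d).$$ Adaptation quantities: for $a>0$ and $s\in[p]$, $\nu_{\mathcal{H}}(s,a)$ is the smallest positive integer $\nu$ satisfying $\mu_\nu\le\frac{\sqrt{\nu\log(1+pa/s^2)}}{n}$. Further $$\mathscr{V}_a:=\left\{2^k: k\in\mathbb{N}\cup\{0\},\ 2^{k-1}<\nu_{\mathcal{H}}(s,a)\le2^k\text{ for some }s\in[p]\right\},\qquad \mathscr{A}_{\mathcal{H}}:=\sup\{a\ge1:\log(e|\mathscr{V}_a|)\ge a\},\qquad \mathscr{V}_{\mathcal{H}}:=\mathscr{V}_{\mathscr{A}_{\mathcal{H}}},$$ $$\mathscr{S}:=\left\{1,2,4,\dots,2^{\lceil\log_2\sqrt{p\mathscr{A}_{\mathcal{H}}}\rceil-1}\right\}\cup\{p\}.$$ *)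

(* Defs.v *)
From HB Require Import structures.
From mathcomp Require Import all_boot all_order all_algebra.
From mathcomp Require Import finmap.
From mathcomp Require Import all_classical all_reals all_analysis.

Set Implicit Arguments.
Unset Strict Implicit.
Unset Printing Implicit Defensive.

Import Order.TTheory GRing.Theory Num.Theory.
Import numFieldNormedType.Exports.

Local Open Scope classical_set_scope.
Local Open Scope ring_scope.

Section product_probability_tuple.
Context {R : realType} {d : measure_display} {T : measurableType d}.

(* The [{mfun _ >-> _}] structure on this map is what makes its [distribution]
   below a probability. *)
Definition tuple_cons (n : nat) (x : T * n.-tuple T) : n.+1.-tuple T :=
  [tuple of x.1 :: x.2].

Lemma measurable_tuple_cons n : measurable_fun setT (@tuple_cons n).
Proof.
exact: (measurable_cons (f := fst) (g := snd) measurable_fst measurable_snd).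
Qed.

HB.instance Definition _ n :=
  isMeasurableFun.Build _ _ _ _ (@tuple_cons n) (@measurable_tuple_cons n).

Fixpoint prod_prob (P : probability T R) (n : nat) :
    probability (n.-tuple T) R :=
  match n with
  | 0 => dirac [tuple]
  | m.+1 => distribution (P \x prod_prob P m)%E (@tuple_cons m)
  end.

Lemma prod_prob_box (P : probability T R) n (A : 'I_n -> set T) :
  (forall i, measurable (A i)) ->
  prod_prob P n [set t | forall i, A i (tnth t i)] = (\prod_(i < n) P (A i))%E.
Proof.
elim: n A => [|n IH] A mA /=.
  rewrite big_ord0 diracE (_ : _ \in _ = true)//.
  by apply/mem_set => -[].
rewrite big_ord_recl -(IH (fun i => A (lift ord0 i)))//.
rewrite -product_measure1E//.
  congr (_ _); apply/seteqP; split => -[x t] /=.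
    by move=> H; split; [have := H ord0; rewrite tnth0|
      move=> i; have := H (lift ord0 i); rewrite tnthS].
  by move=> [Hx Ht] i; case: (unliftP ord0 i) => [j|] ->;
    rewrite ?tnthS ?tnth0//; exact: Ht.
have -> : [set t : n.-tuple T | forall i, A (lift ord0 i) (tnth t i)] =
    \bigcap_(i in [set: 'I_n]) ((@tnth n T ^~ i) @^-1` A (lift ord0 i)).
  by apply/seteqP; split => t /= H i; [move=> _; exact: H|exact: H].
apply: fin_bigcap_measurable => // i _.
by rewrite -[X in measurable X]setTI; exact: measurable_tnth.
Qed.

End product_probability_tuple.

Section L2.
Context {d : measure_display} {T : measurableType d} {R : realType}.
Variables (m : {measure set T -> \bar R}) (D : set T).

Definition L2 (h : T -> R) : Prop :=
  measurable_fun D h /\ m.-integrable D (EFin \o (fun x => h x ^+ 2)).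

Definition L2dot (f g : T -> R) : R := \int[m]_(x in D) (f x * g x).

Definition L2norm (f : T -> R) : R := Num.sqrt (L2dot f f).

End L2.

Section gaussian.
Context {d : measure_display} {Omega : measurableType d} {R : realType}.
Variable P : probability Omega R.

(* [normal_prob m 0] is not the point mass at [m], whence the case split. *)
Definition gaussian_rv (X : Omega -> R) (m v : R) : Prop :=
  measurable_fun setT X /\
  forall A : set (measurableTypeR R), measurable A ->
    P (X @^-1` A) =
      if v == 0 then dirac (m : measurableTypeR R) A
      else normal_prob m (Num.sqrt v) A.

(* [W h] is the stochastic integral of [h] over [D] against white noise: the
   centred Gaussian process over L^2(D) with covariance the L^2 inner product.
   Joint Gaussianity and the covariance are both encoded by the laws of the
   finite linear combinations. *)
Definition white_noise {d' : measure_display} {T : measurableType d'}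
    (mu : {measure set T -> \bar R}) (D : set T)
    (W : (T -> R) -> Omega -> R) : Prop :=
  forall (N : nat) (a : 'I_N -> R) (h : 'I_N -> T -> R),
    (forall i, L2 mu D (h i)) ->
    gaussian_rv (fun w => \sum_(i < N) a i * W (h i) w) 0
      (L2norm mu D (fun x => \sum_(i < N) a i * h i x) ^+ 2).

End gaussian.

Section model.
Context {R : realType}.

(* Lebesgue measure restricted to [0,1]. *)
Definition lebesgue01 : probability (measurableTypeR R) R :=
  uniform_prob (@ltr01 R).

Definition unit_itv : set (measurableTypeR R) := `[0, 1].

Definition cube (p : nat) : set (p.-tuple (measurableTypeR R)) :=
  [set x | forall j, unit_itv (tnth x j)].

Definition lebesgue_cube (p : nat) :
  probability (p.-tuple (measurableTypeR R)) R := prod_prob lebesgue01 p.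

(* [Y h] is the observed integral of [h] against dY; [P f] is the law of the
   observation when the signal is [f]. *)
Definition white_noise_model (p n : nat)
    {d : measure_display} {Omega : measurableType d}
    (P : (p.-tuple (measurableTypeR R) -> R) -> probability Omega R)
    (Y : (p.-tuple (measurableTypeR R) -> R) -> Omega -> R) : Prop :=
  forall f, L2 (lebesgue_cube p) (@cube p) f ->
  exists2 B : (p.-tuple (measurableTypeR R) -> R) -> Omega -> R,
    white_noise (P f) (lebesgue_cube p) (@cube p) B &
    forall h, L2 (lebesgue_cube p) (@cube p) h -> forall w,
      Y h w = L2dot (lebesgue_cube p) (@cube p) h f
              + (Num.sqrt n%:R)^-1 * B h w.

End model.

Section rkhs.
Context {R : realType}.

(* A real Hilbert space whose elements are functions on [0,1], square
   integrable there; the values of [ev g] outside [0,1] are irrelevant. *)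
Record hilbert_fun := HilbertFun {
  hf_space :> completeNormedModType R;
  hdot : hf_space -> hf_space -> R;
  ev : hf_space -> R -> R;
  _ : forall g h, hdot g h = hdot h g;
  _ : forall a f g h, hdot (a *: f + g) h = a * hdot f h + hdot g h;
  _ : forall g, hdot g g = `|g| ^+ 2;
  _ : forall a g h x, unit_itv x -> ev (a *: g + h) x = a * ev g x + ev h x;
  _ : forall g h, (forall x, unit_itv x -> ev g x = ev h x) -> g = h;
  _ : forall g, L2 lebesgue01 unit_itv (ev g)
}.

(* The kernel is K(x, y) = ev (k x) y. *)
Definition reproducing (H : hilbert_fun) (A : set H) (k : R -> H) : Prop :=
  forall x, unit_itv x -> A (k x) /\ forall g, A g -> ev g x = hdot g (k x).

(* Sequences are indexed from 1; the terms of index 0 are unused. *)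
Definition mercer_expansion (K : R -> R -> R) (mu : nat -> R)
    (psi : nat -> R -> R) : Prop :=
  [/\ forall k, (1 <= k)%N -> L2 lebesgue01 unit_itv (psi k),
      forall k l, (1 <= k)%N -> (1 <= l)%N ->
        L2dot lebesgue01 unit_itv (psi k) (psi l) = (k == l)%:R,
      forall k, (1 <= k)%N -> 0 <= mu k.+1 <= mu k
    & forall x y, unit_itv x -> unit_itv y ->
        (fun N : nat => \sum_(1 <= k < N.+1) mu k * psi k x * psi k y)
          @ \oo --> K x y].

Definition is_mercer_rkhs (H : hilbert_fun) : Prop :=
  exists k, reproducing [set: H] k /\
    exists lam phi, mercer_expansion (fun x y => ev (k x) y) lam phi.

Definition mean_zero (g : R -> R) : Prop :=
  L2dot lebesgue01 unit_itv g (cst 1) = 0.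

Definition H0 (H : hilbert_fun) : set H := [set g | mean_zero (ev g)].

(* Every psi_k, including those with mu_k = 0, is an eigenfunction in
   L^2([0,1]) orthogonal to the constants; this is automatic if mu_k > 0. *)
Definition H0_mercer_system (H : hilbert_fun) (mu : nat -> R)
    (psi : nat -> R -> R) : Prop :=
  (exists k0, reproducing (@H0 H) k0 /\
     mercer_expansion (fun x y => ev (k0 x) y) mu psi) /\
  forall k, (1 <= k)%N -> mean_zero (psi k).

Definition additive_class (H : hilbert_fun) (p : nat) (S : {set 'I_p}) :
    set (p.-tuple (measurableTypeR R) -> R) :=
  [set f | exists2 g : 'I_p -> H,
     forall j, j \in S -> H0 (g j) /\ `|g j| <= 1 &
     forall x, cube x -> f x = \sum_(j in S) ev (g j) (tnth x j)].

Definition sparse_additive_class (H : hilbert_fun) (p s : nat) :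
    set (p.-tuple (measurableTypeR R) -> R) :=
  [set f | exists2 S : {set 'I_p}, (#|S| <= s)%N & additive_class H S f].

End rkhs.

Section adaptation.
Context {R : realType}.
Variables (mu : nat -> R) (p n : nat).

Definition log_term (s : nat) (a : R) : R :=
  ln (1 + p%:R * a / s%:R ^+ 2).

Definition nu_cond (s : nat) (a : R) (v : nat) : Prop :=
  (0 < v)%N /\ mu v <= Num.sqrt (v%:R * log_term s a) / n%:R.

Definition nuH (s : nat) (a : R) : nat :=
  xget 0%N [set v | nu_cond s a v /\ forall w, nu_cond s a w -> (v <= w)%N].

(* [2 ^ k < 2 * nu] stands for 2^(k-1) < nu, as k may be 0. *)
Definition Vset (a : R) : set nat :=
  [set v | exists2 k : nat, v = (2 ^ k)%N &
     exists s, [/\ (1 <= s <= p)%N, (2 ^ k < 2 * nuH s a)%N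
                 & (nuH s a <= 2 ^ k)%N]].

Definition AH : R :=
  sup [set a : R | 1 <= a /\ a <= ln (expR 1 * #|` fset_set (Vset a) |%:R)].

Definition VH : set nat := Vset AH.

Definition Sgrid : seq nat :=
  [seq (2 ^ k)%N | k <-
     iota 0 `|Num.ceil (ln (Num.sqrt (p%:R * AH)) / ln 2)|%N] ++ [:: p].

Definition tau_adapt_sq (s : nat) : R :=
  let bulk := s%:R / n%:R * Num.sqrt ((nuH s AH)%:R * log_term s AH) in
  if s%:R < Num.sqrt (p%:R * AH)
  then Num.max (s%:R / n%:R * log_term s AH) bulk
  else bulk.

Definition tau_adapt (s : nat) : R := Num.sqrt (tau_adapt_sq s).

End adaptation.

Section statistics.
Context {R : realType}.

Definition gauss_vec (d : nat) : probability (d.-tuple (measurableTypeR R)) R :=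
  prod_prob (normal_prob (0 : R) 1) d.

Definition sqnorm (d : nat) (g : d.-tuple (measurableTypeR R)) : R :=
  \sum_(i < d) (tnth g i : R) ^+ 2.

Definition alpha (r : R) (d : nat) : R :=
  (\int[gauss_vec d]_(g in [set g | d%:R + r ^+ 2 <= sqnorm g]) sqnorm g)
  / fine (gauss_vec d [set g | d%:R + r ^+ 2 <= sqnorm g]).

Variables (p n : nat).

Definition Xstat {Omega : Type} (psi : nat -> R -> R)
    (Y : (p.-tuple (measurableTypeR R) -> R) -> Omega -> R) (w : Omega)
    (k : nat) (j : 'I_p) : R :=
  Y (fun x => psi k (tnth x j)) w.

(* Below, X is the array of the X_{k,j}, k >= 1. *)
Variable X : nat -> 'I_p -> R.

Definition Estat (j : 'I_p) (d : nat) : R :=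
  n%:R * \sum_(1 <= k < d.+1) X k j ^+ 2.

Definition Tstat (r : R) (d : nat) : R :=
  \sum_(j < p)
    (Estat j d - alpha r d) * (d%:R + r ^+ 2 <= Estat j d)%R%:R.

Variables (D K2 K2' K3 C : R) (mu : nat -> R).

Let A : R := AH mu p n.

Definition dnu (v : nat) : nat := maxn v `|Num.ceil D|%N.

Definition rnu (v s : nat) : R :=
  K2 * ((dnu v)%:R * log_term p s A) `^ (4%:R^-1).

Definition rs (s : nat) : R := K2' * Num.sqrt (log_term p s A).

Definition phi (v s : nat) : bool :=
  if s%:R < Num.sqrt (p%:R * A) then
    if Num.sqrt (log_term p s A) <= K3 * Num.sqrt (dnu v)%:R then
      C * s%:R * Num.sqrt (v%:R * log_term p s A) < Tstat (rnu v s) (dnu v)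
    else
      C * s%:R * log_term p s A < Tstat (rs s) (dnu v)
  else
    v%:R * p%:R + C * Num.sqrt (v%:R * p%:R * A)
      < n%:R * \sum_(j < p) \sum_(1 <= k < v.+1) X k j ^+ 2.

Definition max_test : nat :=
  \max_(v <- fset_set (VH mu p n)) \max_(s <- Sgrid mu p n) phi v s.

End statistics.

(* Main.v *)
Require Import Defs.
From HB Require Import structures.
From mathcomp Require Import all_boot all_order all_algebra.
From mathcomp Require Import finmap.
From mathcomp Require Import all_classical all_reals all_analysis.
From mathcomp Require Import measurable_realfun.
From mathcomp Require Import ring lra.
Import Order.TTheory GRing.Theory Num.Theory.
Import numFieldNormedType.Exports.
Local Open Scope classical_set_scope.
Local Open Scope ring_scope.
Set Implicit Arguments.
Unset Strict Implicit.
Unset Printing Implicit Defensive.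

(** The test rejects when one of the statistics indexed by a dyadic resolution
    [v] and a sparsity level [s] exceeds its threshold. A union bound controls
    the error of the first kind, and for each signal a single well chosen pair
    (v, s) controls the error of the second kind. All error probabilities come
    out of order [1 / C], so that [C] of order [1 / eta] suffices.

    Law of the data. The functions [psi_k(x_j)] are orthonormal in L^2 of the
    cube, because the components are centred and [lebesgue_cube] is a product.
    White noise is only known through the laws of its linear combinations; by
    [cramer_wold] these determine its law on the array of these functions, which
    is therefore the [p]-fold product of [gauss_vec] ([white_noise_array]). Hence
    each statistic is a function of a shifted standard Gaussian array
    ([model_law]), and everything reduces to product measures.

    Deviations. The chi-square statistics are handled by Chernoff's method with
    explicit Gaussian integrals. For a truncated summand
    [F = (E - alpha) 1(E >= d + r^2)] the constant [alpha] makes the mean vanish,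
    so a second order expansion bounds the moment generating function by
    [1 + rho^2 Q], where [Q] is the exponentially weighted tail beyond
    [d + r^2] ([truncated_mgf]); this needs [alpha - d] to be at most of order
    [r^2], which follows from a hazard rate bound for the chi-square law
    ([chi2_tail_decay], [alpha_le]). With [L = log (1 + p A / s^2)], the two
    choices of [r] in the test both give [Q <= exp (- 2 L)] ([calibrated_bulk],
    [calibrated_tail]), that is [p Q <= s^2 / (A (1 + p A / s^2))], and this
    makes all sparse tests fluctuate at the scale of their thresholds.

    First kind. The number of resolutions is at most [exp (A - 1)] ([card_VH]),
    while each sparse probability is exponentially small in a multiple of [C A],
    since [A <= 8 s L] ([AH_le_sparse]); what remains is summable over the dyadic
    [s] ([null_risk]).

    Second kind. A function of the unit ball of the RKHS has energy at most of
    order [mu_(v+1)] outside the span of [psi_1, ..., psi_v] ([rkhs_tail]). At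
    the dyadic resolution following [nuH s] this loss, summed over the [s] active
    components, is below the separation rate, so the retained energy exceeds the
    threshold of the test with the dyadic sparsity preceding [s] (or with [p] in
    the dense case). The active coordinates are then large by
    [chi2_lower_tail], and the centred sum over the other ones is small
    ([power_risk]). *)

(** * Integration against product probabilities *)

Section prod_prob_integral.
Context {R : realType} {d : measure_display} {T : measurableType d}.
Variable P : probability T R.
Local Open Scope ereal_scope.

Lemma ge0_integral_prod_prob_cons n (F : n.+1.-tuple T -> \bar R) :
  measurable_fun setT F -> (forall t, 0 <= F t) ->
  \int[prod_prob P n.+1]_t F t =
  \int[P]_x \int[prod_prob P n]_t F [tuple of x :: t].
Proof.
move=> mF F0; rewrite /= ge0_integral_distribution//.
rewrite fubini_tonelli1//.
  by apply: measurableT_comp => //; exact: measurable_tuple_cons.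
by move=> x; exact: F0.
Qed.

Lemma measurable_prod_tnth n (g : 'I_n -> T -> R) :
  (forall i, measurable_fun setT (g i)) ->
  measurable_fun setT (fun t : n.-tuple T => \prod_(i < n) g i (tnth t i))%R.
Proof.
move=> mg; apply: measurable_prod => i _.
by apply: measurableT_comp => //; exact: measurable_tnth.
Qed.

Lemma ge0_integral_prod_prob_prod n (g : 'I_n -> T -> R) :
  (forall i, measurable_fun setT (g i)) -> (forall i x, 0 <= g i x)%R ->
  \int[prod_prob P n]_t (\prod_(i < n) g i (tnth t i))%:E =
  \prod_(i < n) \int[P]_x (g i x)%:E.
Proof.
elim: n g => [|n IH] g mg g0.
  rewrite big_ord0; under eq_integral do rewrite big_ord0.
  rewrite integral_cst// mul1e; exact: (probability_setT (prod_prob P 0)).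
rewrite ge0_integral_prod_prob_cons//; last 2 first.
- by apply/measurable_EFinP; exact: measurable_prod_tnth.
- by move=> t; rewrite lee_fin; apply: prodr_ge0.
rewrite big_ord_recl -(IH (fun i => g (lift ord0 i)))//.
under eq_integral => x _.
  under eq_integral => t _.
    rewrite big_ord_recl /= tnth0 EFinM.
    under eq_bigr do rewrite tnthS.
    over.
  rewrite ge0_integralZl//; last 3 first.
  - apply/measurable_EFinP.
    exact: (measurable_prod_tnth (g := fun i => g (lift ord0 i))).
  - by move=> t _; rewrite lee_fin; apply: prodr_ge0.
  - by rewrite lee_fin.
  over.
rewrite ge0_integralZr//.
- exact/measurable_EFinP.
- by move=> x _; rewrite lee_fin.
- by apply: integral_ge0 => t _; rewrite lee_fin; apply: prodr_ge0.
Qed.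

Lemma prod_prob_tnth n (i : 'I_n) (A : set T) : measurable A ->
  prod_prob P n [set t | A (tnth t i)] = P A.
Proof.
move=> mA; pose B j := if j == i then A else setT.
rewrite [X in prod_prob P n X](_ : _ = [set t | forall j, B j (tnth t j)]).
  rewrite prod_prob_box => [|j]; last by rewrite /B; case: ifP.
  rewrite (bigD1 i)//= /B eqxx big1 ?mule1// => j /negbTE ->.
  exact: probability_setT.
apply/seteqP; split => t /=.
  by move=> At j; rewrite /B; case: eqP => // ->.
by move=> /(_ i); rewrite /B eqxx.
Qed.

Lemma prod_prob_tnth2 n (i j : 'I_n) (A B : set T) : i != j ->
  measurable A -> measurable B ->
  prod_prob P n [set t | A (tnth t i) /\ B (tnth t j)] = P A * P B.
Proof.
move=> ij mA mB.
pose C k := if k == i then A else if k == j then B else setT.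
rewrite [X in prod_prob P n X](_ : _ = [set t | forall j, C j (tnth t j)]).
  rewrite prod_prob_box => [|k]; last by rewrite /C; do 2 case: ifP => // _.
  rewrite (bigD1 i)//= (bigD1 j)//=; last by rewrite eq_sym.
  rewrite /C !eqxx eq_sym (negbTE ij) big1 ?mule1// => k /andP[/negbTE -> /negbTE ->].
  exact: probability_setT.
apply/seteqP; split => t /=.
  by move=> [At Bt] k; rewrite /C; case: eqP => [->//|_]; case: eqP => // ->.
move=> H; split; first by have := H i; rewrite /C eqxx.
by have := H j; rewrite /C eqxx eq_sym (negbTE ij).
Qed.

Lemma ge0_integral_prod_prob_tnth n (i : 'I_n) (f : T -> \bar R) :
  measurable_fun setT f -> (forall x, 0 <= f x) ->
  \int[prod_prob P n]_t f (tnth t i) = \int[P]_x f x.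
Proof.
move=> mf f0; have mt := @measurable_tnth _ T n i.
transitivity (\int[pushforward (prod_prob P n) (fun t => tnth t i)]_x f x).
  by rewrite ge0_integral_pushforward.
by apply: eq_measure_integral => A mA _; exact: prod_prob_tnth.
Qed.

Lemma integrable_prod_prob_tnth n (i : 'I_n) (f : T -> R) :
  P.-integrable setT (EFin \o f) ->
  (prod_prob P n).-integrable setT (EFin \o (fun t => f (tnth t i))).
Proof.
move=> /integrableP[mf foo]; apply/integrableP; split.
  apply/measurable_EFinP; apply: measurableT_comp; last exact: measurable_tnth.
  exact/measurable_EFinP.
rewrite (ge0_integral_prod_prob_tnth i (f := fun x => `|(EFin \o f) x|))//.
exact: measurableT_comp.
Qed.

Lemma integral_prod_prob_tnth n (i : 'I_n) (f : T -> R) :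
  P.-integrable setT (EFin \o f) ->
  \int[prod_prob P n]_t (f (tnth t i))%:E = \int[P]_x (f x)%:E.
Proof.
move=> fi; have mt := @measurable_tnth _ T n i.
have mf := measurable_int _ fi.
transitivity (\int[pushforward (prod_prob P n) (fun t => tnth t i)]_x (f x)%:E).
  rewrite (@integral_pushforward _ _ _ _ _ _ mt _ setT (EFin \o f))//.
  exact: integrable_prod_prob_tnth.
by apply: eq_measure_integral => A mA _; exact: prod_prob_tnth.
Qed.

Lemma integral_prod_prob_tnth2 n (i j : 'I_n) (f g : T -> R) : i != j ->
  P.-integrable setT (EFin \o f) -> P.-integrable setT (EFin \o g) ->
  (prod_prob P n).-integrable setT
    (EFin \o (fun t => f (tnth t i) * g (tnth t j))%R) /\
  \int[prod_prob P n]_t (f (tnth t i) * g (tnth t j))%:E =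
  (\int[P]_x (f x)%:E) * (\int[P]_x (g x)%:E).
Proof.
move=> ij fi gi.
have mf : measurable_fun setT f by exact/measurable_EFinP/(measurable_int _ fi).
have mg : measurable_fun setT g by exact/measurable_EFinP/(measurable_int _ gi).
have mij : measurable_fun setT (fun t : n.-tuple T => (tnth t i, tnth t j)).
  by apply/measurable_fun_pairP; split; exact: measurable_tnth.
pose Xmix := isMeasurableFun.Build _ _ _ _ _ mij.
pose X : {mfun _ >-> _} := HB.pack (fun t : n.-tuple T => (tnth t i, tnth t j)) Xmix.
have law A : measurable A -> distribution (prod_prob P n) X A = (P \x P) A.
  move=> mA; apply/esym; apply: product_measure_unique => // B C mB mC.
  exact: prod_prob_tnth2.
have mh : measurable_fun setT (fun z : T * T => f z.1 * g z.2)%R.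
  by apply: measurable_funM; exact: measurableT_comp.
have hi : (P \x P).-integrable setT (EFin \o (fun z : T * T => f z.1 * g z.2)%R).
  apply/integrable12ltyP; first exact/measurable_EFinP.
  under eq_integral => x _.
    under eq_integral => y _.
      rewrite /= normrM EFinM; over.
    rewrite ge0_integralZl//; last by apply/measurable_EFinP; exact: measurableT_comp.
    over.
  rewrite ge0_integralZr//; last 2 first.
  - by apply/measurable_EFinP; exact: measurableT_comp.
  - exact: integral_ge0.
  move: fi gi => /integrableP[_ fi] /integrableP[_ gi].
  by rewrite lte_mul_pinfty// ?ge0_fin_numE//; exact: integral_ge0.
have hX : (prod_prob P n).-integrable setT
    (EFin \o (fun t => f (tnth t i) * g (tnth t j))%R).
  apply/integrableP; split.
    by apply/measurable_EFinP; apply: measurable_funM;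
      apply: measurableT_comp => //; exact: measurable_tnth.
  have := @ge0_integral_distribution _ _ _ _ _ (prod_prob P n) X
    (fun z => `|(f z.1 * g z.2)%:E|).
  rewrite /comp /= => <-//; last first.
    by apply/measurable_EFinP; exact: measurableT_comp.
  rewrite (@eq_measure_integral _ _ _ setT (P \x P)); last first.
    by move=> A mA _; exact: law.
  by move: hi => /integrableP[].
split => //.
transitivity (\int[distribution (prod_prob P n) X]_z (f z.1 * g z.2)%:E).
  rewrite (integral_distribution (f := fun z => (f z.1 * g z.2)%:E))//.
  exact/measurable_EFinP.
transitivity (\int[P \x P]_z (f z.1 * g z.2)%:E).
  by apply: eq_measure_integral => A mA _; exact: law.
rewrite -integral12_prod_meas1//.
transitivity (\int[P]_x ((f x)%:E * \int[P]_y (g y)%:E)).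
  apply: eq_integral => x _; rewrite /fubini_F /=.
  by under eq_integral do rewrite EFinM; rewrite integralZl.
rewrite -(fineK (integrable_fin_num _ gi))// integralZr//.
Qed.

End prod_prob_integral.

(** * Gaussian laws on the line and their sums *)

Section density.
Context {R : realType} {d : measure_display} {T : measurableType d}.
Variables (mu nu : {measure set T -> \bar R}) (g : T -> R).
Hypothesis mg : measurable_fun setT g.
Hypothesis g0 : forall x, 0 <= g x.
Hypothesis nuE : forall A, measurable A -> nu A = (\int[mu]_(x in A) (g x)%:E)%E.
Local Open Scope ereal_scope.
Import HBNNSimple.

(** Checked on simple functions and extended by monotone convergence. *)
Lemma ge0_integral_density (f : T -> \bar R) :
  measurable_fun setT f -> (forall x, 0 <= f x) ->
  \int[nu]_x f x = \int[mu]_x (f x * (g x)%:E).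
Proof.
have mEg : measurable_fun setT (fun x => (g x)%:E) by exact/measurable_EFinP.
have simple (h : {nnsfun T >-> R}) :
    \int[nu]_x (h x)%:E = \int[mu]_x ((h x)%:E * (g x)%:E).
  under [LHS]eq_integral do rewrite fimfunE -fsumEFin//.
  rewrite [LHS]ge0_integral_fsum//; last 2 first.
    - by move=> r; exact/measurable_EFinP/measurableT_comp.
    - by move=> n x _; rewrite EFinM nnfun_muleindic_ge0.
  under [RHS]eq_integral => x _.
    rewrite fimfunE -fsumEFin// muleC ge0_mule_fsumr; last first.
      by move=> r; rewrite EFinM nnfun_muleindic_ge0.
    over.
  rewrite [RHS]ge0_integral_fsum//; last 2 first.
    - move=> r; apply/emeasurable_funM => //.
      by apply/measurable_EFinP; do 2 apply/measurableT_comp => //.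
    - move=> n x _; apply: mule_ge0; first by rewrite lee_fin.
      by rewrite EFinM nnfun_muleindic_ge0.
  apply: eq_fsbigr => r _.
  rewrite integralZl_indic_nnsfun//= integral_indic// setIT nuE//.
  transitivity (\int[mu]_x (r%:E * ((g x)%:E * (\1_(h @^-1` [set r]) x)%:E))); last first.
    by apply: eq_integral => x _; rewrite EFinM muleCA.
  have [r0|r0] := leP 0%R r.
    rewrite ge0_integralZl//; last 2 first.
    - by apply: emeasurable_funM => //; exact/measurable_EFinP.
    - by move=> x _; rewrite mule_ge0 ?lee_fin.
    congr (_ * _); rewrite [LHS]integral_mkcond.
    by apply: eq_integral => x _; rewrite epatch_indic.
  rewrite preimage_nnfun0// integral_set0 mule0 integral0_eq// => x _.
  by rewrite indicE in_set0 !mule0.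
move=> mf f0.
pose f_ := nnsfun_approx measurableT mf.
transitivity (limn (fun n => \int[nu]_x (f_ n x)%:E)).
  rewrite -monotone_convergence//=.
  - apply: eq_integral => ? /[!inE] xD; apply/esym/cvg_lim => //=.
    exact: cvg_nnsfun_approx.
  - by move=> n; exact/measurable_EFinP/measurable_funTS.
  - by move=> n ? _; rewrite lee_fin.
  - by move=> ? _ ? ? mn; rewrite lee_fin; exact/lefP/nd_nnsfun_approx.
transitivity (limn (fun n => \int[mu]_x ((f_ n x)%:E * (g x)%:E))).
  by apply/congr_lim/funext => n; exact: simple.
rewrite -monotone_convergence//=.
- apply: eq_integral => x _; apply/cvg_lim => //=.
  apply: cvgeZr => //; exact: cvg_nnsfun_approx.
- by move=> n; apply: emeasurable_funM => //; exact/measurable_EFinP/measurable_funTS.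
- by move=> n x _; rewrite mule_ge0 ?lee_fin.
- move=> x _ m n mn; rewrite lee_wpmul2r ?lee_fin//.
  exact/lefP/nd_nnsfun_approx.
Qed.

End density.

Section lebesgue_affine.
Context {R : realType}.
Local Notation leb := (@lebesgue_measure R).
Local Open Scope ereal_scope.

(** By uniqueness of the Lebesgue measure, it is enough to compare it with its
    rescaled image on intervals. *)
Lemma ge0_integral_affine (a b : R) (f : R -> \bar R) : a != 0%R ->
  measurable_fun [set: measurableTypeR R] f -> (forall x, 0 <= f x) ->
  \int[leb]_x f (a * x + b)%R = (`|a|^-1)%:E * \int[leb]_x f x.
Proof.
move=> a0 mf f0.
have ma : measurable_fun [set: measurableTypeR R]
    ((fun x => a * x + b)%R : measurableTypeR R -> measurableTypeR R).
  by apply: measurable_funD => //; exact: measurable_funM.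
pose nu : {measure set (measurableTypeR R) -> \bar R} :=
  measure_function_pushforward__canonical__measure_function_Measure leb ma.
have an : (0 <= `|a|)%R by [].
have key A : measurable A -> leb A = mscale (NngNum an) nu A.
  apply: lebesgue_measure_unique => _ [[x1 x2] _ <-] /=.
  rewrite /mscale /= /nu /pushforward lebesgue_measure_itv/= lte_fin.
  have [a_gt0|a_lt0|/eqP] := ltgtP 0%R a; last by rewrite eq_sym (negbTE a0).
    rewrite (_ : _ @^-1` _ = `]((x1 - b) / a)%R, ((x2 - b) / a)%R]%classic); last first.
      apply/seteqP; split => x /=; rewrite !in_itv/= ltr_pdivrMr// ler_pdivlMr//;
        by rewrite ltrBlDr lerBrDr mulrC.
    rewrite lebesgue_measure_itv/= lte_fin ltr_pM2r ?invr_gt0// ltrD2r.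
    case: ifP => _; last by rewrite mule0.
    by rewrite -!EFinD -EFinM gtr0_norm//; congr EFin; field.
  rewrite (_ : _ @^-1` _ = `[((x2 - b) / a)%R, ((x1 - b) / a)%R[%classic); last first.
    apply/seteqP; split => x /=; rewrite !in_itv/= ltr_ndivlMr// ler_ndivrMr//;
      rewrite ltrBlDr lerBrDr mulrC => /andP[? ?]; by apply/andP.
  rewrite lebesgue_measure_itv/= lte_fin ltr_nM2r ?invr_lt0// ltrD2r.
  case: ifP => _; last by rewrite mule0.
  by rewrite -!EFinD -EFinM ltr0_norm//; congr EFin; field.
transitivity (\int[nu]_x f x); first by rewrite ge0_integral_pushforward.
rewrite [in RHS](eq_measure_integral (mscale (NngNum an) nu)); last first.
  by move=> A mA _; exact: key.
rewrite ge0_integral_mscale//= muleA -EFinM mulVf ?normr_eq0// mul1e.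
by [].
Qed.

End lebesgue_affine.

Section gaussian_line.
Context {R : realType}.
Local Notation leb := (@lebesgue_measure R).
Implicit Types (m s v a b x : R).

(** [normal_pdf] parametrized by the variance, the form in which completing the
    square is a rational identity. *)
Definition gauss_pdf m v x : R :=
  (Num.sqrt (v * pi *+ 2))^-1 * expR (- (x - m) ^+ 2 / (v *+ 2)).

Lemma gauss_pdfE m v : 0 < v -> normal_pdf m (Num.sqrt v) = gauss_pdf m v.
Proof.
move=> v0; rewrite normal_pdfE ?gt_eqF ?sqrtr_gt0//.
by rewrite /normal_peak /normal_fun sqr_sqrtr ?ltW.
Qed.

Lemma measurable_gauss_pdf m v : 0 < v -> measurable_fun setT (gauss_pdf m v).
Proof. by move=> v0; rewrite -gauss_pdfE//; exact: measurable_normal_pdf. Qed.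

Lemma gauss_pdf_ge0 m v x : 0 <= gauss_pdf m v x.
Proof. by rewrite mulr_ge0 ?invr_ge0 ?expR_ge0. Qed.

Lemma integral_gauss_pdf m v : 0 < v ->
  (\int[leb]_x (gauss_pdf m v x)%:E = 1)%E.
Proof. by move=> v0; rewrite -gauss_pdfE// integral_normal_pdf. Qed.

Lemma ge0_integral_normal m v (f : R -> \bar R) : 0 < v ->
  measurable_fun [set: measurableTypeR R] f -> (forall x, 0 <= f x)%E ->
  (\int[normal_prob m (Num.sqrt v)]_x f x =
   \int[leb]_x (f x * (gauss_pdf m v x)%:E))%E.
Proof.
move=> v0 mf f0.
apply: ge0_integral_density => //; first exact: measurable_gauss_pdf.
  by move=> x; exact: gauss_pdf_ge0.
by move=> A mA; rewrite -gauss_pdfE.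
Qed.

Lemma normal_prob_gauss_pdf m v (A : set (measurableTypeR R)) : 0 < v ->
  measurable A ->
  normal_prob m (Num.sqrt v) A =
  (\int[leb]_x ((\1_A x)%:E * (gauss_pdf m v x)%:E))%E.
Proof.
move=> v0 mA; rewrite /normal_prob gauss_pdfE// integral_mkcond.
by apply: eq_integral => x _; rewrite epatch_indic muleC.
Qed.

Lemma gaussian_rv_affine a m :
  gaussian_rv (normal_prob 0 1) (fun x : measurableTypeR R => a * x + m) m (a ^+ 2).
Proof.
have ma : measurable_fun [set: measurableTypeR R] (fun x : measurableTypeR R => a * x + m).
  by apply: measurable_funD => //; exact: measurable_funM.
split => // A mA; rewrite sqrf_eq0; case: eqVneq => [->|a0].
  rewrite diracE; have [Am|Am] := boolP (m \in A).
    rewrite (_ : _ @^-1` _ = setT) ?probability_setT//.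
    by apply/seteqP; split => // x _ /=; rewrite mul0r add0r; exact/set_mem.
  rewrite (_ : _ @^-1` _ = set0) ?measure0//.
  apply/seteqP; split => // x /=; rewrite mul0r add0r => /mem_set.
  by rewrite (negbTE Am).
have a2 : 0 < a ^+ 2 by rewrite exprn_even_gt0.
have mfA : measurable ((fun x : measurableTypeR R => a * x + m) @^-1` A).
  by rewrite -[X in measurable X]setTI; exact: ma.
have := normal_prob_gauss_pdf 0 ltr01 mfA; rewrite sqrtr1 => E1.
have E2 := normal_prob_gauss_pdf m a2 mA.
rewrite [LHS]E1 [RHS]E2 {E1 E2}.
transitivity (\int[leb]_x (`|a|%:E * ((\1_A (a * x + m))%:E * (gauss_pdf m (a ^+ 2) (a * x + m))%:E)))%E.
  apply: eq_integral => x _; rewrite -!EFinM; congr (_%:E); rewrite [RHS]mulrCA; congr (_ * _).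
  rewrite /gauss_pdf mul1r addrK mulrA; congr (_ * expR _).
    rewrite -mulrnAr sqrtrM ?sqr_ge0// sqrtr_sqr invfM mulrA divff ?mul1r//.
    by rewrite normr_eq0.
  by rewrite subr0 exprMn -mulr_natr -[a ^+ 2 *+ 2]mulr_natr; field.
rewrite ge0_integralZl//; last 2 first.
- apply: emeasurable_funM; apply/measurable_EFinP; apply: measurableT_comp => //.
  exact: measurable_gauss_pdf.
- by move=> x _; rewrite mule_ge0 ?lee_fin ?gauss_pdf_ge0.
rewrite (@ge0_integral_affine _ a m (fun x => (\1_A x)%:E * (gauss_pdf m (a ^+ 2) x)%:E)%E)//.
- by rewrite muleA -EFinM divff ?mul1e// normr_eq0.
- apply: emeasurable_funM; apply/measurable_EFinP => //.
  exact: measurable_gauss_pdf.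
- by move=> x; rewrite mule_ge0 ?lee_fin ?gauss_pdf_ge0.
Qed.

(** Completing the square: the product of the two densities, as a function of
[u], is a Gaussian density times the density of the sum. *)
Lemma gauss_pdf_conv v w u z : 0 < v -> 0 < w ->
  gauss_pdf 0 v u * gauss_pdf 0 w (z - u) =
  gauss_pdf 0 (v + w) z * gauss_pdf (z * v / (v + w)) (v * w / (v + w)) u.
Proof.
move=> v0 w0; have vw0 := addr_gt0 v0 w0; have pi0 := @pi_gt0 R.
have p0 (t : R) : 0 < t -> 0 <= t * pi *+ 2 by move=> t0; rewrite mulrn_wge0// mulr_ge0// ltW.
rewrite /gauss_pdf mulrACA [RHS]mulrACA -!expRD -!invfM -!sqrtrM ?p0//.
congr (_ * _).
  have E (q : R) : v * q *+ 2 * (w * q *+ 2) =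
      (v + w) * q *+ 2 * (v * w / (v + w) * q *+ 2).
    by field; rewrite gt_eqF.
  by rewrite E.
apply: (f_equal (@expR R)); field.
by rewrite !gt_eqF.
Qed.

End gaussian_line.

Lemma measure_indic {R : realType} {d} {T : measurableType d}
    (m : {measure set T -> \bar R}) (A : set T) : measurable A ->
  m A = (\int[m]_x (\1_A x)%:E)%E.
Proof. by move=> mA; rewrite integral_indic// setIT. Qed.

Section gaussian_convolution.
Context {R : realType}.
Local Notation leb := (@lebesgue_measure R).
Local Open Scope ereal_scope.

Lemma gaussian_rv_integral {d} {T : measurableType d} (P : probability T R)
    (X : T -> R) (v : R) (f : R -> \bar R) : (0 <= v)%R -> gaussian_rv P X 0 v ->
  measurable_fun [set: measurableTypeR R] f -> (forall x, 0 <= f x) ->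
  \int[P]_x f (X x) = if v == 0%R then f 0%R else
    \int[leb]_x (f x * (gauss_pdf 0 v x)%:E).
Proof.
move=> v0 [mX lawX] mf f0.
have mX' : measurable_fun setT (X : T -> measurableTypeR R) by [].
transitivity (\int[pushforward P (X : T -> measurableTypeR R)]_x f x).
  by rewrite ge0_integral_pushforward.
case: eqVneq lawX => [_|vn0] lawX.
  rewrite (eq_measure_integral (dirac (0%R : measurableTypeR R))); last first.
    by move=> A mA _; exact: lawX.
  by rewrite integral_dirac// diracT mul1e.
rewrite -ge0_integral_normal// ?lt_def ?vn0//.
by apply: eq_measure_integral => A mA _; exact: lawX.
Qed.

(** When both variances are positive, [gauss_pdf_conv] factors the joint density so
    that one of the two integrals is that of a Gaussian density. *)
Lemma gaussian_rv_pair {d1 d2} {T1 : measurableType d1} {T2 : measurableType d2}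
    (P : probability T1 R) (Q : probability T2 R) (X : T1 -> R) (Y : T2 -> R)
    (v w : R) : (0 <= v)%R -> (0 <= w)%R ->
  gaussian_rv P X 0 v -> gaussian_rv Q Y 0 w ->
  gaussian_rv (P \x Q) (fun z => X z.1 + Y z.2)%R 0 (v + w).
Proof.
move=> v0 w0 gX gY; have [mX _] := gX; have [mY _] := gY.
have mXY : measurable_fun setT (fun z : T1 * T2 => X z.1 + Y z.2)%R.
  by apply: measurable_funD; exact: measurableT_comp.
split => // A mA.
have mXYA : measurable ((fun z : T1 * T2 => X z.1 + Y z.2)%R @^-1` A).
  by rewrite -[X in measurable X]setTI; exact: mXY.
have m1A : measurable_fun [set: measurableTypeR R] (fun x => (\1_A x)%:E : \bar R).
  by apply/measurable_EFinP.
have shift (c : R) : measurable_fun [set: measurableTypeR R]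
    (fun x : R => (\1_A (c + x)%R)%:E : \bar R).
  by apply/measurable_EFinP; apply: measurableT_comp => //; exact: measurable_funD.
have lhsE : (P \x Q) ((fun z : T1 * T2 => X z.1 + Y z.2)%R @^-1` A) =
    \int[P]_x \int[Q]_y (\1_A (X x + Y y)%R)%:E.
  transitivity (\int[P \x Q]_z (\1_A (X z.1 + Y z.2)%R)%:E).
    exact: measure_indic.
  rewrite fubini_tonelli1//.
  by apply/measurable_EFinP; exact: measurableT_comp.
pose h (u : R) : \bar R := if w == 0%R then (\1_A u)%:E else
    \int[leb]_y ((\1_A (u + y)%R)%:E * (gauss_pdf 0 w y)%:E).
have hE : \int[P]_x \int[Q]_y (\1_A (X x + Y y)%R)%:E = \int[P]_x h (X x).
  apply: eq_integral => x _.
  rewrite (gaussian_rv_integral (f := fun y => (\1_A (X x + y)%R)%:E) w0 gY)//.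
  by rewrite /h; case: eqP => // _; rewrite addr0.
have h0 u : 0 <= h u.
  rewrite /h; case: eqP => _; rewrite ?lee_fin//.
  by apply: integral_ge0 => y _; rewrite mule_ge0 ?lee_fin ?gauss_pdf_ge0.
have [w_eq0|wn0] := eqVneq w 0%R.
  have hw : h = fun u => (\1_A u)%:E by rewrite /h w_eq0 eqxx.
  rewrite [LHS]lhsE hE hw w_eq0 addr0 -(proj2 gX)//.
  have mXA : measurable (X @^-1` A).
    by rewrite -[X in measurable X]setTI; exact: mX.
  exact/esym/(@measure_indic R _ _ P (X @^-1` A)).
have w_gt0 : (0 < w)%R by rewrite lt_def wn0.
have vw_gt0 : (0 < v + w)%R by rewrite ltr_wpDl.
have mgw : measurable_fun [set: measurableTypeR R] (fun x => (gauss_pdf 0 w x)%:E : \bar R).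
  by apply/measurable_EFinP; exact: measurable_gauss_pdf.
rewrite [LHS]lhsE hE gt_eqF//.
have hN : normal_prob 0 (Num.sqrt (v + w)) A =
    \int[leb]_x ((\1_A x)%:E * (gauss_pdf 0 (v + w) x)%:E).
  exact: normal_prob_gauss_pdf.
rewrite [RHS]hN.
pose F (p : measurableTypeR R * measurableTypeR R) : \bar R :=
  (\1_A p.2)%:E * (gauss_pdf 0 w (p.2 - p.1)%R)%:E.
have mF : measurable_fun setT F.
  apply: emeasurable_funM; apply/measurable_EFinP; apply: measurableT_comp => //.
    exact: measurable_gauss_pdf.
  exact: measurable_funB.
have F0 p : 0 <= F p by rewrite mule_ge0 ?lee_fin ?gauss_pdf_ge0.
have hsub u : h u = \int[leb]_z F (u, z).
  rewrite /h (negbTE wn0).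
  pose f z := (\1_A z)%:E * (gauss_pdf 0 w (z - u)%R)%:E.
  have mf : measurable_fun [set: measurableTypeR R] f.
    apply: emeasurable_funM => //; apply/measurable_EFinP; apply: measurableT_comp => //.
      exact: measurable_gauss_pdf.
    exact: measurable_funB.
  have f0 z : 0 <= f z by rewrite mule_ge0 ?lee_fin ?gauss_pdf_ge0.
  transitivity (\int[leb]_y f (1 * y + u)%R).
    by apply: eq_integral => y _; rewrite /f mul1r addrK addrC.
  by rewrite (ge0_integral_affine u (oner_neq0 R) mf f0) normr1 invr1 mul1e.
have mh : measurable_fun [set: measurableTypeR R] h.
  rewrite (_ : h = fubini_F leb F); last exact/funext.
  exact: measurable_fun_fubini_tonelli_F.
rewrite (gaussian_rv_integral v0 gX mh h0).
case: eqVneq => [v_eq0|vn0].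
  rewrite /h (negbTE wn0) v_eq0 add0r.
  by apply: eq_integral => y _; rewrite add0r.
have v_gt0 : (0 < v)%R by rewrite lt_def vn0.
have mgv : measurable_fun [set: measurableTypeR R] (fun x => (gauss_pdf 0 v x)%:E : \bar R).
  by apply/measurable_EFinP; exact: measurable_gauss_pdf.
pose G (p : measurableTypeR R * measurableTypeR R) : \bar R :=
  F p * (gauss_pdf 0 v p.1)%:E.
have mG : measurable_fun setT G.
  apply: emeasurable_funM => //; apply/measurable_EFinP; apply: measurableT_comp => //.
  exact: measurable_gauss_pdf.
have G0 p : 0 <= G p by apply: mule_ge0 => //; rewrite lee_fin gauss_pdf_ge0.
transitivity (\int[leb]_u \int[leb]_z G (u, z)).
  apply: eq_integral => u _; rewrite hsub /G /= ge0_integralZr//.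
    by apply: measurableT_comp => //; exact: measurable_pair1.
  by rewrite lee_fin gauss_pdf_ge0.
transitivity (\int[leb]_z \int[leb]_u G (u, z)); first exact: (fubini_tonelli G mG G0).
apply: eq_integral => z _.
have mgz : measurable_fun [set: measurableTypeR R]
    (fun x => (gauss_pdf (z * v / (v + w)) (v * w / (v + w)) x)%:E : \bar R).
  apply/measurable_EFinP; apply: measurable_gauss_pdf.
  by rewrite divr_gt0 ?mulr_gt0.
transitivity (\int[leb]_u ((\1_A z)%:E * (gauss_pdf 0 (v + w) z)%:E *
    (gauss_pdf (z * v / (v + w)) (v * w / (v + w)) u)%:E)).
  apply: eq_integral => u _; rewrite /G /F /= -!EFinM -mulrA [(gauss_pdf 0 w _ * _)%R]mulrC.
  by rewrite gauss_pdf_conv// mulrA.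
rewrite ge0_integralZl//; last 2 first.
- by move=> u _; rewrite lee_fin gauss_pdf_ge0.
- by rewrite mule_ge0 ?lee_fin ?gauss_pdf_ge0.
by rewrite integral_gauss_pdf ?mule1// divr_gt0 ?mulr_gt0.
Qed.

End gaussian_convolution.

Section gaussian_sums.
Context {R : realType} {d : measure_display} {T : measurableType d}.
Variable P : probability T R.

Lemma gaussian_rv_sum n (u : 'I_n -> T -> R) (v : 'I_n -> R) :
  (forall i, 0 <= v i) -> (forall i, gaussian_rv P (u i) 0 (v i)) ->
  gaussian_rv (prod_prob P n) (fun t => \sum_(i < n) u i (tnth t i)) 0
    (\sum_(i < n) v i).
Proof.
elim: n u v => [|n IH] u v v0 gu.
  rewrite big_ord0 (_ : (fun=> _) = cst 0); last by apply/funext => t; rewrite big_ord0.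
  split => // A mA; rewrite eqxx diracE.
  have [A0|A0] := boolP (_ \in A).
    rewrite (_ : _ @^-1` _ = setT) ?probability_setT//.
    by apply/seteqP; split => // x _ /=; exact/set_mem.
  rewrite (_ : _ @^-1` _ = set0) ?measure0//.
  by apply/seteqP; split => // x /= /mem_set; rewrite (negbTE A0).
have mS : measurable_fun setT (fun t : n.+1.-tuple T => \sum_(i < n.+1) u i (tnth t i)).
  apply: measurable_sum => i; apply: measurableT_comp; last exact: measurable_tnth.
  by case: (gu i).
have sv0 : 0 <= \sum_(i < n) v (lift ord0 i) by exact: sumr_ge0.
have [_ law] := gaussian_rv_pair (v0 ord0) sv0 (gu ord0) (IH (fun i => u (lift ord0 i)) (fun i => v (lift ord0 i))
    (fun i => v0 _) (fun i => gu _)).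
split; first exact: mS.
move=> A mA.
rewrite [X in if X == _ then _ else _]big_ord_recl.
rewrite [X in Num.sqrt X]big_ord_recl.
rewrite -[RHS](law A mA).
set X := fun t : n.+1.-tuple T => _.
transitivity ((P \x prod_prob P n)%E (@tuple_cons _ _ n @^-1` (X @^-1` A))); first by [].
have XE z : X (tuple_cons z) = u ord0 z.1 + \sum_(i < n) u (lift ord0 i) (tnth z.2 i).
  rewrite /X /tuple_cons big_ord_recl tnth0; congr (_ + _).
  by apply: eq_bigr => i _; rewrite tnthS.
by congr (_ _); apply/seteqP; split => z; rewrite /preimage /= XE.
Qed.

End gaussian_sums.

Section gaussian_square.
Context {R : realType}.
Local Notation leb := (@lebesgue_measure R).

(** The exponential moment of a squared, possibly shifted, standard Gaussian,
again by completing the square. *)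
Lemma expR_sqr_normal (mu b : R) : 2 * mu < 1 ->
  (\int[normal_prob 0 1]_x (expR (mu * (b + x) ^+ 2))%:E =
   ((Num.sqrt (1 - 2 * mu))^-1 * expR (mu * b ^+ 2 / (1 - 2 * mu)))%:E)%E.
Proof.
move=> mu1; have c0 : 0 < 1 - 2 * mu by rewrite subr_gt0.
have mE : measurable_fun [set: measurableTypeR R]
    (fun x => (expR (mu * (b + x) ^+ 2))%:E : \bar R).
  apply/measurable_EFinP; apply: measurableT_comp => //.
  by apply: measurable_funM => //; apply: measurable_funX; exact: measurable_funD.
have := ge0_integral_normal 0 ltr01 mE; rewrite sqrtr1 => ->; last first.
  by move=> x; rewrite lee_fin expR_ge0.
set k := _ * expR _; set c := 1 - 2 * mu.
have k0 : 0 <= k by rewrite mulr_ge0 ?expR_ge0.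
have ci0 : 0 < c^-1 by rewrite invr_gt0.
transitivity (\int[leb]_x (k%:E * (gauss_pdf (2 * mu * b / c) c^-1 x)%:E))%E.
  apply: eq_integral => x _; rewrite -!EFinM; apply: (f_equal EFin).
  rewrite /gauss_pdf /k mulrCA -expRD [RHS]mulrACA -expRD; congr (_ * _).
    rewrite -invfM -sqrtrM ?ltW//.
    have E (q : R) : 1 * q *+ 2 = (1 - 2 * mu) * (c^-1 * q *+ 2).
      by rewrite /c; field; rewrite gt_eqF.
    by rewrite E.
  by apply: (f_equal (@expR R)); rewrite /c; field; rewrite gt_eqF.
rewrite ge0_integralZl//.
- by rewrite integral_gauss_pdf ?mule1.
- by apply/measurable_EFinP; exact: measurable_gauss_pdf.
- by move=> x _; rewrite lee_fin gauss_pdf_ge0.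
Qed.

End gaussian_square.

(** * Laws determined by linear forms *)

Section step_function.
Context {R : realType}.
Implicit Types x y f : R.

Lemma bernoulli_le1 x m : 0 <= x -> x <= 1 -> (1 - x) ^+ m * (1 + m%:R * x) <= 1.
Proof.
move=> x0 x1; elim: m => [|m IH]; first by rewrite expr0 mul0r addr0 mul1r.
apply: le_trans IH; rewrite exprSr -mulrA ler_wpM2l ?exprn_ge0 ?subr_ge0//.
rewrite -natr1; have : 0 <= (m%:R + 1) * x ^+ 2 by rewrite mulr_ge0 ?sqr_ge0// addr_ge0.
by nra.
Qed.

Lemma bernoulli_ge x m : 0 <= x -> x <= 1 -> 1 - m%:R * x <= (1 - x) ^+ m.
Proof.
move=> x0 x1; elim: m => [|m IH]; first by rewrite expr0 mul0r subr0.
rewrite exprSr; apply: le_trans (ler_wpM2r _ IH); rewrite ?subr_ge0// -natr1.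
have : 0 <= m%:R * x ^+ 2 by rewrite mulr_ge0 ?sqr_ge0.
by nra.
Qed.

(** A polynomial in [f]. The factor [n] in the exponent settles the value of the
    limit at [1/2]. *)
Definition smooth_step n f : R := (1 - f ^+ n) ^+ (n * 2 ^ n).

Lemma smooth_step_itv n f : 0 <= f -> f <= 1 -> 0 <= smooth_step n f <= 1.
Proof.
move=> f0 f1; have fn1 : f ^+ n <= 1 by rewrite exprn_ile1.
have fn0 : 0 <= f ^+ n by rewrite exprn_ge0.
by rewrite exprn_ge0 ?subr_ge0//= exprn_ile1 ?subr_ge0// lerBlDr lerDl.
Qed.

Lemma smooth_step_cvg f : 0 <= f -> f <= 1 ->
  smooth_step n f @[n --> \oo] --> ((f < 2^-1)%R%:R : R).
Proof.
move=> f0 f1; have [fl|fg] := ltP f 2^-1.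
  (* Bernoulli's inequality reduces the claim to n (2 f)^n -> 0. *)
  pose r := Num.sqrt (2 * f).
  have r0 : 0 <= r by rewrite sqrtr_ge0.
  have r1 : r < 1.
    by rewrite -sqrtr1 ltr_sqrt//; lra.
  have rr : r ^+ 2 = 2 * f by rewrite sqr_sqrtr// mulr_ge0.
  have lo : (fun n => 1 - (1 - r)^-1 * r ^+ n) @ \oo --> (1 : R).
    rewrite -[X in _ --> X]subr0; apply: cvgB; first exact: cvg_cst.
    rewrite -(mulr0 (1 - r)^-1); apply: cvgMr.
    by apply: cvg_expr; rewrite ger0_norm.
  apply: (squeeze_cvgr _ lo (cvg_cst _)); near=> n.
  rewrite (andP (smooth_step_itv n f0 f1)).2 andbT.
  have fn1 : f ^+ n <= 1 by rewrite exprn_ile1.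
  apply: le_trans (bernoulli_ge (n * 2 ^ n) (exprn_ge0 n f0) fn1).
  rewrite lerB// natrM natrX -mulrA -exprMn -rr exprAC expr2 mulrA.
  rewrite ler_wpM2r ?exprn_ge0//.
  have r10 : 0 <= 1 - r by rewrite subr_ge0 ltW.
  have r11 : 1 - r <= 1 by rewrite gerBl.
  have := bernoulli_le1 n r10 r11; rewrite opprB addrC subrK mulrDr mulr1 => H.
  rewrite -(@ler_pM2r _ (1 - r)) ?subr_gt0// mulVf ?gt_eqF ?subr_gt0//.
  apply: le_trans H; rewrite mulrA [r ^+ n * _]mulrC lerDr exprn_ge0//.
have hi : (fun n : nat => harmonic n) @ \oo --> (0 : R) by exact: cvg_harmonic.
apply: (squeeze_cvgr _ (cvg_cst _) hi); near=> n.
rewrite (andP (smooth_step_itv n f0 f1)).1 /=.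
have fn0 : 0 <= f ^+ n by rewrite exprn_ge0.
have fn1 : f ^+ n <= 1 by rewrite exprn_ile1.
have := bernoulli_le1 (n * 2 ^ n) fn0 fn1.
rewrite -/(smooth_step n f) => H.
rewrite /harmonic -[leRHS]mul1r ler_pdivlMr ?ltr0n//.
apply: le_trans H; rewrite ler_wpM2l ?(andP (smooth_step_itv n f0 f1)).1//.
rewrite -nat1r lerD2l natrM -mulrA ler_peMr// natrX -exprMn exprn_ege1//.
by lra.
Unshelve. all: by end_near.
Qed.

End step_function.

Lemma integral_prob_cst {R : realType} {d} {T : measurableType d}
  (P : probability T R) (c : R) : (\int[P]_x c%:E = c%:E)%E.
Proof.
by rewrite (integral_cst P measurableT) [X in (_ * X)%E]probability_setT mule1.
Qed.

Section cramer_wold.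
Context {R : realType} {d : measure_display} {T : measurableType d} {I : finType}.
Variables (P1 P2 : probability T R) (X : I -> T -> R).
Hypothesis mX : forall i, measurable_fun setT (X i).
Hypothesis lin : forall (a : I -> R) (A : set (measurableTypeR R)), measurable A ->
  P1 ((fun x => \sum_i a i * X i x) @^-1` A) =
  P2 ((fun x => \sum_i a i * X i x) @^-1` A).
Implicit Types (q : (I -> R) * R) (l : seq ((I -> R) * R)) (U V h : T -> R).

Let aff q x : R := \sum_i q.1 i * X i x + q.2.

Let trig l x : R := \prod_(q <- l) cos (aff q x).

Let maff q : measurable_fun setT (aff q).
Proof.
apply: measurable_funD => //; apply: measurable_sum => i.
exact: measurable_funM.
Qed.

Let mcos (f : T -> R) : measurable_fun setT f -> measurable_fun setT (cos \o f).
Proof.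
move=> mf; apply: measurableT_comp => //.
by apply: continuous_measurable_fun; exact: continuous_cos.
Qed.

Let mtrig l : measurable_fun setT (trig l).
Proof. by apply: measurable_prod => q _; exact: mcos. Qed.

Let trig_le1 l x : `|trig l x| <= 1.
Proof.
rewrite /trig; elim: l => [|q l IH]; first by rewrite big_nil normr1.
by rewrite big_cons normrM mulr_ile1// cos_max.
Qed.

Let bmeas U := measurable_fun setT U /\ exists M, forall x, `|U x| <= M.

Let same U := (\int[P1]_x (U x)%:E = \int[P2]_x (U x)%:E)%E.

Let bint (P : probability T R) U : bmeas U -> P.-integrable setT (EFin \o U).
Proof.
move=> [mU [M UM]]; apply: measurable_bounded_integrable => //.
  by rewrite -ge0_fin_numE// fin_num_measure.
by exists M; split; [exact: num_real|move=> K MK x _; exact: le_trans (UM x) (ltW MK)].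
Qed.

Let bmeasM U V : bmeas U -> bmeas V -> bmeas (fun x => U x * V x).
Proof.
move=> [mU [M UM]] [mV [N VN]]; split; first exact: measurable_funM.
by exists (M * N) => x; rewrite normrM ler_pM.
Qed.

Let bmeas_trig l : bmeas (trig l).
Proof. by split; [exact: mtrig|exists 1]. Qed.

Let sameD U V : bmeas U -> bmeas V -> same U -> same V -> same (fun x => U x + V x).
Proof.
move=> bU bV sU sV; rewrite /same.
under eq_integral do rewrite EFinD.
under [RHS]eq_integral do rewrite EFinD.
rewrite !integralD//; try exact: bint.
by congr (_ + _)%E.
Qed.

Let sameZ c U : bmeas U -> same U -> same (fun x => c * U x).
Proof.
move=> bU sU; rewrite /same.
under eq_integral do rewrite EFinM.
under [RHS]eq_integral do rewrite EFinM.
rewrite !integralZl//; try exact: bint.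
by congr (_ * _)%E.
Qed.

Let same_cos q : same (fun x => cos (aff q x)).
Proof.
have ml : measurable_fun setT (fun x => \sum_i q.1 i * X i x : measurableTypeR R).
  by apply: measurable_sum => i; exact: measurable_funM.
have mc : measurable_fun [set: measurableTypeR R] (fun y => (cos (y + q.2))%:E : \bar R).
  apply/measurable_EFinP; apply: (@measurableT_comp _ _ _ _ _ _ cos).
    by apply: continuous_measurable_fun; exact: continuous_cos.
  exact: measurable_funD.
have bc : bmeas (fun x => cos (aff q x)).
  by split; [exact: (mcos (maff q))|exists 1 => x; exact: cos_max].
have E (P : probability T R) : (\int[P]_x (cos (aff q x))%:E =
    \int[pushforward P (fun x => (\sum_i q.1 i * X i x)%R : measurableTypeR R)]_y (cos (y + q.2))%:E)%E.
  rewrite (integral_pushforward ml mc)//.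
  exact: (bint P bc).
rewrite /same !E; apply: eq_measure_integral => A mA _.
exact: lin.
Qed.

(** A product of two cosines is half the sum of two cosines of linear forms, so
    a trigonometric product is a combination of cosines of linear forms. *)
Let same_trig l : same (trig l).
Proof.
rewrite /trig; have [n] := ubnP (size l); elim: n l => // n IH [|q [|q' l]] /= ln.
- rewrite /same; under eq_integral do rewrite big_nil.
  under [RHS]eq_integral do rewrite big_nil.
  by rewrite !integral_prob_cst.
- rewrite (_ : (fun _ => _) = (fun x => cos (aff q x))); first exact: same_cos.
  by apply/funext => x; rewrite big_seq1.
pose qp : (I -> R) * R := (fun i => q.1 i + q'.1 i, q.2 + q'.2).
pose qm : (I -> R) * R := (fun i => q.1 i - q'.1 i, q.2 - q'.2).
rewrite (_ : (fun _ => _) = (fun x => 2^-1 * (trig (qp :: l) x + trig (qm :: l) x))).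
  apply: sameZ.
    have [m1 [M1 b1]] := bmeas_trig (qp :: l); have [m2 [M2 b2]] := bmeas_trig (qm :: l).
    split; first exact: measurable_funD.
    by exists (M1 + M2) => x; apply: le_trans (ler_normD _ _) _; rewrite lerD.
  by apply: sameD => //; apply: IH.
apply/funext => x; rewrite /trig !big_cons mulrA -mulrDl mulrA; congr (_ * _).
have -> : aff qp x = aff q x + aff q' x.
  rewrite /aff addrACA -big_split/=; congr (_ + _).
  by apply: eq_bigr => i _; rewrite mulrDl.
have -> : aff qm x = aff q x - aff q' x.
  rewrite /aff opprD addrACA -sumrN -big_split/=; congr (_ + _).
  by apply: eq_bigr => i _; rewrite mulrBl.
by rewrite cosD cosB; field.
Qed.

(** The weights with the same integral under [P1] and [P2] against every
    trigonometric product. The functions [mult] whose multiplication preserves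
    this class contain the cosines and are stable under products, sums and
    bounded limits, hence contain the indicators of half-spaces [X i < b]. *)
Let DD U := bmeas U /\ forall l, same (fun x => U x * trig l x).

Let mult h := bmeas h /\ forall U, DD U -> DD (fun x => U x * h x).

Let DD1 : DD (cst 1).
Proof.
split; first by split => //; exists 1 => x; rewrite normr1.
by move=> l; under eq_fun do rewrite mul1r; exact: same_trig.
Qed.

Let mult_cst c : mult (cst c).
Proof.
have bc : bmeas (cst c) by split => //; exists `|c|.
split => // U [bU sU]; split; first exact: bmeasM.
move=> l; under eq_fun do rewrite [_ * cst c _]mulrC -mulrA.
by apply: sameZ => //; exact: bmeasM.
Qed.

Let mult_cos q : mult (fun x => cos (aff q x)).
Proof.
have bc : bmeas (fun x => cos (aff q x)).
  by split; [exact: (mcos (maff q))|exists 1 => x; exact: cos_max].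
split => // U [bU sU]; split; first exact: bmeasM.
move=> l; have := sU (q :: l); rewrite /trig.
by under eq_fun do rewrite big_cons mulrA.
Qed.

Let multM h k : mult h -> mult k -> mult (fun x => h x * k x).
Proof.
move=> [bh mh] [bk mk]; split; first exact: bmeasM.
by move=> U dU; under eq_fun do rewrite mulrA; apply: mk; exact: mh.
Qed.

Let multD h k : mult h -> mult k -> mult (fun x => h x + k x).
Proof.
move=> [bh mh] [bk mk].
have bhk : bmeas (fun x => h x + k x).
  have [m1 [M1 b1]] := bh; have [m2 [M2 b2]] := bk.
  split; first exact: measurable_funD.
  by exists (M1 + M2) => x; apply: le_trans (ler_normD _ _) _; rewrite lerD.
split => // U dU; have [bU _] := dU; split; first exact: bmeasM.
move=> l; under eq_fun do rewrite mulrDr mulrDl.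
have [b1 s1] := mh _ dU; have [b2 s2] := mk _ dU.
by apply: sameD => //; apply: bmeasM.
Qed.

Let multX h n : mult h -> mult (fun x => h x ^+ n).
Proof.
move=> mh; elim: n => [|n IH]; first exact: (mult_cst 1).
by under eq_fun do rewrite exprS; exact: multM.
Qed.

Let mult_lim (h_ : nat -> T -> R) h :
  (forall n, mult (h_ n)) -> (forall n x, 0 <= h_ n x <= 1) ->
  (forall x, h_ n x @[n --> \oo] --> h x) -> mult h.
Proof.
move=> mh h01 hh.
have hx x : `|h x| <= 1.
  rewrite ler_norml; apply/andP; split.
    apply: (cvgr_to_ge (hh x)); near=> n.
    by have /andP[h0 _] := h01 n x; apply: le_trans h0; rewrite lerN10.
  by apply: (cvgr_to_le (hh x)); near=> n; have /andP[] := h01 n x.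
have mmh : measurable_fun setT h.
  apply: (@measurable_fun_cvg _ _ _ setT (fun n => h_ n)) => // n.
  by case: (mh n) => -[].
have bh : bmeas h by split => //; exists 1.
split => // U dU; have [bU _] := dU; have [mU [M UM]] := bU.
split; first exact: bmeasM.
move=> l.
have cvgP_ (P : probability T R) :
    (\int[P]_x (U x * h_ n x * trig l x)%:E)%E @[n --> \oo] -->
    (\int[P]_x (U x * h x * trig l x)%:E)%E.
  apply: (@dominated_cvg _ _ _ P setT measurableT
    (fun n x => (U x * h_ n x * trig l x)%:E) _ (cst M%:E)) => //.
  - move=> n; apply/measurable_EFinP; apply: measurable_funM => //.
    by apply: measurable_funM => //; case: (mh n) => -[].
  - move=> x _; apply: cvg_EFin; first by near=> n.
    by apply: cvgMl; apply: cvgMr; exact: hh.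
  - exact: finite_measure_integrable_cst.
  - move=> n x _; rewrite lee_fin !normrM -[leRHS]mulr1.
    rewrite ler_pM// -[leRHS]mulr1 ler_pM//.
    by have /andP[h0 h1] := h01 n x; rewrite ger0_norm.
have E n : (\int[P1]_x (U x * h_ n x * trig l x)%:E =
    \int[P2]_x (U x * h_ n x * trig l x)%:E)%E.
  by have [_ /(_ U dU)[_ /(_ l)]] := mh n.
have := cvgP_ P1; under eq_fun do rewrite E.
rewrite /same; by move=> /(cvg_unique _ (cvgP_ P2)) => /(_ (@ereal_hausdorff R)) ->.
Unshelve. all: by end_near.
Qed.

(** [smooth_step] of an affine function of a cosine tends to the indicator that
    [sin ((b - X i) / M)] is positive, which at each point is that of [X i < b] as
    soon as [M] is large. *)
Let mult_step i b : mult (fun x => ((X i x < b)%R%:R : R)).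
Proof.
pose q (M : nat) : (I -> R) * R :=
  (fun j => if j == i then - M.+1%:R^-1 else 0, b / M.+1%:R - pi / 2).
have qE M x : cos (aff (q M) x) = sin ((b - X i x) / M.+1%:R).
  rewrite -cosBpihalf /aff /q /= (bigD1 i)//= eqxx big1 => [|j /negbTE ->].
    by congr cos; rewrite addr0 mulrBl; ring.
  by rewrite mul0r.
have sin_step M : mult (fun x => ((0 < sin ((b - X i x) / M.+1%:R))%R%:R : R)).
  pose f x : R := 2^-1 + - 2^-1 * cos (aff (q M) x).
  have f01 x : 0 <= f x <= 1.
    have := cos_max (aff (q M) x); rewrite /f ler_norml => /andP[? ?].
    by apply/andP; split; lra.
  have mf : mult f.
    by apply: multD; [exact: mult_cst|apply: multM; [exact: mult_cst|exact: mult_cos]].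
  apply: (@mult_lim (fun n x => smooth_step n (f x))).
  - move=> n; apply: multX.
    have -> : (fun x => 1 - f x ^+ n) = (fun x => cst 1 x + cst (-1) x * f x ^+ n).
      by apply/funext => x /=; rewrite mulN1r.
    apply: multD; first exact: mult_cst.
    by apply: multM; [exact: mult_cst|exact: multX].
  - by move=> n x; have /andP[? ?] := f01 x; exact: smooth_step_itv.
  - move=> x; have /andP[f0 f1] := f01 x.
    have -> : (0 < sin ((b - X i x) / M.+1%:R)) = (f x < 2^-1).
      by rewrite /f qE; apply/idP/idP => ?; lra.
    exact: smooth_step_cvg.
apply: (@mult_lim (fun M x => ((0 < sin ((b - X i x) / M.+1%:R))%R%:R : R))) => //.
  by move=> M x; case: (_ < _); rewrite ?ler01 ?lexx.
move=> x.
have big : \forall M \near \oo, `|(b - X i x) / M.+1%:R| < pi.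
  near=> M; rewrite normrM normfV (@ger0_norm _ M.+1%:R)// ltr_pdivrMr ?ltr0n//.
  rewrite mulrC -ltr_pdivrMr ?pi_gt0//.
  apply: (@lt_trans _ _ M%:R); last by rewrite ltr_nat.
  by near: M; exact: nbhs_infty_gtr.
apply: cvg_near_cst; near=> M.
have : `|(b - X i x) / M.+1%:R| < pi by near: M.
rewrite ltr_norml => /andP[lo hi]; congr (_%:R); congr nat_of_bool.
have M0 : 0 < M.+1%:R^-1 :> R by rewrite invr_gt0 ltr0n.
have [Xb|bX] := ltP (X i x) b.
  by rewrite sin_gt0_pi// hi andbT pmulr_lgt0// subr_gt0.
apply/negbTE; rewrite -leNgt -oppr_ge0 -sinN.
apply: sin_ge0_pi; rewrite oppr_ge0 pmulr_lle0// subr_le0 bX /=.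
by rewrite lerNl ltW.
Unshelve. all: by end_near.
Qed.

Let box (l : seq (I * R)) : set T := [set x | all (fun e => X e.1 x < e.2) l].

Let mbox L : measurable (box L).
Proof.
elim: L => [|e L IH]; first by rewrite /box /= (_ : [set _ | _] = setT)//; exact/seteqP.
rewrite (_ : box _ = (X e.1 @^-1` `]-oo, e.2[%classic) `&` box L).
  apply: measurableI => //; rewrite -[X in measurable X]setTI.
  by apply: mX => //; exact: measurable_itv.
by apply/seteqP; split => x; rewrite /box /= in_itv/= => /andP.
Qed.

Let same_box L : P1 (box L) = P2 (box L).
Proof.
have H : mult (fun x => \prod_(e <- L) ((X e.1 x < e.2)%R%:R : R)).
  elim: L => [|e L IH]; first by under eq_fun do rewrite big_nil; exact: mult_cst.
  by under eq_fun do rewrite big_cons; apply: multM => //; exact: mult_step.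
have [_ /(_ _ DD1) [_ /(_ [::])]] := H.
rewrite /same !measure_indic//.
have E x : cst 1 x * \prod_(e <- L) ((X e.1 x < e.2)%R%:R : R) * trig [::] x = \1_(box L) x.
  rewrite /trig big_nil mulr1 mul1r indicE; elim: L {H} => [|e L IH].
    by rewrite big_nil mem_set.
  rewrite big_cons IH; have [Xe|Xe] := ltP (X e.1 x) e.2.
    rewrite mul1r; congr (nat_of_bool _)%:R.
    by apply/idP/idP => /set_mem H1; apply/mem_set; move: H1; rewrite /box /= Xe.
  by rewrite mul0r memNset// /box /= ltNge Xe.
have EE (P : probability T R) : (\int[P]_x (\1_(box L) x)%:E =
    \int[P]_x (cst 1 x * \prod_(e <- L) ((X e.1 x < e.2)%R%:R : R) * trig [::] x)%:E)%E.
  by apply: eq_integral => x _; rewrite -E.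
by rewrite !EE.
Qed.

(** The theorem of Cramer and Wold. The first hypothesis expresses that the [X i]
    generate the sigma-algebra of [T]; applied to the identity, it shows that the
    boxes, a pi-system on which the laws agree, generate it too. *)
Lemma cramer_wold :
  (forall (d' : measure_display) (S : measurableType d') (f : S -> T),
    (forall i, measurable_fun setT (X i \o f)) -> measurable_fun setT f) ->
  forall A, measurable A -> P1 A = P2 A.
Proof.
move=> gen A mA.
pose G : set (set T) := range box.
have idm : measurable_fun setT (id : g_sigma_algebraType G -> T).
  apply: gen => i; apply: (measurability _ (RGenInftyO.measurableE R)).
  move=> _ [_ [b ->] <-]; rewrite setTI.
  apply: sub_sigma_algebra; exists [:: (i, b)] => //.
  by apply/seteqP; split => x; rewrite /box/= in_itv/= andbT.
have GA : <<s G >> A.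
  by have := idm measurableT A mA; rewrite setTI preimage_id.
apply: (@g_sigma_algebra_measure_unique _ _ _ G _ (fun=> box [::])) => //.
- by move=> _ [l _ <-]; exact: mbox.
- by move=> _; exists [::].
- by apply/seteqP; split => // x _; exists 0%N.
- move=> _ _ [l _ <-] [l' _ <-]; exists (l ++ l') => //.
  by apply/seteqP; split => x; rewrite /box/= all_cat => /andP.
- by move=> _ [l _ <-]; exact: same_box.
- by move=> _; rewrite -ge0_fin_numE// fin_num_measure.
Qed.

End cramer_wold.

(** * Gaussian arrays and chi-square deviations *)

Section array_law.
Context {R : realType}.

Lemma gaussian_rv_array p d (a : 'I_p -> 'I_d -> R) :
  gaussian_rv (prod_prob (@gauss_vec R d) p)
    (fun t => \sum_(j < p) \sum_(k < d) a j k * tnth (tnth t j) k) 0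
    (\sum_(j < p) \sum_(k < d) a j k ^+ 2).
Proof.
apply: (@gaussian_rv_sum _ _ _ _ p
  (fun j (v : d.-tuple (measurableTypeR R)) => \sum_(k < d) a j k * tnth v k)
  (fun j => \sum_(k < d) a j k ^+ 2)) => j.
  by apply: sumr_ge0 => k _; exact: sqr_ge0.
apply: (@gaussian_rv_sum _ _ _ _ d
  (fun k (x : measurableTypeR R) => a j k * x) (fun k => a j k ^+ 2)) => k.
  exact: sqr_ge0.
have := gaussian_rv_affine (a j k) 0.
by under eq_fun do rewrite addr0.
Qed.

Lemma measurable_tuple_tuple {d' : measure_display} {S : measurableType d'}
    p d (f : S -> p.-tuple (d.-tuple (measurableTypeR R))) :
  (forall j k, measurable_fun setT (fun x => tnth (tnth (f x) j) k : measurableTypeR R)) ->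
  measurable_fun setT f.
Proof.
move=> mf; apply/measurable_fun_tnthP => j.
by apply/measurable_fun_tnthP => k; exact: mf.
Qed.

Definition array {Omega : Type} p d (Z : 'I_p -> 'I_d -> Omega -> R) (w : Omega) :
    p.-tuple (d.-tuple (measurableTypeR R)) :=
  [tuple [tuple Z j k w | k < d] | j < p].

Lemma tnth_array {Omega : Type} p d (Z : 'I_p -> 'I_d -> Omega -> R) w j k :
  tnth (tnth (array Z w) j) k = Z j k w.
Proof. by rewrite !tnth_mktuple. Qed.

(** The linear forms of the array and of the standard Gaussian array have the
    same Gaussian laws, so [cramer_wold] applies. *)
Lemma array_law {d' : measure_display} {Omega : measurableType d'}
    (P : probability Omega R) p d (Z : 'I_p -> 'I_d -> Omega -> R) :
  (forall j k, measurable_fun setT (Z j k)) ->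
  (forall a : 'I_p -> 'I_d -> R, gaussian_rv P
    (fun w => \sum_(j < p) \sum_(k < d) a j k * Z j k w) 0
    (\sum_(j < p) \sum_(k < d) a j k ^+ 2)) ->
  measurable_fun setT (array Z) /\
  forall A, measurable A -> P (array Z @^-1` A) = prod_prob (@gauss_vec R d) p A.
Proof.
move=> mZ gZ.
have mA : measurable_fun setT (array Z).
  apply: measurable_tuple_tuple => j k.
  by under eq_fun do rewrite tnth_array; exact: mZ.
split => // A.
pose Xmix := isMeasurableFun.Build _ _ _ _ _ mA.
pose X : {mfun _ >-> _} := HB.pack (array Z) Xmix.
pose c (i : 'I_p * 'I_d) (t : p.-tuple (d.-tuple (measurableTypeR R))) : R :=
  tnth (tnth t i.1) i.2.
have mc i : measurable_fun setT (c i).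
  apply: (measurableT_comp (f := fun v : d.-tuple (measurableTypeR R) => tnth v i.2));
  exact: measurable_tnth.
apply: (@cramer_wold _ _ _ _ (distribution P X) (prod_prob (@gauss_vec R d) p) c).
- exact: mc.
- move=> a B mB.
  pose a' j k := a (j, k).
  have E1 w : \sum_i a i * c i (array Z w) = \sum_(j < p) \sum_(k < d) a' j k * Z j k w.
    by rewrite pair_bigA; apply: eq_bigr => -[j k] _; rewrite /c tnth_array.
  have E2 t : \sum_i a i * c i t = \sum_(j < p) \sum_(k < d) a' j k * tnth (tnth t j) k.
    by rewrite pair_bigA; apply: eq_bigr => -[j k] _.
  have [_ /(_ B mB) H1] := gZ a'.
  have [_ /(_ B mB) H2] := gaussian_rv_array a'.
  transitivity (P ((fun w => \sum_(j < p) \sum_(k < d) a' j k * Z j k w) @^-1` B)).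
    rewrite /distribution/= /pushforward; congr (P _).
    by apply/seteqP; split => w; rewrite /preimage /= E1.
  rewrite H1 -H2; congr (_ _).
  by apply/seteqP; split => w; rewrite /preimage /= E2.
- by move=> d1 S f mf; apply: measurable_tuple_tuple => j k; exact: (mf (j, k)).
Qed.

End array_law.

Lemma ge0_integralM_cst {R : realType} {d} {T : measurableType d}
    (m : {measure set T -> \bar R}) (c : R) (f : T -> R) : 0 <= c ->
  measurable_fun setT f -> (forall x, 0 <= f x) ->
  (\int[m]_x (c * f x)%:E = c%:E * \int[m]_x (f x)%:E)%E.
Proof.
move=> c0 mf f0; under eq_integral do rewrite EFinM.
rewrite ge0_integralZl ?lee_fin//; first exact/measurable_EFinP.
by move=> x _; rewrite lee_fin.
Qed.

Section level_sets.
Context {R : realType} {d} {T : measurableType d} (f : T -> R).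
Hypothesis mf : measurable_fun setT f.

Lemma measurable_le_cst c : measurable [set x | f x <= c].
Proof.
rewrite (_ : [set _ | _] = setT `&` f @^-1` `]-oo, c]%classic).
  by apply: mf => //; exact: measurable_itv.
by rewrite setTI; apply/seteqP; split => x /=; rewrite in_itv.
Qed.

Lemma measurable_gt_cst c : measurable [set x | c < f x].
Proof.
rewrite (_ : [set _ | _] = setT `&` f @^-1` `]c, +oo[%classic).
  by apply: mf => //; exact: measurable_itv.
by rewrite setTI; apply/seteqP; split => x /=; rewrite in_itv/= andbT.
Qed.

Lemma measurable_ge_cst c : measurable [set x | c <= f x].
Proof.
rewrite (_ : [set _ | _] = setT `&` f @^-1` `[c, +oo[%classic).
  by apply: mf => //; exact: measurable_itv.
by rewrite setTI; apply/seteqP; split => x /=; rewrite in_itv/= andbT.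
Qed.

End level_sets.

(** The form of Markov's inequality behind all Chernoff bounds below. *)
Lemma le_measure_integral {R : realType} {d} {T : measurableType d}
    (m : {measure set T -> \bar R}) (A : set T) (g : T -> R) :
  measurable A -> measurable_fun setT g -> (forall x, 0 <= g x) ->
  (forall x, A x -> 1 <= g x) -> (m A <= \int[m]_x (g x)%:E)%E.
Proof.
move=> mA mg g0 g1; rewrite measure_indic//; apply: ge0_le_integral => //.
- exact/measurable_EFinP.
- exact/measurable_EFinP.
move=> x _; rewrite lee_fin indicE; case: (boolP (x \in A)) => [/set_mem|_] //.
exact: g1.
Qed.

Lemma lee_prodl {R : realType} {I : Type} (r : seq I) (F G : I -> \bar R) :
  (forall i, (0 <= F i <= G i)%E) -> (\prod_(i <- r) F i <= \prod_(i <- r) G i)%E.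
Proof.
move=> FG; suff : (0 <= \prod_(i <- r) F i <= \prod_(i <- r) G i)%E by case/andP.
elim: r => [|i r /andP[IH0 IH]]; first by rewrite !big_nil lexx lee01.
have /andP[F0 FGi] := FG i.
by rewrite !big_cons mule_ge0//= lee_pmul.
Qed.

Section chi_square.
Context {R : realType}.
Implicit Types (mu lam x b : R) (d p m : nat).

Lemma sqrt_chi_bound mu : mu <= 4^-1 ->
  (Num.sqrt (1 - 2 * mu))^-1 <= expR (mu + 4 * mu ^+ 2).
Proof.
move=> mu4; have c0 : 0 < 1 - 2 * mu by lra.
rewrite -[leLHS]mul1r ler_pdivrMr ?sqrtr_gt0//.
have : expR (mu + 4 * mu ^+ 2) ^+ 2 * (1 - 2 * mu) >= 1.
  rewrite -expRM_natl; apply: le_trans (ler_wpM2r _ (expR_ge1Dx _)); last by lra.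
  by have := sqr_ge0 mu; nra.
move=> H; rewrite -[leLHS](@sqrtr1 R) -[X in X * _]ger0_norm ?expR_ge0//.
rewrite -sqrtr_sqr -sqrtrM ?sqr_ge0// ler_sqrt//.
exact: le_trans ler01 H.
Qed.

Lemma measurable_shifted_sqnorm d (b : 'I_d -> R) :
  measurable_fun setT (fun v : d.-tuple (measurableTypeR R) => \sum_(k < d) (b k + tnth v k) ^+ 2).
Proof.
apply: measurable_sum => k; apply: measurable_funX; apply: measurable_funD => //.
exact: measurable_tnth.
Qed.

Lemma gauss_vec_mgf d (b : 'I_d -> R) mu : mu <= 4^-1 ->
  (\int[gauss_vec d]_v (expR (mu * \sum_(k < d) (b k + tnth v k) ^+ 2))%:E <=
   (expR (d%:R * (mu + 4 * mu ^+ 2) + mu / (1 - 2 * mu) * \sum_(k < d) b k ^+ 2))%:E)%E.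
Proof.
move=> mu4; have c0 : 0 < 1 - 2 * mu by lra.
under eq_integral do rewrite mulr_sumr expR_sum.
rewrite (@ge0_integral_prod_prob_prod _ _ _ (normal_prob 0 1) d
  (fun k x => expR (mu * (b k + x) ^+ 2))); last 2 first.
- move=> k; apply: measurableT_comp => //; apply: measurable_funM => //.
  by apply: measurable_funX; exact: measurable_funD.
- by move=> k x; exact: expR_ge0.
have mu1 : 2 * mu < 1 by lra.
under eq_bigr do rewrite (expR_sqr_normal _ mu1).
rewrite prodEFin lee_fin mulr_sumr expRD.
have -> : d%:R * (mu + 4 * mu ^+ 2) = \sum_(k < d) (mu + 4 * mu ^+ 2).
  by rewrite sumr_const card_ord mulr_natl.
rewrite !expR_sum -big_split/=; apply: ler_prod => k _.
rewrite mulr_ge0 ?expR_ge0 ?invr_ge0 ?sqrtr_ge0//= mulrAC ler_wpM2r ?expR_ge0//.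
exact: sqrt_chi_bound.
Qed.

Local Notation arr p d := (p.-tuple (d.-tuple (measurableTypeR R))).
Local Notation law p d := (prod_prob (@gauss_vec R d) p).

Definition shifted_sqnorm p d (S : {set 'I_p}) (b : 'I_p -> 'I_d -> R) (t : arr p d) : R :=
  \sum_(j in S) \sum_(k < d) (b j k + tnth (tnth t j) k) ^+ 2.

Lemma measurable_shifted_sqnorm_set p d (S : {set 'I_p}) (b : 'I_p -> 'I_d -> R) :
  measurable_fun setT (shifted_sqnorm S b).
Proof.
rewrite /shifted_sqnorm; under eq_fun do rewrite big_mkcond/=.
apply: measurable_sum => j; case: (j \in S) => //.
apply: (measurableT_comp (measurable_shifted_sqnorm (b j))).
exact: measurable_tnth.
Qed.

Lemma array_mgf p d (S : {set 'I_p}) (b : 'I_p -> 'I_d -> R) mu : mu <= 4^-1 ->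
  (\int[law p d]_t (expR (mu * shifted_sqnorm S b t))%:E <=
   (expR ((#|S| * d)%:R * (mu + 4 * mu ^+ 2) +
      mu / (1 - 2 * mu) * \sum_(j in S) \sum_(k < d) b j k ^+ 2))%:E)%E.
Proof.
move=> mu4.
pose g j (v : d.-tuple (measurableTypeR R)) : R :=
  if j \in S then expR (mu * \sum_(k < d) (b j k + tnth v k) ^+ 2) else 1.
under eq_integral => t _.
  rewrite /shifted_sqnorm mulr_sumr expR_sum big_mkcond/=.
  rewrite -/(\prod_(j < p) g j (tnth t j)).
  over.
rewrite (@ge0_integral_prod_prob_prod _ _ _ (gauss_vec d) p g); last 2 first.
- move=> j; rewrite /g; case: (j \in S) => //; apply: measurableT_comp => //.
  by apply: measurable_funM => //; exact: measurable_shifted_sqnorm.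
- by move=> j v; rewrite /g; case: ifP => // _; exact: expR_ge0.
have -> : (#|S| * d)%:R * (mu + 4 * mu ^+ 2) +
      mu / (1 - 2 * mu) * \sum_(j in S) \sum_(k < d) b j k ^+ 2 =
   \sum_(j in S) (d%:R * (mu + 4 * mu ^+ 2) + mu / (1 - 2 * mu) * \sum_(k < d) b j k ^+ 2).
  by rewrite big_split/= sumr_const mulr_sumr natrM -mulrA mulr_natl.
rewrite expR_sum [in leRHS]big_mkcond/= -prodEFin.
apply: lee_prodl => j; apply/andP; split.
  by apply: integral_ge0 => v _; rewrite lee_fin /g; case: ifP => // _; exact: expR_ge0.
rewrite /g; case: ifP => _; first exact: gauss_vec_mgf.
by rewrite integral_prob_cst.
Qed.

(** Chernoff's bound from [array_mgf]; the exponent is left as a function of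
    [mu], to be chosen from the size of [x]. *)
Lemma chi2_upper_tail p d (S : {set 'I_p}) mu x : 0 <= mu -> mu <= 4^-1 ->
  (law p d [set t | (#|S| * d)%:R + x < shifted_sqnorm S (fun _ _ => 0) t]%R
   <= (expR (- mu * x + 4 * mu ^+ 2 * (#|S| * d)%:R))%:E)%E.
Proof.
move=> mu0 mu4; pose b (_ : 'I_p) (_ : 'I_d) : R := 0; pose X := shifted_sqnorm S b.
have mX : measurable_fun setT X by exact: measurable_shifted_sqnorm_set.
apply: (@le_trans _ _ (\int[law p d]_t (expR (- mu * ((#|S| * d)%:R + x)) * expR (mu * X t))%:E)%E).
  apply: le_measure_integral.
  - exact: measurable_gt_cst.
  - by apply: measurable_funM => //; apply: measurableT_comp => //; exact: measurable_funM.
  - by move=> t; rewrite mulr_ge0 ?expR_ge0.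
  - move=> t /= /ltW Xt; rewrite -expRD -[leLHS]expR0 ler_expR mulNr addrC subr_ge0.
    by rewrite ler_wpM2l.
rewrite ge0_integralM_cst ?expR_ge0//; last first.
  by apply: measurableT_comp => //; exact: measurable_funM.
apply: (le_trans (lee_wpmul2l _ (array_mgf S b mu4))); first by rewrite lee_fin expR_ge0.
rewrite -EFinM lee_fin -expRD ler_expR.
rewrite (_ : \sum_(j in S) _ = 0).
  by rewrite mulr0 addr0 le_eqVlt; apply/predU1P; left; ring.
by rewrite big1// => j _; rewrite big1// => k _; rewrite /b expr0n.
Qed.

(** The shift contributes [- lam (1 - 2 lam) Delta] to the exponent and the threshold
    [lam Delta / 2]; for [lam <= 1/8] the sum is at most [- lam Delta / 4]. *)
Lemma chi2_lower_tail p d (S : {set 'I_p}) (b : 'I_p -> 'I_d -> R) lam Delta :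
  0 <= lam -> lam <= 8^-1 -> Delta = \sum_(j in S) \sum_(k < d) b j k ^+ 2 ->
  (law p d [set t | shifted_sqnorm S b t <= (#|S| * d)%:R + Delta / 2]%R
   <= (expR (- lam * Delta / 4 + 4 * lam ^+ 2 * (#|S| * d)%:R))%:E)%E.
Proof.
move=> lam0 lam8 DE; pose X := shifted_sqnorm S b; set m : R := (#|S| * d)%:R.
have mX : measurable_fun setT X by exact: measurable_shifted_sqnorm_set.
have D0 : 0 <= Delta by rewrite DE; apply: sumr_ge0 => j _; apply: sumr_ge0 => k _; exact: sqr_ge0.
apply: (@le_trans _ _ (\int[law p d]_t (expR (lam * (m + Delta / 2)) * expR (- lam * X t))%:E)%E).
  apply: le_measure_integral.
  - exact: measurable_le_cst.
  - by apply: measurable_funM => //; apply: measurableT_comp => //; exact: measurable_funM.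
  - by move=> t; rewrite mulr_ge0 ?expR_ge0.
  - move=> t /= Xt; rewrite -expRD -[leLHS]expR0 ler_expR mulNr subr_ge0.
    by rewrite ler_wpM2l.
rewrite ge0_integralM_cst ?expR_ge0//; last first.
  by apply: measurableT_comp => //; exact: measurable_funM.
have mu4 : - lam <= 4^-1 by lra.
apply: (le_trans (lee_wpmul2l _ (array_mgf S b mu4))); first by rewrite lee_fin expR_ge0.
rewrite -EFinM lee_fin -expRD ler_expR -/m -DE.
have H : - lam / (1 - 2 * - lam) * Delta <= - lam * (1 - 2 * lam) * Delta.
  rewrite ler_wpM2r// !mulNr lerN2 ler_pdivlMr; last by lra.
  by have := sqr_ge0 lam; nra.
apply: (@le_trans _ _ (lam * (m + Delta / 2) + (m * (- lam + 4 * (- lam) ^+ 2) + - lam * (1 - 2 * lam) * Delta))).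
  by rewrite lerD2l lerD2l.
have : lam ^+ 2 * Delta <= lam / 8 * Delta by rewrite ler_wpM2r// expr2 ler_wpM2l.
by nra.
Qed.

End chi_square.

(** * The truncated chi-square variable *)

Section scaling.
Context {R : realType}.
Local Notation leb := (@lebesgue_measure R).
Implicit Types (c x t y r : R) (d : nat).

(** Density of N(0, c^-2) with respect to N(0, 1). *)
Definition scale_density c x : R := c * expR (- (c ^+ 2 - 1) * x ^+ 2 / 2).

Lemma scale_density_ge0 c x : 0 <= c -> 0 <= scale_density c x.
Proof. by move=> c0; rewrite mulr_ge0 ?expR_ge0. Qed.

Lemma measurable_scale_density c :
  measurable_fun [set: measurableTypeR R] (scale_density c).
Proof.
apply: measurable_funM => //; apply: measurableT_comp => //.
by apply: measurable_funM => //; apply: measurable_funM => //; exact: measurable_funX.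
Qed.

Lemma integral_normal_scale c (f : R -> \bar R) : 0 < c ->
  measurable_fun [set: measurableTypeR R] f -> (forall x, 0 <= f x)%E ->
  (\int[normal_prob 0 1]_x f (x / c)%R =
   \int[normal_prob 0 1]_x (f x * (scale_density c x)%:E))%E.
Proof.
move=> c0 mf f0.
have mfc : measurable_fun [set: measurableTypeR R] (fun x : R => f (x / c)).
  by apply: measurableT_comp => //; exact: measurable_funM.
have mEd : measurable_fun [set: measurableTypeR R] (fun x => (scale_density c x)%:E : \bar R).
  by apply/measurable_EFinP; exact: measurable_scale_density.
have mg : measurable_fun [set: measurableTypeR R] (fun x => (f x * (scale_density c x)%:E)%E).
  exact: emeasurable_funM.
have := ge0_integral_normal 0 ltr01 mfc (fun x => f0 (x / c)); rewrite sqrtr1 => E1.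
have g0 x : (0 <= f x * (scale_density c x)%:E)%E.
  by apply: mule_ge0 => //; rewrite lee_fin; apply: scale_density_ge0; exact: ltW.
have := ge0_integral_normal 0 ltr01 mg g0; rewrite sqrtr1 => E2.
rewrite [LHS]E1 [RHS]E2.
have mp : measurable_fun [set: measurableTypeR R] (fun x => (gauss_pdf 0 1 x)%:E : \bar R).
  by apply/measurable_EFinP; exact: measurable_gauss_pdf.
pose h y := (f y * (gauss_pdf 0 1 (c * y))%:E)%E.
have mh : measurable_fun [set: measurableTypeR R] h.
  apply: emeasurable_funM => //; apply/measurable_EFinP; apply: measurableT_comp.
    exact: measurable_gauss_pdf.
  exact: measurable_funM.
have h0 y : (0 <= h y)%E by rewrite mule_ge0 ?lee_fin ?gauss_pdf_ge0.
transitivity (\int[leb]_x h (c^-1 * x + 0)%R)%E.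
  apply: eq_integral => x _; rewrite /h addr0 mulrC; congr (_ * (gauss_pdf 0 1 _)%:E)%E.
  by rewrite [_^-1 * _]mulrC mulrCA divff ?mulr1// gt_eqF.
rewrite ge0_integral_affine ?invr_eq0 ?gt_eqF// gtr0_norm ?invr_gt0// invrK.
rewrite -ge0_integralZl//; last by rewrite lee_fin ltW.
apply: eq_integral => x _; rewrite /h muleCA -muleA; congr (_ * _)%E.
rewrite -!EFinM; apply: (f_equal EFin); rewrite /scale_density /gauss_pdf [RHS]mulrACA -expRD.
by rewrite mulrA; congr (_ * expR _); field.
Qed.

Lemma gauss_vec_scale d c (h : R -> \bar R) : 0 < c ->
  measurable_fun [set: measurableTypeR R] h -> (forall x, 0 <= h x)%E ->
  (\int[gauss_vec d]_v h (\sum_(k < d) (tnth v k / c) ^+ 2)%R =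
   \int[gauss_vec d]_v
     (h (\sum_(k < d) tnth v k ^+ 2)%R * (\prod_(k < d) scale_density c (tnth v k))%:E))%E.
Proof.
move=> c0; elim: d h => [|d IH] h mh h0.
  by apply: eq_integral => v _; rewrite !big_ord0 mule1.
pose sq (v : d.-tuple (measurableTypeR R)) : R := \sum_(k < d) tnth v k ^+ 2.
pose pr (v : d.-tuple (measurableTypeR R)) : R := \prod_(k < d) scale_density c (tnth v k).
have msq : measurable_fun setT sq.
  by apply: measurable_sum => k; apply: measurable_funX; exact: measurable_tnth.
have mpr : measurable_fun setT pr.
  exact: (measurable_prod_tnth (fun k => measurable_scale_density c)).
have pr0 v : 0 <= pr v by apply: prodr_ge0 => k _; rewrite scale_density_ge0 ?ltW.
have msum n (g : R -> R) : measurable_fun [set: measurableTypeR R] g ->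
    measurable_fun setT (fun v : n.-tuple (measurableTypeR R) => \sum_(k < n) g (tnth v k)).
  move=> mg; apply: measurable_sum => k; apply: measurableT_comp => //; exact: measurable_tnth.
rewrite ge0_integral_prod_prob_cons//; last first.
  apply: (measurableT_comp mh); apply: (msum _ (fun x => (x / c) ^+ 2)).
  by apply: measurable_funX; exact: measurable_funM.
rewrite ge0_integral_prod_prob_cons; last 2 first.
- apply: emeasurable_funM.
    by apply: (measurableT_comp mh); apply: (msum _ (fun x => x ^+ 2)); exact: measurable_funX.
  by apply/measurable_EFinP; exact: (measurable_prod_tnth (fun k => measurable_scale_density c)).
- move=> t; rewrite mule_ge0// lee_fin; apply: prodr_ge0 => k _.
  by rewrite scale_density_ge0 ?ltW.
pose F (z : measurableTypeR R * d.-tuple (measurableTypeR R)) : \bar R :=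
  (h (z.1 ^+ 2 + sq z.2)%R * (pr z.2)%:E)%E.
have mF : measurable_fun setT F.
  apply: emeasurable_funM.
    apply: (measurableT_comp mh); apply: measurable_funD; last exact: measurableT_comp.
    exact: measurable_funX.
  by apply/measurable_EFinP; exact: measurableT_comp.
have F0 z : (0 <= F z)%E by rewrite mule_ge0 ?lee_fin.
pose G x := (\int[gauss_vec d]_t F (x, t))%E.
have mG : measurable_fun [set: measurableTypeR R] G.
  exact: (measurable_fun_fubini_tonelli_F (m2 := gauss_vec d) F mF).
have G0 x : (0 <= G x)%E by apply: integral_ge0 => t _.
transitivity (\int[normal_prob 0 1]_x G (x / c)%R)%E.
  apply: eq_integral => x _.
  transitivity (\int[gauss_vec d]_t h ((x / c) ^+ 2 + \sum_(k < d) (tnth t k / c) ^+ 2)%R)%E.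
    apply: eq_integral => t _; rewrite big_ord_recl tnth0.
    by under eq_bigr do rewrite tnthS.
  rewrite (IH (fun y => h ((x / c) ^+ 2 + y)%R))//.
  by apply: measurableT_comp => //; exact: measurable_funD.
rewrite integral_normal_scale//.
apply: eq_integral => x _; rewrite /G.
rewrite -ge0_integralZr//; last 2 first.
- by apply: measurableT_comp => //; exact: measurable_pair1.
- by rewrite lee_fin scale_density_ge0 ?ltW.
apply: eq_integral => t _; rewrite /F /= !big_ord_recl !tnth0.
have -> : \sum_(i < d) tnth [tuple of x :: t] (lift ord0 i) ^+ 2 = sq t.
  by apply: eq_bigr => k _; rewrite tnthS.
have -> : \prod_(i < d) scale_density c (tnth [tuple of x :: t] (lift ord0 i)) = pr t.
  by apply: eq_bigr => k _; rewrite tnthS.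
by rewrite -muleA -EFinM [(_ * scale_density _ _)%R]mulrC.
Qed.

Definition chi2_tail d t : R := fine (gauss_vec d [set g | t <= sqnorm g]).

Lemma measurable_sqnorm d : measurable_fun setT (@sqnorm R d).
Proof.
by apply: measurable_sum => k; apply: measurable_funX; exact: measurable_tnth.
Qed.

Lemma measurable_chi2_set d t : measurable [set g : d.-tuple (measurableTypeR R) | t <= sqnorm g].
Proof. exact: (measurable_ge_cst (@measurable_sqnorm d)). Qed.

Lemma chi2_tailE d t : gauss_vec d [set g | t <= sqnorm g] = (chi2_tail d t)%:E.
Proof. by rewrite /chi2_tail fineK// fin_num_measure//; exact: measurable_chi2_set. Qed.

Lemma chi2_tail_ge0 d t : 0 <= chi2_tail d t.
Proof. exact: fine_ge0. Qed.

Lemma sqnorm_ge0 d (g : d.-tuple (measurableTypeR R)) : 0 <= sqnorm g.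
Proof. by apply: sumr_ge0 => k _; exact: sqr_ge0. Qed.

(** The hazard rate of the chi-square law: rescaling [g] by [c] costs the
density [scale_density], which is at most [c^d exp(-(c^2-1) t / 2)] on
[t <= |g|^2]. *)
Lemma chi2_tail_scale d t c : 1 <= c ->
  chi2_tail d (c ^+ 2 * t) <= c ^+ d * expR (- (c ^+ 2 - 1) * t / 2) * chi2_tail d t.
Proof.
move=> c1; have c0 : 0 < c by exact: lt_le_trans ltr01 c1.
rewrite -lee_fin EFinM -!chi2_tailE !measure_indic; last 2 first.
- exact: measurable_chi2_set.
- exact: measurable_chi2_set.
pose h x : \bar R := ((t <= x)%R%:R)%:E.
have mh : measurable_fun [set: measurableTypeR R] h.
  apply/measurable_EFinP; rewrite (_ : (fun _ => _) = \1_`[t, +oo[%classic).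
    exact: measurable_indic.
  by apply/funext => x; rewrite indicE mem_setE in_itv/= andbT.
have h0 x : (0 <= h x)%E by rewrite lee_fin.
have -> : (\int[gauss_vec d]_g (\1_[set g | (c ^+ 2 * t <= sqnorm g)%R] g)%:E =
    \int[gauss_vec d]_v h (\sum_(k < d) (tnth v k / c) ^+ 2)%R)%E.
  apply: eq_integral => v _; rewrite /h indicE.
  under eq_bigr do rewrite expr_div_n; rewrite -mulr_suml ler_pdivlMr ?exprn_gt0// [t * _]mulrC.
  have -> // : (v \in [set g | c ^+ 2 * t <= sqnorm g]) = (c ^+ 2 * t <= sqnorm v).
    by apply/idP/idP => [/set_mem|?]//; exact/mem_set.
rewrite gauss_vec_scale//.
have k0 : 0 <= c ^+ d * expR (- (c ^+ 2 - 1) * t / 2) by apply: mulr_ge0; [apply: exprn_ge0; exact: ltW|exact: expR_ge0].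
rewrite -ge0_integralM_cst//; last first.
  by apply: measurable_indic; exact: measurable_chi2_set.
have mI : measurable_fun setT (fun v : d.-tuple (measurableTypeR R) =>
     h (\sum_(k < d) tnth v k ^+ 2)%R).
  exact: (measurableT_comp mh (@measurable_sqnorm d)).
apply: ge0_le_integral => //.
- move=> v _; rewrite mule_ge0// lee_fin; apply: prodr_ge0 => k _.
  by rewrite scale_density_ge0 ?ltW.
- apply: emeasurable_funM => //.
  by apply/measurable_EFinP; exact: (measurable_prod_tnth (fun k => measurable_scale_density c)).
- apply/measurable_EFinP; apply: measurable_funM => //.
  by apply: measurable_indic; exact: measurable_chi2_set.
move=> v _; rewrite /h indicE -EFinM lee_fin -/(sqnorm v).
have -> : (v \in [set g | t <= sqnorm g]) = (t <= sqnorm v).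
  by apply/idP/idP => [/set_mem|?]//; exact/mem_set.
case: (lerP t (sqnorm v)) => [tv|_]; last by rewrite mul0r mulr0.
rewrite mul1r mulr1 big_split/= prodr_const card_ord -expR_sum; apply: ler_wpM2l.
  by apply: exprn_ge0; exact: ltW.
rewrite ler_expR -mulr_suml -mulr_sumr ler_pM2r// !mulNr lerN2 ler_wpM2l// subr_ge0.
by rewrite exprn_ege1.
Qed.

(** [chi2_tail_scale] with [c^2 = 1 + y / t], followed by [log c^2 <= c^2 - 1]. *)
Lemma chi2_tail_decay d t y : 0 < t -> 0 <= y ->
  chi2_tail d (t + y) <= expR (- ((1 - d%:R / t) / 2) * y) * chi2_tail d t.
Proof.
move=> t0 y0; pose c := Num.sqrt (1 + y / t).
have yt : 0 <= y / t by apply: divr_ge0 => //; exact: ltW.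
have cc : c ^+ 2 = 1 + y / t by rewrite sqr_sqrtr// addr_ge0.
have c1 : 1 <= c by rewrite -sqrtr1 ler_sqrt ?lerDl// addr_ge0.
have := chi2_tail_scale d t c1; rewrite cc mulrDl mul1r divfK ?gt_eqF// => H.
apply: le_trans H _; rewrite ler_wpM2r ?chi2_tail_ge0//.
have ce : c <= expR (y / t / 2).
  rewrite -(@ler_pXn2r _ 2) ?nnegrE ?sqrtr_ge0 ?expR_ge0// cc -expRM_natl.
  by apply: le_trans (expR_ge1Dx _) _; rewrite ler_expR le_eqVlt; apply/predU1P; left; field; rewrite gt_eqF.
apply: (@le_trans _ _ (expR (d%:R * (y / t / 2)) * expR (- (1 + y / t - 1) * t / 2))).
  rewrite ler_wpM2r ?expR_ge0// expRM_natl lerXn2r ?nnegrE ?expR_ge0//.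
  exact: sqrtr_ge0.
rewrite -expRD ler_expR le_eqVlt; apply/predU1P; left; field.
by rewrite gt_eqF.
Qed.

(** The tail contains the event that the first coordinate lies in a fixed
    bounded interval, on which the Gaussian density is bounded below. *)
Lemma chi2_tail_gt0 d t : (0 < d)%N -> 0 < chi2_tail d t.
Proof.
case: d => // d _; rewrite -lte_fin -chi2_tailE.
pose a := Num.sqrt (Num.max t 0).
have mI : measurable (`[a, a + 1]%classic : set (measurableTypeR R)) by exact: measurable_itv.
apply: (@lt_le_trans _ _ (normal_prob 0 1 (`[a, a + 1]%classic : set (measurableTypeR R)))).
  rewrite -(@sqrtr1 R) normal_prob_gauss_pdf// sqrtr1.
  apply: (@lt_le_trans _ _ (\int[leb]_x ((gauss_pdf 0 1 (a + 1)) * \1_(`[a, a + 1]%classic : set (measurableTypeR R)) x)%:E)%E).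
    rewrite ge0_integralM_cst ?gauss_pdf_ge0// -measure_indic//.
    have L1 : leb (`[a, a + 1]%classic : set (measurableTypeR R)) = 1%E.
      by rewrite lebesgue_measure_itv/= lte_fin ltrDl ltr01 -EFinD addrAC subrr add0r.
    rewrite [X in (_ * X)%E]L1 mule1.
    rewrite lte_fin /gauss_pdf mulr_gt0 ?expR_gt0// invr_gt0 sqrtr_gt0 mul1r mulrn_wgt0//.
    exact: pi_gt0.
  apply: ge0_le_integral => //.
  - by move=> x _; rewrite lee_fin mulr_ge0 ?gauss_pdf_ge0.
  - by apply/measurable_EFinP; apply: measurable_funM.
  - apply: emeasurable_funM; apply/measurable_EFinP => //; exact: measurable_gauss_pdf.
  move=> x _; rewrite -EFinM lee_fin mulrC indicE; case: (boolP (x \in _)) => [|_]; last by rewrite !mul0r.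
  rewrite mem_setE in_itv/= => /andP[ax xa]; rewrite !mul1r.
  rewrite /gauss_pdf ler_wpM2l ?invr_ge0 ?sqrtr_ge0// ler_expR ler_pM2r// lerN2 !subr0.
  have a0 : 0 <= a by exact: sqrtr_ge0.
  by rewrite lerXn2r ?nnegrE ?addr_ge0// (le_trans a0).
rewrite -(prod_prob_tnth (normal_prob 0 1) (@ord0 d) mI).
apply: le_measure.
- rewrite inE -[X in measurable X]setTI; exact: measurable_tnth.
- by rewrite inE; exact: measurable_chi2_set.
move=> g /=; rewrite in_itv/= => /andP[ag _].
apply: (@le_trans _ _ (tnth g ord0 ^+ 2)); last first.
  by rewrite /sqnorm big_ord_recl lerDl; apply: sumr_ge0 => k _; exact: sqr_ge0.
apply: (@le_trans _ _ (a ^+ 2)).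
  by rewrite sqr_sqrtr le_max lexx ?orbT.
by rewrite lerXn2r ?nnegrE ?sqrtr_ge0// (le_trans _ ag)// sqrtr_ge0.
Qed.

End scaling.

Section truncated_chi2.
Context {R : realType}.
Variables (d : nat) (r : R).
Hypothesis d0 : (0 < d)%N.
Hypothesis r0 : 0 < r.
Local Notation leb := (@lebesgue_measure R).
Local Notation t0 := (d%:R + r ^+ 2).
Local Notation P := (@gauss_vec R d).
Local Notation vec := (d.-tuple (measurableTypeR R)).
Local Notation B := [set g : vec | t0 <= sqnorm g].

Let t0_gt0 : 0 < t0.
Proof. by rewrite addr_gt0 ?exprn_gt0// ltr0n. Qed.

Let mB : measurable B.
Proof. exact: measurable_chi2_set. Qed.

Lemma sqnorm_mgf mu : mu <= 4^-1 ->
  (\int[P]_v (expR (mu * sqnorm v))%:E <= (expR (d%:R * (mu + 4 * mu ^+ 2)))%:E)%E.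
Proof.
move=> mu4; have := gauss_vec_mgf (fun _ : 'I_d => 0) mu4.
rewrite (_ : \sum_(k < d) 0 ^+ 2 = 0); last by rewrite big1// => k _; rewrite expr0n.
rewrite mulr0 addr0.
apply: le_trans; rewrite le_eqVlt; apply/predU1P; left; apply: eq_integral => v _.
by rewrite /sqnorm; under [in RHS]eq_bigr do rewrite add0r.
Qed.

Lemma integrable_sqnorm : P.-integrable setT (EFin \o @sqnorm R d).
Proof.
have msq := @measurable_sqnorm R d.
apply/integrableP; split; first exact/measurable_EFinP.
apply: (@le_lt_trans _ _ (\int[P]_v (4 * expR (4^-1 * sqnorm v))%:E)%E).
  apply: ge0_le_integral => //.
  - by apply: measurableT_comp => //; exact/measurable_EFinP.
  - apply/measurable_EFinP; apply: measurable_funM => //; apply: measurableT_comp => //.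
    exact: measurable_funM.
  move=> v _; rewrite /= lee_fin ger0_norm ?sqnorm_ge0//.
  rewrite -ler_pdivrMl//; apply: le_trans (expR_ge1Dx _).
  by rewrite lerDr.
rewrite ge0_integralM_cst//; last first.
  by apply: measurableT_comp => //; exact: measurable_funM.
rewrite lte_mul_pinfty//.
by apply: le_lt_trans (sqnorm_mgf (lexx _)) (ltry _).
Qed.

Let Esq := \int[P]_(g in B) sqnorm g.

Let sqB : P.-integrable B (EFin \o @sqnorm R d).
Proof. exact: integrableS integrable_sqnorm. Qed.

Let EsqE : (\int[P]_(g in B) (sqnorm g)%:E = Esq%:E)%E.
Proof. by rewrite /Esq /Rintegral fineK//; exact: integrable_fin_num. Qed.

Local Notation al := (alpha r d).

Let tailB : 0 < chi2_tail d t0. Proof. exact: chi2_tail_gt0. Qed.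

Let alphaE : al * chi2_tail d t0 = Esq.
Proof. by rewrite /alpha -/(chi2_tail d t0) -/Esq divfK// gt_eqF. Qed.

Lemma alpha_ge : t0 <= al.
Proof.
rewrite -(ler_pM2r tailB) alphaE -lee_fin -EsqE EFinM -chi2_tailE.
rewrite -(integral_cst P mB).
apply: ge0_le_integral => //.
- by move=> g _; rewrite lee_fin ltW.
- by apply/measurable_EFinP; apply: measurable_funTS; exact: measurable_sqnorm.
Qed.

(** The mean residual life is at most the inverse of the hazard rate. *)
Lemma alpha_le : al <= t0 + 2 * t0 / r ^+ 2.
Proof.
pose X (g : vec) : R := Num.max 0 (sqnorm g - t0).
have mX : measurable_fun setT X.
  apply: measurable_maxr => //; apply: measurable_funB => //; exact: measurable_sqnorm.
have X0 g : 0 <= X g by rewrite /X le_max lexx.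
pose Xmix := isMeasurableFun.Build _ _ _ _ _ mX.
pose XX : {RV P >-> R} := HB.pack X Xmix.
pose h := r ^+ 2 / (2 * t0).
have h0 : 0 < h by rewrite divr_gt0 ?exprn_gt0// mulr_gt0.
have hE : h = (1 - d%:R / t0) / 2.
  by rewrite /h; field; rewrite gt_eqF.
have EX : ('E_P[XX] <= (chi2_tail d t0 / h)%:E)%E.
  rewrite ge0_expectation_ccdf//.
  apply: (@le_trans _ _ (\int[leb]_(y in `[0%R, +oo[) ((chi2_tail d t0 / h)%:E * (exponential_pdf h y)%:E))%E).
    apply: ge0_le_integral => //.
    - by apply: measurable_funTS; exact: ccdf_measurable.
    - apply: emeasurable_funM => //; apply/measurable_EFinP; apply: measurable_funTS.
      exact: measurable_exponential_pdf.
    move=> y /=; rewrite in_itv/= andbT => y0.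
    apply: (@le_trans _ _ (chi2_tail d (t0 + y))%:E).
      rewrite -chi2_tailE /ccdf /distribution/= /pushforward; apply: le_measure.
      - rewrite inE -[X in measurable X]setTI; exact: (mX measurableT _ (measurable_itv _)).
      - by rewrite inE; exact: measurable_chi2_set.
      - move=> g /=; rewrite in_itv/= andbT /X lt_max ltNge y0/= ltrBrDl => /ltW.
        by [].
    apply: (@le_trans _ _ (expR (- h * y) * chi2_tail d t0)%:E).
      by rewrite lee_fin hE; exact: chi2_tail_decay.
    rewrite exponential_pdfE// -EFinM lee_fin mulrC.
    by rewrite mulrA divfK ?gt_eqF.
  rewrite ge0_integralZl//; last 3 first.
  - apply/measurable_EFinP; apply: measurable_funTS; exact: measurable_exponential_pdf.
  - by move=> y _; rewrite lee_fin exponential_pdf_ge0// ltW.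
  - by rewrite lee_fin divr_ge0 ?chi2_tail_ge0// ltW.
  rewrite -[leRHS]mule1; apply: lee_wpmul2l.
    by rewrite lee_fin divr_ge0 ?chi2_tail_ge0// ltW.
  rewrite -(integral_exponential_pdf h0); apply: ge0_subset_integral => //.
  - by apply/measurable_EFinP; exact: measurable_exponential_pdf.
  - by move=> y _; rewrite lee_fin exponential_pdf_ge0// ltW.
have key : Esq - t0 * chi2_tail d t0 <= chi2_tail d t0 / h.
  rewrite -lee_fin EFinB -EsqE EFinM -chi2_tailE -(integral_cst P mB).
  rewrite -integralB//; last first.
    exact: finite_measure_integrable_cst.
  apply: le_trans EX; rewrite unlock /expectation.
  rewrite (_ : (\int[P]_(g in B) _)%E = (\int[P]_(g in B) (X g)%:E)%E); last first.
    apply: eq_integral => g /set_mem gB; rewrite /= -EFinB /X; congr EFin.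
    by rewrite max_r// subr_ge0.
  apply: ge0_subset_integral => //; first exact/measurable_EFinP.
  by move=> g _; rewrite lee_fin.
rewrite -(ler_pM2r tailB) alphaE mulrDl -lerBlDl; apply: le_trans key _.
by rewrite le_eqVlt; apply/predU1P; left; rewrite /h; field; rewrite !gt_eqF.
Qed.

Definition truncated (v : vec) : R := (sqnorm v - al) * (t0 <= sqnorm v)%R%:R.

Lemma measurable_truncated : measurable_fun setT truncated.
Proof.
apply: measurable_funM; first by apply: measurable_funB => //; exact: measurable_sqnorm.
rewrite (_ : (fun _ => _) = \1_B); first exact: measurable_indic.
apply/funext => v; rewrite indicE; congr (nat_of_bool _)%:R.
by apply/idP/idP => [?|/set_mem]//; exact/mem_set.
Qed.

Let truncatedE v : truncated v = ((fun v => sqnorm v - al) \_ B) v.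
Proof.
rewrite /truncated patchE; have -> : (v \in B) = (t0 <= sqnorm v).
  by apply/idP/idP => [/set_mem|?]//; exact/mem_set.
by case: (_ <= _); rewrite ?mulr1 ?mulr0.
Qed.

Let sqalB : P.-integrable B (EFin \o (fun v => sqnorm v - al)).
Proof.
have -> : EFin \o (fun v : vec => sqnorm v - al) = ((EFin \o @sqnorm R d) \- cst al%:E)%E.
  by apply/funext => v /=; rewrite EFinB.
by apply: integrableB => //; exact: finite_measure_integrable_cst.
Qed.

Lemma integrable_truncated : P.-integrable setT (EFin \o truncated).
Proof.
have -> : EFin \o truncated = (EFin \o (fun v => sqnorm v - al)) \_ B.
  by apply/funext => v /=; rewrite truncatedE /= !patchE; case: ifP.
by rewrite -integrable_mkcond.
Qed.

(** [alpha] is chosen so that the truncated statistic is centred. *)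
Lemma integral_truncated : (\int[P]_v (truncated v)%:E = 0)%E.
Proof.
transitivity (\int[P]_(v in B) (sqnorm v - al)%:E)%E.
  rewrite [RHS]integral_mkcond; apply: eq_integral => v _.
  by rewrite truncatedE !patchE; case: ifP.
under eq_integral do rewrite EFinB.
rewrite integralB//; last exact: finite_measure_integrable_cst.
by rewrite EsqE integral_cst// [X in (_ - _ * X)%E]chi2_tailE -EFinM alphaE subee.
Qed.

Let expR_sub1_le (x : R) : `|expR x - 1| <= `|x| * expR `|x|.
Proof.
have [x0|x0] := lerP 0 x.
  have e1 : 1 <= expR x by rewrite -expR0 ler_expR.
  rewrite !ger0_norm ?subr_ge0//; have := expR_ge1Dx (- x).
  rewrite -(ler_pM2r (expR_gt0 x)) -expRD addNr expR0; lra.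
have e1 : expR x <= 1 by rewrite -expR0 ler_expR ltW.
rewrite (ltr0_norm x0) ler0_norm ?subr_le0//.
have h1 := expR_ge1Dx x; have : 1 <= expR (- x) by rewrite -expR0 ler_expR oppr_ge0 ltW.
by nra.
Qed.

Let expR_taylor (x : R) : expR x <= 1 + x + x ^+ 2 * expR `|x|.
Proof.
have H : x * (expR x - 1) <= x ^+ 2 * expR `|x|.
  apply: le_trans (ler_norm _) _; rewrite normrM -real_normK ?num_real// expr2 -mulrA.
  by rewrite ler_wpM2l ?expR_sub1_le.
have := expR_ge1Dx (- x); rewrite -(ler_pM2r (expR_gt0 x)) -expRD addNr expR0 => H1.
by nra.
Qed.

Let sqr_le_expR (y : R) : 0 <= y -> y ^+ 2 <= expR (2 * y).
Proof.
move=> y0; rewrite expRM_natl lerXn2r ?nnegrE ?expR_ge0//.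
by apply: le_trans (expR_ge1Dx _); rewrite lerDr.
Qed.

(** [expR x <= 1 + x + x^2 expR |x|], where the linear term integrates to zero.
    Where the truncated variable does not vanish, its modulus is at most
    [(sqnorm - d) + (alpha - d)], and the indicator is bounded by [expR (theta (sqnorm - d - r^2))]; the resulting
    exponential moment of the chi-square variable is explicit. *)
Lemma truncated_mgf (lam theta rho : R) : 0 < lam -> 0 < theta ->
  3 * lam + theta <= 4^-1 -> `|rho| <= 1 ->
  (\int[P]_v (expR (rho * lam * truncated v))%:E <=
   (1 + rho ^+ 2 * expR (3 * lam * (al - d%:R) - theta * r ^+ 2 +
      4 * (3 * lam + theta) ^+ 2 * d%:R))%:E)%E.
Proof.
move=> lam0 theta0 mu4 rho1; set mu := 3 * lam + theta.
pose K := expR (3 * lam * (al - d%:R) - theta * r ^+ 2 - mu * d%:R).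
have K0 : 0 <= K by exact: expR_ge0.
have mF := measurable_truncated.
have pw v : expR (rho * lam * truncated v) <=
    1 + rho * lam * truncated v + rho ^+ 2 * K * expR (mu * sqnorm v).
  rewrite /truncated; case: (lerP t0 (sqnorm v)) => [tv|_]; last first.
    rewrite !mulr0 expR0 addr0 lerDl mulr_ge0 ?expR_ge0// mulr_ge0 ?sqr_ge0//.
  rewrite mulr1; set z := sqnorm v - al.
  apply: le_trans (expR_taylor _) _; rewrite lerD2l -(mulrA rho) exprMn -2!(mulrA (rho ^+ 2)) ler_wpM2l ?sqr_ge0//.
  set y := lam * `|z|.
  have y0 : 0 <= y by apply: mulr_ge0 => //; exact: ltW.
  have zz : (lam * z) ^+ 2 = y ^+ 2 by rewrite /y !exprMn real_normK ?num_real.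
  rewrite zz; apply: (@le_trans _ _ (expR (2 * y) * expR y)).
    apply: ler_pM; rewrite ?sqr_ge0 ?expR_ge0 ?sqr_le_expR// ler_expR !normrM (gtr0_norm lam0).
    by rewrite -/y ler_piMl.
  rewrite -!expRD ler_expR.
  have zle : `|z| <= (sqnorm v - d%:R) + (al - d%:R).
    have r2 : 0 < r ^+ 2 by rewrite exprn_gt0.
    have := alpha_ge; rewrite ler_norml /z => ta; apply/andP; split; lra.
  have : theta * (d%:R + r ^+ 2) <= theta * sqnorm v by rewrite ler_pM2l.
  have : lam * `|z| <= lam * (sqnorm v - d%:R + (al - d%:R)) by rewrite ler_pM2l.
  rewrite -/y /mu => h1 h2; lra.
have mE c : measurable_fun setT (fun v : vec => expR (c * sqnorm v)).
  by apply: measurableT_comp => //; apply: measurable_funM => //; exact: measurable_sqnorm.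
have fint : P.-integrable setT (fun v => (expR (mu * sqnorm v))%:E).
  apply/integrableP; split; first exact/measurable_EFinP.
  under eq_integral do rewrite /= ger0_norm ?expR_ge0//.
  by apply: le_lt_trans (sqnorm_mgf mu4) (ltry _).
apply: (@le_trans _ _ (\int[P]_v (1%:E + (rho * lam)%:E * (truncated v)%:E +
    (rho ^+ 2 * K)%:E * (expR (mu * sqnorm v))%:E))%E).
  apply: ge0_le_integral => //.
  - by apply/measurable_EFinP; apply: measurableT_comp => //; apply: measurable_funM.
  - by apply: emeasurable_funD; [apply: emeasurable_funD => //|];
      apply: emeasurable_funM => //; apply/measurable_EFinP; [|exact: mE].
  - by move=> v _; rewrite -!EFinM -!EFinD lee_fin.
rewrite integralD//; last 2 first.
- apply: integrableD => //; first exact: finite_measure_integrable_cst.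
  by apply: integrableZl => //; exact: integrable_truncated.
- exact: integrableZl.
rewrite integralD//; last 2 first.
- exact: finite_measure_integrable_cst.
- by apply: integrableZl => //; exact: integrable_truncated.
rewrite integral_prob_cst !integralZl//; last exact: integrable_truncated.
rewrite integral_truncated mule0 adde0 EFinD leeD2l//.
apply: (@le_trans _ _ ((rho ^+ 2 * K)%:E * (expR (d%:R * (mu + 4 * mu ^+ 2)))%:E)%E).
  by apply: lee_wpmul2l; [rewrite lee_fin mulr_ge0 ?sqr_ge0|exact: sqnorm_mgf].
rewrite -EFinM lee_fin -(mulrA (rho ^+ 2) K); apply: ler_wpM2l; first exact: sqr_ge0.
rewrite -expRD ler_expR.
by rewrite le_eqVlt; apply/predU1P; left; ring.
Qed.

End truncated_chi2.

(** * Deviations of the sparse and dense statistics *)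

Section calibration.
Context {R : realType}.
Local Notation law p d := (prod_prob (@gauss_vec R d) p).
Local Notation arr p d := (p.-tuple (d.-tuple (measurableTypeR R))).

(** [w] is the threshold of the test divided by [C s]. The condition says that at
    the exponential scale [L / (128 w)] the truncated variable has moment
    generating function [1 + rho^2 exp (- 2 L)], and that [alpha - d] and
    [sqrt d] are at most of the order of [w]. *)
Definition calibrated d (r L w : R) : Prop :=
  exists lam : R, [/\ 0 < lam, lam * w = L / 128, alpha r d <= d%:R + 512 * w,
    Num.sqrt d%:R <= 16 * w &
    forall rho : R, `|rho| <= 1 ->
      (\int[gauss_vec d]_v (expR (rho * lam * truncated r v))%:E <=
       (1 + rho ^+ 2 * expR (- (2 * L)))%:E)%E].

(** [truncated_mgf] with [theta = sqrt (L / d)] and [lam] a small multiple of it: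
    [theta r^2] is then a large multiple of [L], against [lam (alpha - d)] and
    [theta^2 d], which are smaller ones. *)
Lemma calibrated_bulk d (r L : R) : (0 < d)%N -> 0 < r -> 2^-1 <= L ->
  Num.sqrt L <= 8^-1 * Num.sqrt d%:R -> r ^+ 2 = 16 * Num.sqrt (d%:R * L) ->
  calibrated d r L (Num.sqrt (d%:R * L)).
Proof.
move=> d0 r0 L2; set l := Num.sqrt L; set e := Num.sqrt d%:R => le8 rE.
have dE : d%:R = e ^+ 2 :> R by rewrite sqr_sqrtr.
have LE : L = l ^+ 2 by rewrite sqr_sqrtr//; lra.
have wE : Num.sqrt (d%:R * L) = e * l by rewrite sqrtrM.
have e0 : 0 < e by rewrite sqrtr_gt0 ltr0n.
have l0 : 0 < l by rewrite sqrtr_gt0; lra.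
rewrite wE in rE *.
pose q := l / e.
have q0 : 0 < q by rewrite divr_gt0.
have lE : l = q * e by rewrite /q divfK// gt_eqF.
have q8 : q <= 8^-1 by rewrite /q ler_pdivrMr.
have qe : 2^-1 <= q ^+ 2 * e ^+ 2 by rewrite -exprMn -lE -LE.
have r2 : r ^+ 2 = 16 * (q * e ^+ 2) by rewrite rE lE; ring.
have al : alpha r d <= d%:R + 32 * (q * e ^+ 2).
  apply: le_trans (alpha_le d0 r0) _; rewrite r2 dE.
  have qe2 : 0 < q * e ^+ 2 by rewrite mulr_gt0 ?exprn_gt0.
  have h : 2 * (e ^+ 2 + 16 * (q * e ^+ 2)) / (16 * (q * e ^+ 2)) = 2 + q^-1 / 8.
    by field; rewrite !gt_eqF.
  rewrite h.
  have qV : q * q^-1 = 1 by rewrite mulfV// gt_eqF.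
  have qV0 : 0 < q^-1 by rewrite invr_gt0.
  have : q^-1 <= 2 * (q * e ^+ 2).
    rewrite -(ler_pM2l q0) qV; nra.
  have : 8 <= q^-1 by rewrite -[leLHS]invrK lef_pV2 ?posrE.
  lra.
have LE' : L = q ^+ 2 * e ^+ 2 by rewrite LE lE exprMn.
exists (q / 128); split.
- by rewrite divr_gt0.
- by rewrite LE' lE; ring.
- apply: le_trans al _; rewrite lerD2l lE; have : 0 < q * e ^+ 2 by rewrite mulr_gt0 ?exprn_gt0.
  nra.
- rewrite -/e lE.
  have : 1 <= 2 * (q ^+ 2 * e ^+ 2) by lra.
  have : q ^+ 2 <= q / 8 by rewrite expr2 ler_pM2l.
  have ee : 0 < e ^+ 2 by rewrite exprn_gt0.
  nra.
move=> rho rho1; have q128 : 0 < q / 128 by rewrite divr_gt0.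
apply: le_trans (truncated_mgf d0 r0 q128 q0 _ rho1) _; first lra.
rewrite lee_fin lerD2l ler_wpM2l ?sqr_ge0// ler_expR LE' r2 dE.
have : q * (alpha r d - e ^+ 2) <= q * (32 * (q * e ^+ 2)).
  by rewrite ler_pM2l// lerBlDl; move: al; rewrite dE.
have : 0 < q ^+ 2 * e ^+ 2 by lra.
nra.
Qed.

(** Here [d] is at most a multiple of [L], and [truncated_mgf] applies with
    constant [lam] and [theta]. *)
Lemma calibrated_tail d (r L : R) : (0 < d)%N -> 0 < r -> 2^-1 <= L ->
  8^-1 * Num.sqrt d%:R < Num.sqrt L -> r ^+ 2 = 256 * L ->
  calibrated d r L L.
Proof.
move=> d0 r0 L2 le8 rE.
have d64 : d%:R <= 64 * L.
  have L0 : 0 <= L by lra.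
  have -> : d%:R = Num.sqrt d%:R ^+ 2 :> R by rewrite sqr_sqrtr.
  have -> : L = Num.sqrt L ^+ 2 by rewrite sqr_sqrtr.
  by have := sqrtr_ge0 (d%:R : R); have := sqrtr_ge0 L; nra.
have al : alpha r d <= d%:R + 512 * L.
  apply: le_trans (alpha_le d0 r0) _; rewrite rE.
  have : 2 * (d%:R + 256 * L) / (256 * L) <= 3.
    by rewrite ler_pdivrMr; lra.
  lra.
exists 128^-1; split => //.
- by rewrite mulrC.
- have L0 : 0 <= L by lra.
  have s0 := sqrtr_ge0 L; have LE := sqr_sqrtr L0.
  have : 2^-1 <= Num.sqrt L.
    by rewrite -[leLHS]ger0_norm// -sqrtr_sqr ler_wsqrtr//; lra.
  nra.
move=> rho rho1.
apply: le_trans (truncated_mgf d0 r0 _ _ _ rho1 (lam := 128^-1) (theta := 8^-1)) _ => //; first lra.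
rewrite lee_fin lerD2l ler_wpM2l ?sqr_ge0// ler_expR rE.
lra.
Qed.

Lemma measurable_truncated_sum p d (S : {set 'I_p}) (r : R) :
  measurable_fun setT (fun t : arr p d => \sum_(j in S) truncated r (tnth t j)).
Proof.
under eq_fun do rewrite big_mkcond/=; apply: measurable_sum => j; case: (j \in S) => //.
by apply: (measurableT_comp (@measurable_truncated R d r)); exact: measurable_tnth.
Qed.

Lemma truncated_sum_tail p d (S : {set 'I_p}) (r Q lam rho y : R) :
  (\int[gauss_vec d]_v (expR (rho * lam * truncated r v))%:E <= (1 + Q)%:E)%E ->
  0 <= Q -> 0 <= lam ->
  (law p d [set t | y <= rho * \sum_(j in S) truncated r (tnth t j)]%R
   <= (expR (- (lam * y) + p%:R * Q))%:E)%E.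
Proof.
move=> HQ Q0 lam0.
pose X (t : arr p d) := rho * \sum_(j in S) truncated r (tnth t j).
have mtr := @measurable_truncated R d r.
have mX : measurable_fun setT X.
  by apply: measurable_funM => //; exact: measurable_truncated_sum.
apply: (@le_trans _ _ (\int[law p d]_t (expR (- (lam * y)) * expR (lam * X t))%:E)%E).
  apply: le_measure_integral.
  - exact: measurable_ge_cst.
  - by apply: measurable_funM => //; apply: measurableT_comp => //; exact: measurable_funM.
  - by move=> t; rewrite mulr_ge0 ?expR_ge0.
  - move=> t /= Xt; rewrite -expRD -[leLHS]expR0 ler_expR addrC subr_ge0.
    by rewrite ler_wpM2l.
rewrite ge0_integralM_cst ?expR_ge0//; last first.
  by apply: measurableT_comp => //; exact: measurable_funM.
rewrite expRD EFinM; apply: lee_wpmul2l; first by rewrite lee_fin expR_ge0.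
pose g j (v : d.-tuple (measurableTypeR R)) : R :=
  if j \in S then expR (rho * lam * truncated r v) else 1.
under eq_integral => t _.
  rewrite /X mulrA (mulrC lam) mulr_sumr expR_sum big_mkcond/=.
  rewrite -/(\prod_(j < p) g j (tnth t j)).
  over.
rewrite (@ge0_integral_prod_prob_prod _ _ _ (gauss_vec d) p g); last 2 first.
- move=> j; rewrite /g; case: (j \in S) => //; apply: measurableT_comp => //.
  exact: measurable_funM.
- by move=> j v; rewrite /g; case: ifP => // _; exact: expR_ge0.
have -> : p%:R * Q = \sum_(j < p) Q by rewrite sumr_const card_ord mulr_natl.
rewrite expR_sum -prodEFin.
apply: lee_prodl => j; apply/andP; split.
  by apply: integral_ge0 => v _; rewrite lee_fin /g; case: ifP => // _; exact: expR_ge0.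
rewrite /g; case: (j \in S).
  by apply: le_trans HQ _; rewrite lee_fin expR_ge1Dx.
by rewrite integral_prob_cst lee_fin -expR0 ler_expR.
Qed.

(** Since [expR L = 1 + p A / s^2]. *)
Lemma sparse_mgf_mass p s (A L : R) : (0 < s)%N -> 1 <= A ->
  L = ln (1 + p%:R * A / s%:R ^+ 2) ->
  p%:R * expR (- (2 * L)) <= s%:R ^+ 2 / (A * expR L).
Proof.
move=> s0 A1 LE; set u := p%:R * A / s%:R ^+ 2 in LE.
have s2 : 0 < s%:R ^+ 2 :> R by rewrite exprn_gt0// ltr0n.
have A0 : 0 < A by lra.
have u0 : 0 <= u by apply: divr_ge0; [apply: mulr_ge0 => //|]; exact: ltW.
have eL : expR L = 1 + u by rewrite LE lnK// posrE; lra.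
rewrite expRN (_ : 2 * L = L + L); last by ring.
rewrite expRD eL.
have -> : p%:R = u * s%:R ^+ 2 / A by rewrite /u; field; rewrite !gt_eqF// ltr0n.
have -> : s%:R ^+ 2 / (A * (1 + u)) = (1 + u) * (s%:R ^+ 2 / (A * ((1 + u) * (1 + u)))).
  by field; rewrite !gt_eqF//; lra.
have -> : u * s%:R ^+ 2 / A * ((1 + u) * (1 + u))^-1 = u * (s%:R ^+ 2 / (A * ((1 + u) * (1 + u)))).
  by field; rewrite !gt_eqF//; lra.
apply: ler_wpM2r; last lra.
by apply: divr_ge0; [exact: ltW|apply: mulr_ge0; nra].
Qed.

(** Chernoff's exponent is [- rho C z + rho^2 / B] with [z] of order [s L]. The
    choice [rho = z B] balances its terms, unless this exceeds the admissible range
    [rho <= 1]; the two terms of the bound correspond to the two cases. *)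
Lemma sparse_null_tail p d s (r A L w C : R) : (0 < s)%N -> 1 <= A ->
  L = ln (1 + p%:R * A / s%:R ^+ 2) -> 0 < L -> 1 <= C ->
  calibrated d r L w ->
  (law p d [set t | C * s%:R * w < \sum_(j < p) truncated r (tnth t j)]%R <=
   (expR (- ((C - 1) / 128 * (s%:R * L))) +
    expR (- ((C - 1) / 128 ^+ 2 * (L ^+ 2 * A * expR L))))%:E)%E.
Proof.
move=> s0 A1 LE L0 C1 [lam [lam0 lamw _ _ mgf]].
have s00 : 0 < s%:R :> R by rewrite ltr0n.
set c : R := 128^-1; have c0 : 0 < c by rewrite invr_gt0.
set B := A * expR L / s%:R ^+ 2.
have B0 : 0 < B by rewrite divr_gt0 ?exprn_gt0// mulr_gt0 ?expR_gt0//; lra.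
set z := c * (s%:R * L); have z0 : 0 < z by rewrite !mulr_gt0.
have tail rho : 0 < rho -> rho <= 1 ->
  (law p d [set t | C * s%:R * w < \sum_(j < p) truncated r (tnth t j)]%R <=
   (expR (- (rho * C * z) + rho ^+ 2 / B))%:E)%E.
  move=> rho0 rho1.
  apply: (@le_trans _ _ (law p d [set t | rho * (C * s%:R * w) <= rho * \sum_(j in finset.setT) truncated r (tnth t j)]%R)).
    apply: le_measure; rewrite ?inE.
    - apply: measurable_gt_cst; apply: measurable_sum => j.
      by apply: (measurableT_comp (@measurable_truncated R d r)); exact: measurable_tnth.
    - by apply: measurable_ge_cst; apply: measurable_funM => //; exact: measurable_truncated_sum.
    - move=> t /= H; rewrite ler_pM2l// ltW//; apply: lt_le_trans H _.
      by rewrite le_eqVlt; apply/predU1P; left; apply: eq_bigl => j; rewrite finset.in_setT.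
  apply: le_trans (truncated_sum_tail _ _ (mgf rho _) _ _) _.
  - by rewrite gtr0_norm.
  - by rewrite mulr_ge0 ?sqr_ge0 ?expR_ge0.
  - exact: ltW.
  rewrite lee_fin ler_expR.
  have -> : lam * (rho * (C * s%:R * w)) = rho * C * z.
    by rewrite /z /c mulrC -!mulrA (mulrC w) lamw; ring.
  rewrite lerD2l mulrCA ler_wpM2l ?sqr_ge0//.
  apply: le_trans (sparse_mgf_mass s0 A1 LE) _.
  by rewrite /B invf_div.
have [zB|zB] := lerP (z * B) 1.
  apply: le_trans (tail (z * B) (mulr_gt0 z0 B0) zB) _.
  rewrite lee_fin; apply: (@le_trans _ _ (expR (- ((C - 1) / 128 ^+ 2 * (L ^+ 2 * A * expR L))))); last first.
    by rewrite lerDr expR_ge0.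
  rewrite ler_expR le_eqVlt; apply/predU1P; left.
  by rewrite /z /B /c; field; do ?[apply/andP; split]; rewrite gt_eqF ?expR_gt0//; lra.
apply: le_trans (tail 1 ltr01 (lexx _)) _.
rewrite lee_fin; apply: (@le_trans _ _ (expR (- ((C - 1) / 128 * (s%:R * L))))); last first.
  by rewrite lerDl expR_ge0.
rewrite ler_expR expr1n !mul1r.
have : B^-1 <= z by rewrite -[leLHS]mul1r ler_pdivrMr// ltW.
have -> : (C - 1) / 128 * (s%:R * L) = (C - 1) * z by rewrite /z /c; ring.
lra.
Qed.

Definition shifted_tstat p d (r : R) (b : 'I_p -> 'I_d -> R) (t : arr p d) : R :=
  \sum_(j < p) (\sum_(k < d) (b j k + tnth (tnth t j) k) ^+ 2 - alpha r d) *
    (d%:R + r ^+ 2 <= \sum_(k < d) (b j k + tnth (tnth t j) k) ^+ 2)%R%:R.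

Lemma measurable_shifted_tstat p d r (b : 'I_p -> 'I_d -> R) :
  measurable_fun setT (@shifted_tstat p d r b).
Proof.
apply: measurable_sum => j.
have mE : measurable_fun setT (fun t : arr p d => \sum_(k < d) (b j k + tnth (tnth t j) k) ^+ 2).
  by apply: (measurableT_comp (measurable_shifted_sqnorm (b j))); exact: measurable_tnth.
apply: measurable_funM; first by apply: measurable_funB.
set f := fun t : arr p d => _ in mE.
rewrite (_ : (fun _ => _) = \1_[set t | d%:R + r ^+ 2 <= f t]); last first.
  apply/funext => v; rewrite indicE; congr (nat_of_bool _)%:R.
  by apply/idP/idP => [?|/set_mem]//; exact/mem_set.
by apply: measurable_indic; exact: measurable_ge_cst.
Qed.

Lemma shifted_tstat0 p d r (t : arr p d) :
  shifted_tstat r (fun _ _ => 0) t = \sum_(j < p) truncated r (tnth t j).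
Proof.
by apply: eq_bigr => j _; rewrite /truncated /sqnorm; under eq_bigr do rewrite add0r.
Qed.

(** A term removed by the truncation has energy at most [d + r^2 <= alpha], so
    putting it back decreases the statistic. *)
Lemma shifted_tstat_ge p d r (S : {set 'I_p}) (b : 'I_p -> 'I_d -> R) (t : arr p d) :
  (0 < d)%N -> 0 < r -> (forall j k, j \notin S -> b j k = 0) ->
  \sum_(j in ~: S) truncated r (tnth t j) +
    (shifted_sqnorm S b t - #|S|%:R * alpha r d) <= shifted_tstat r b t.
Proof.
move=> d0 r0 bS.
rewrite [leRHS](bigID (mem S))/= addrC; apply: lerD; last first.
  rewrite mulr_natl -sumr_const /shifted_sqnorm -sumrB; apply: ler_sum => j jS.
  case: (lerP (d%:R + r ^+ 2) _) => [_|lt]; rewrite ?mulr1// mulr0.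
  by rewrite subr_le0 (le_trans (ltW lt))// alpha_ge.
rewrite le_eqVlt; apply/predU1P; left.
apply: eq_big => j; first by rewrite finset.in_setC.
rewrite finset.in_setC => jS; rewrite /truncated /sqnorm.
by have -> : \sum_(k < d) (b j k + tnth (tnth t j) k) ^+ 2 = \sum_(k < d) tnth (tnth t j) k ^+ 2
  by apply: eq_bigr => k _; rewrite bS// add0r.
Qed.

(** The statistic is below its threshold only if the inactive part is very
    negative or the energy on [S] is atypically small. The first is bounded with
    [rho = - 1 / s], the second by [chi2_lower_tail] at the scale of the standard
    deviation [sqrt (s d)] of the energy, which is at most of order [s w]. *)
Lemma sparse_power_tail p d s (S : {set 'I_p}) (b : 'I_p -> 'I_d -> R) (r A L w C : R) :
  (0 < d)%N -> 0 < r -> (0 < s)%N -> 1 <= A ->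
  L = ln (1 + p%:R * A / s%:R ^+ 2) -> 2^-1 <= L -> 0 <= C ->
  calibrated d r L w -> (#|S| <= 2 * s)%N ->
  (forall j k, j \notin S -> b j k = 0) ->
  (4 * C + 2048) * (s%:R * w) <= \sum_(j in S) \sum_(k < d) b j k ^+ 2 ->
  (law p d [set t | shifted_tstat r b t <= C * s%:R * w]%R <=
   (expR (1 - C / 256) + expR (1 - C / 256))%:E)%E.
Proof.
move=> d0 r0 s0 A1 LE L2 C0 [lam [lam0 lamw al dw mgf]] Ss bS.
set Delta := \sum_(j in S) _ => DE.
have s00 : 0 < s%:R :> R by rewrite ltr0n.
have s1 : 1 <= s%:R :> R by rewrite ler1n.
have w0 : 0 < w by rewrite -(pmulr_rgt0 _ lam0) lamw; lra.
have sw0 : 0 < s%:R * w by rewrite mulr_gt0.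
pose N (t : arr p d) := (- s%:R^-1) * \sum_(j in ~: S) truncated r (tnth t j).
have mN : measurable_fun setT N.
  by apply: measurable_funM => //; exact: measurable_truncated_sum.
have mE := measurable_shifted_sqnorm_set S b.
apply: (@le_trans _ _ (law p d ([set t | C * w <= N t] `|`
   [set t | shifted_sqnorm S b t <= (#|S| * d)%:R + Delta / 2]))).
  apply: le_measure; rewrite ?inE.
  - by apply: measurable_le_cst; exact: measurable_shifted_tstat.
  - by apply: measurableU; [exact: measurable_ge_cst|exact: measurable_le_cst].
  move=> t /= T; have [?|NC] := lerP (C * w) (N t); [by left|right].
  have := shifted_tstat_ge t d0 r0 bS; rewrite -/Delta.
  have : - (C * s%:R * w) <= \sum_(j in ~: S) truncated r (tnth t j).
    have : - N t * s%:R = \sum_(j in ~: S) truncated r (tnth t j).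
      by rewrite /N; field; rewrite gt_eqF.
    move=> <-; have : N t * s%:R <= C * w * s%:R by rewrite ler_pM2r// ltW.
    nra.
  have : #|S|%:R * alpha r d <= (#|S| * d)%:R + 1024 * (s%:R * w).
    apply: le_trans (ler_wpM2l _ al) _ => //; rewrite mulrDr natrM lerD2l.
    have : #|S|%:R <= 2 * s%:R :> R by rewrite -natrM ler_nat.
    have : 0 <= #|S|%:R :> R by [].
    nra.
  move=> h1 h2 h3; nra.
apply: (le_trans (measureU2 _ _ _)).
- exact: measurable_ge_cst.
- exact: measurable_le_cst.
rewrite EFinD; apply: leeD.
  have rho1 : `|- s%:R^-1| <= 1 :> R.
    by rewrite normrN gtr0_norm ?invr_gt0// invf_le1.
  apply: le_trans (truncated_sum_tail _ _ (mgf _ rho1) _ _) _.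
  - by rewrite mulr_ge0 ?sqr_ge0 ?expR_ge0.
  - exact: ltW.
  rewrite lee_fin ler_expR.
  have -> : lam * (C * w) = C * (L / 128) by rewrite -lamw; ring.
  have : p%:R * ((- s%:R^-1) ^+ 2 * expR (- (2 * L))) <= 1.
    rewrite sqrrN mulrCA exprVn ler_pdivrMl ?exprn_gt0// mulr1.
    apply: le_trans (sparse_mgf_mass s0 A1 LE) _.
    have : 1 <= A * expR L.
      have : 1 <= expR L by rewrite -expR0 ler_expR; lra.
      nra.
    move=> h; rewrite ler_pdivrMr; last lra.
    by rewrite ler_peMr ?sqr_ge0.
  have : C * (2^-1 / 128) <= C * (L / 128) by rewrite ler_wpM2l//; lra.
  lra.
pose x : R := Num.sqrt d%:R; pose y : R := Num.sqrt s%:R.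
have x1 : 1 <= x by rewrite -sqrtr1 ler_wsqrtr// ler1n.
have y1 : 1 <= y by rewrite -sqrtr1 ler_wsqrtr.
have xE : d%:R = x ^+ 2 by rewrite sqr_sqrtr.
have yE : s%:R = y ^+ 2 by rewrite sqr_sqrtr.
have xy0 : 0 < x * y by nra.
(* The inverse standard deviation, up to the factor that keeps l2 <= 1/8. *)
pose l2 : R := (12 * (x * y))^-1.
have l2E : l2 * (x * y) = 12^-1 by rewrite /l2; field; rewrite !gt_eqF; nra.
have l20 : 0 < l2 by rewrite invr_gt0; nra.
apply: le_trans (chi2_lower_tail (lam := l2) _ _ (erefl Delta)) _.
- exact: ltW.
- by rewrite /l2 lef_pV2 ?posrE//; nra.
rewrite lee_fin ler_expR.
have Sd : (#|S| * d)%:R <= 2 * (x * y) ^+ 2.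
  have : #|S|%:R <= 2 * y ^+ 2 by rewrite -yE -natrM ler_nat.
  by move=> /(ler_wpM2r (sqr_ge0 x)); rewrite natrM xE; lra.
have h1 : 4 * l2 ^+ 2 * (#|S| * d)%:R <= 4 * l2 ^+ 2 * (2 * (x * y) ^+ 2).
  by rewrite ler_wpM2l// mulr_ge0 ?sqr_ge0.
have h2 : 4 * l2 ^+ 2 * (2 * (x * y) ^+ 2) = 8 * (12^-1) ^+ 2 by rewrite -l2E; ring.
have h3 : x * y <= 16 * (s%:R * w).
  have : x * y <= 16 * w * y by rewrite ler_wpM2r//; lra.
  have : 16 * w * y <= 16 * w * s%:R by rewrite ler_wpM2l ?yE; nra.
  lra.
have h4 : l2 * (x * y) <= l2 * (16 * (s%:R * w)) by rewrite ler_pM2l.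
have h5 : l2 * ((4 * C + 2048) * (s%:R * w)) <= l2 * Delta by rewrite ler_pM2l.
have h6 : 0 < l2 * (s%:R * w) by rewrite mulr_gt0.
have h7 : C * (12^-1 / 16) <= C * (l2 * (s%:R * w)) by rewrite ler_wpM2l//; nra.
nra.
Qed.

(** [chi2_upper_tail] at [mu] of order [sqrt (A / (v p))], which is admissible
    because [A <= p]. *)
Lemma dense_null_tail p v (A C : R) : (0 < p)%N -> (0 < v)%N -> 1 <= A -> A <= p%:R ->
  (law p v [set t | v%:R * p%:R + C * Num.sqrt (v%:R * p%:R * A)
      < shifted_sqnorm finset.setT (fun _ _ => 0) t]%R <=
   (expR (- ((C - 1) / 4 * A)))%:E)%E.
Proof.
move=> p0 v0 A1 Ap; pose m : R := Num.sqrt (v%:R * p%:R); pose a : R := Num.sqrt A.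
have A0 : 0 <= A by lra.
have mE : v%:R * p%:R = m ^+ 2 by rewrite sqr_sqrtr// mulr_ge0.
have aE : A = a ^+ 2 by rewrite sqr_sqrtr.
have m0 : 0 < m by rewrite sqrtr_gt0 mulr_gt0// ltr0n.
have a0 : 0 < a by rewrite sqrtr_gt0; lra.
have am : a <= m.
  rewrite ler_wsqrtr// (le_trans Ap)// ler_peMl// ler1n//.
pose mu := a / m / 4.
have mu0 : 0 <= mu by rewrite !mulr_ge0// ltW// ?invr_gt0.
have mu4 : mu <= 4^-1 by rewrite /mu ler_piMl// ler_pdivrMr// mul1r.
have := @chi2_upper_tail R p v finset.setT mu (C * Num.sqrt (v%:R * p%:R * A)) mu0 mu4.
rewrite finset.cardsT card_ord natrM (mulrC p%:R).
move=> H; apply: (le_trans H); rewrite lee_fin ler_expR.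
rewrite le_eqVlt; apply/predU1P; left.
rewrite sqrtrM ?mulr_ge0// -/m -/a mE aE /mu; field; exact: lt0r_neq0.
Qed.

Lemma dense_power_tail p v (b : 'I_p -> 'I_v -> R) (A C : R) :
  (0 < p)%N -> (0 < v)%N -> 1 <= A -> 0 <= C ->
  2 * C * Num.sqrt (v%:R * p%:R * A) <= \sum_(j < p) \sum_(k < v) b j k ^+ 2 ->
  (law p v [set t | shifted_sqnorm finset.setT b t <=
      v%:R * p%:R + C * Num.sqrt (v%:R * p%:R * A)]%R <=
   (expR (1 - C / 256))%:E)%E.
Proof.
move=> p0 v0 A1 C0; set Delta := \sum_(j < p) _ => DE.
pose m : R := Num.sqrt (v%:R * p%:R).
have A0 : 0 <= A by lra.
have mE : v%:R * p%:R = m ^+ 2 by rewrite sqr_sqrtr// mulr_ge0.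
have m1 : 1 <= m.
  by rewrite -sqrtr1 ler_wsqrtr// -natrM ler1n muln_gt0 v0.
have mA : m <= Num.sqrt (v%:R * p%:R * A).
  by rewrite ler_wsqrtr// ler_peMr// mulr_ge0.
set q := Num.sqrt (v%:R * p%:R * A) in DE mA *.
pose lam := (8 * m)^-1.
have lam0 : 0 < lam by rewrite invr_gt0; lra.
have lm : lam * m = 8^-1 by rewrite /lam; field; rewrite gt_eqF; lra.
have DE' : Delta = \sum_(j in finset.setT) \sum_(k < v) b j k ^+ 2.
  by apply: eq_bigl => j; rewrite finset.in_setT.
apply: (@le_trans _ _ (law p v [set t | shifted_sqnorm finset.setT b t <= (#|(finset.setT : {set 'I_p})| * v)%:R + Delta / 2]%R)).
  apply: le_measure; rewrite ?inE.
  - by apply: measurable_le_cst; exact: measurable_shifted_sqnorm_set.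
  - by apply: measurable_le_cst; exact: measurable_shifted_sqnorm_set.
  move=> t /= H; apply: (le_trans H); rewrite finset.cardsT card_ord natrM mulrC lerD2l; lra.
apply: le_trans (chi2_lower_tail (lam := lam) _ _ DE') _.
- exact: ltW.
- by rewrite /lam lef_pV2 ?posrE//; lra.
rewrite lee_fin ler_expR finset.cardsT card_ord natrM (mulrC p%:R) mE.
have h2 : 4 * lam ^+ 2 * m ^+ 2 = 4 * (8^-1) ^+ 2 by rewrite -lm; ring.
have h4 : lam * m <= lam * q by rewrite ler_pM2l.
have h5 : lam * (2 * C * q) <= lam * Delta by rewrite ler_pM2l.
have h7 : C * 8^-1 <= C * (lam * q) by rewrite ler_wpM2l//; lra.
nra.
Qed.

End calibration.

(** * The adaptation quantities *)

Section adaptation_facts.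
Context {R : realType}.
Variables (mu : nat -> R) (p n : nat).
Hypothesis p0 : (0 < p)%N.
Hypothesis n0 : (0 < n)%N.
Hypothesis mu_noninc : forall k, (1 <= k)%N -> 0 <= mu k.+1 <= mu k.
Hypothesis mu1 : mu 1%N = 1.

Lemma mu_ge0 k : (1 <= k)%N -> 0 <= mu k.
Proof. by move=> /mu_noninc /andP[]; exact: le_trans. Qed.

Lemma mu_antitone j k : (1 <= j)%N -> (j <= k)%N -> mu k <= mu j.
Proof.
move=> j1; elim: k => [|k IH]; first by rewrite leqn0 => /eqP j00; rewrite j00 in j1.
rewrite leq_eqVlt => /orP[/eqP -> //|]; rewrite ltnS => jk.
apply: le_trans (IH jk).
by have /andP[] := mu_noninc (leq_trans j1 jk).
Qed.

Let log_arg_gt0 s (a : R) : 0 <= a -> 0 < 1 + p%:R * a / s%:R ^+ 2.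
Proof.
move=> a0; rewrite ltr_pwDl// divr_ge0 ?mulr_ge0//.
Qed.

Lemma log_term_gt0 s (a : R) : (0 < s)%N -> 0 < a -> 0 < log_term p s a.
Proof.
move=> s0 a0; by rewrite ln_gt0// ltrDl divr_gt0 ?mulr_gt0 ?exprn_gt0 ?ltr0n.
Qed.

Lemma log_term_le s (a b : R) : 0 <= a -> a <= b -> log_term p s a <= log_term p s b.
Proof.
move=> a0 ab; rewrite ler_ln ?posrE ?log_arg_gt0//; last exact: le_trans ab.
by rewrite lerD2l ler_wpM2r ?invr_ge0 ?sqr_ge0// ler_wpM2l.
Qed.

(** So [nuH] is nonincreasing in [a]. *)
Lemma nu_cond_le s (a b : R) v : 0 <= a -> a <= b ->
  nu_cond mu p n s a v -> nu_cond mu p n s b v.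
Proof.
move=> a0 ab [v0 H]; split => //; apply: (le_trans H).
rewrite ler_wpM2r ?invr_ge0// ler_wsqrtr// ler_wpM2l//; exact: log_term_le.
Qed.

Lemma nuHP s (a : R) : (0 < s)%N -> 0 < a ->
  nu_cond mu p n s a (nuH mu p n s a) /\
  forall w, nu_cond mu p n s a w -> (nuH mu p n s a <= w)%N.
Proof.
move=> s0 a0; have L0 := log_term_gt0 s0 a0.
have ex : exists v, `[< nu_cond mu p n s a v >].
  exists (Num.truncn (n%:R ^+ 2 / log_term p s a)).+1; apply/asboolP; split => //.
  apply: (@le_trans _ _ 1); first by rewrite -mu1; exact: mu_antitone.
  have n00 : 0 < n%:R :> R by rewrite ltr0n.
  rewrite ler_pdivlMr// mul1r -[leLHS]gtr0_norm// -sqrtr_sqr ler_wsqrtr//.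
  rewrite -ler_pdivrMr//; apply: ltW; exact: truncnS_gt.
case: (ex_minnP ex) => m /asboolP mc mm.
suff : [set v | nu_cond mu p n s a v /\ forall w, nu_cond mu p n s a w -> (v <= w)%N] (nuH mu p n s a).
  by [].
by rewrite /nuH; case: xgetP => [x -> []//|/(_ m)]; case; split => // w wc; apply: mm; exact/asboolP.
Qed.

Lemma nuH_gt0 s (a : R) : (0 < s)%N -> 0 < a -> (0 < nuH mu p n s a)%N.
Proof. by move=> s0 a0; have [[]] := nuHP s0 a0. Qed.

Definition dyadic_ceil m := (2 ^ up_log 2 m)%N.

Lemma dyadic_ceil_bounds m : (0 < m)%N -> (m <= dyadic_ceil m < 2 * m)%N.
Proof.
rewrite /dyadic_ceil; case: m => [//|[_|m _]]; first by rewrite up_log1.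
have /= /andP[] := @up_log_bounds 2 m.+2 isT isT.
have : (0 < up_log 2 m.+2)%N by rewrite up_log_gt0.
case: (up_log 2 m.+2) => // k _ h1 h2; rewrite h2/= expnS ltn_mul2l//.
Qed.

Lemma dyadic_ceil_eq k m : (m <= 2 ^ k)%N -> (2 ^ k < 2 * m)%N -> (2 ^ k)%N = dyadic_ceil m.
Proof.
case: k => [|k]; last first.
  by rewrite expnS ltn_mul2l/= => h1 h2; rewrite /dyadic_ceil (@up_log_eq 2 k) ?expnS// h2 h1.
by case: m => // -[_ _|//]; rewrite /dyadic_ceil up_log1.
Qed.

Lemma VsetE (a : R) : 0 < a ->
  Vset mu p n a = [set v | v \in [seq dyadic_ceil (nuH mu p n s a) | s <- iota 1 p]].
Proof.
move=> a0; apply/seteqP; split => v /=.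
  move=> [k -> [s [/andP[s1 sp] h1 h2]]]; apply/mapP; exists s; last exact: dyadic_ceil_eq.
  by rewrite mem_iota s1 add1n ltnS.
move=> /mapP[s]; rewrite mem_iota add1n ltnS => /andP[s1 sp] ->.
have /andP[h1 h2] := dyadic_ceil_bounds (nuH_gt0 s1 a0).
by exists (up_log 2 (nuH mu p n s a)) => //; exists s; split => //; apply/andP; split.
Qed.

Lemma finite_Vset (a : R) : 0 < a -> finite_set (Vset mu p n a).
Proof. by move=> a0; rewrite VsetE//; exact: finite_seq. Qed.

Lemma mem_Vset (a : R) v : 0 < a -> v \in fset_set (Vset mu p n a) -> Vset mu p n a v.
Proof. by move=> a0; rewrite in_fset_set ?inE//; exact: finite_Vset. Qed.

Lemma card_Vset_le (a : R) : 0 < a -> (#|` fset_set (Vset mu p n a)| <= p)%N.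
Proof.
move=> a0; rewrite -[leqRHS](size_iota 1) -(size_map (fun s => dyadic_ceil (nuH mu p n s a))).
apply: uniq_leq_size; first exact: fset_uniq.
by move=> v /(mem_Vset a0); rewrite VsetE.
Qed.

Lemma card_Vset_gt0 (a : R) : 0 < a -> (0 < #|` fset_set (Vset mu p n a)|)%N.
Proof.
move=> a0; rewrite cardfs_gt0; apply/fset0Pn; exists (dyadic_ceil (nuH mu p n 1 a)).
rewrite in_fset_set; last exact: finite_Vset.
rewrite inE VsetE//=; apply/mapP; exists 1%N => //.
by rewrite mem_iota add1n ltnS.
Qed.

Local Notation A := (AH mu p n).
Let lnV (a : R) : R := ln (expR 1 * #|` fset_set (Vset mu p n a) |%:R).
Let lnVE (a : R) : 0 < a -> lnV a = 1 + ln #|` fset_set (Vset mu p n a) |%:R.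
Proof.
by move=> a0; rewrite /lnV lnM ?posrE ?expR_gt0 ?ltr0n ?card_Vset_gt0// expRK.
Qed.

Let lnV_le (a : R) : 0 < a -> lnV a <= 1 + ln p%:R.
Proof.
move=> a0; rewrite lnVE// lerD2l ler_ln ?posrE ?ltr0n ?card_Vset_gt0// ler_nat.
exact: card_Vset_le.
Qed.

Let X := [set a : R | 1 <= a /\ a <= lnV a].
Let AE : A = sup X. Proof. by []. Qed.

Let X1 : X 1.
Proof.
split; first exact: lexx.
by rewrite lnVE// lerDl ln_ge0// ler1n card_Vset_gt0.
Qed.

Let Xub : has_ubound X.
Proof.
by exists (1 + ln p%:R) => a [a1 aX]; apply: le_trans aX _; apply: lnV_le; lra.
Qed.

Lemma AH_ge1 : 1 <= A. Proof. exact: ub_le_sup X1. Qed.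

Lemma AH_gt0 : 0 < A. Proof. by have := AH_ge1; lra. Qed.

(** There are at most [p] resolutions, one for each sparsity. *)
Lemma AH_le : A <= 1 + ln p%:R.
Proof.
apply: ge_sup; first by exists 1.
by move=> a [a1 aX]; apply: le_trans aX _; apply: lnV_le; lra.
Qed.

Lemma AH_le_p : A <= p%:R.
Proof.
apply: le_trans AH_le _.
have p00 : 0 < p%:R :> R by rewrite ltr0n.
by have := expR_ge1Dx (ln p%:R : R); rewrite lnK.
Qed.

Let log_term_cvg s : log_term p s a @[a --> A] --> log_term p s A.
Proof.
have a0 := AH_gt0.
apply: (@continuous_comp _ _ _ (fun a : R => 1 + p%:R * a / s%:R ^+ 2) (@ln R)); last first.
  by apply: continuous_ln; apply: log_arg_gt0; exact: ltW.
apply: cvgD; first exact: cvg_cst.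
by apply: cvgMl; apply: cvgMr; exact: cvg_id.
Qed.

(** The finitely many strict inequalities that exclude the integers below [nuH]
    at [A] persist for slightly larger [a]. *)
Let nuH_right : \forall a \near A^'+, forall s : 'I_p.+1, (0 < s)%N ->
  nuH mu p n s a = nuH mu p n s A.
Proof.
have A0 := AH_gt0.
apply: filter_forall => s; have [->|s0] := posnP s; first by near=> a.
have [nA nmin] := nuHP s0 A0.
have : \forall a \near A^'+, forall w : 'I_(nuH mu p n s A), ~ nu_cond mu p n s a w.
  apply: filter_forall => w; have [w0|w0] := posnP w.
    by near=> a => -[]; rewrite w0.
  have Hw : Num.sqrt (w%:R * log_term p s A) / n%:R < mu w.
    rewrite ltNge; apply/negP => Hw.
    by have := nmin w (conj w0 Hw); rewrite leqNgt ltn_ord.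
  have Hc : Num.sqrt (w%:R * log_term p s a) / n%:R @[a --> A^'+] -->
      Num.sqrt (w%:R * log_term p s A) / n%:R.
    apply: cvgMl; apply: (@cvg_comp _ _ _ (fun a => w%:R * log_term p s a) (@Num.sqrt R)); last first.
      exact: sqrt_continuous.
    by apply: cvgMr; apply: cvg_within_filter; exact: log_term_cvg.
  have Hlt : \forall a \near A^'+, Num.sqrt (w%:R * log_term p s a) / n%:R < mu w.
    exact: cvgr_lt Hc _ Hw.
  near=> a => -[_]; rewrite leNgt => /negP; apply; near: a; exact: Hlt.
move=> H.
near=> a => _.
have Aa : A < a by near: a; exact: nbhs_right_gt.
have a0 : 0 < a by exact: lt_trans Aa.
have [na amin] := nuHP s0 a0.
apply/eqP; rewrite eqn_leq amin/=; last exact: nu_cond_le (ltW A0) (ltW Aa) nA.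
rewrite leqNgt; apply/negP => lt.
have Ha : forall w : 'I_(nuH mu p n s A), ~ nu_cond mu p n s a w by near: a.
exact: (Ha (Ordinal lt)).
Unshelve. all: by end_near. Qed.

(** The supremum defining [AH] does not have to be attained, but the set of
    resolutions is right-continuous in [a]. *)
Lemma card_VH : #|` fset_set (VH mu p n)|%:R <= expR (A - 1).
Proof.
have A0 := AH_gt0; have c0 := card_Vset_gt0 A0.
rewrite -[leLHS]lnK ?posrE ?ltr0n// ler_expR lerBrDl -lnVE//.
rewrite leNgt; apply/negP => lt.
have : \forall a \near A^'+, a < lnV A by exact: nbhs_right_lt.
move=> Hlt.
suff : \forall a \near A^'+, False by move/filter_ex => -[].
near=> a.
have Aa : A < a by near: a; exact: nbhs_right_gt.
have aV : a < lnV A by near: a.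
have nuE : forall s : 'I_p.+1, (0 < s)%N -> nuH mu p n s a = nuH mu p n s A by near: a.
have VE : Vset mu p n a = Vset mu p n A.
  rewrite (VsetE (lt_trans A0 Aa)) (VsetE A0).
  have -> // : [seq dyadic_ceil (nuH mu p n s a) | s <- iota 1 p] =
      [seq dyadic_ceil (nuH mu p n s A) | s <- iota 1 p].
  apply/eq_in_map => s; rewrite mem_iota add1n => /andP[s0 sp].
  by have /= -> := nuE (Ordinal sp) s0.
have : X a.
  split; first by have := AH_ge1; lra.
  by rewrite /lnV VE; exact: ltW.
by move/(ub_le_sup Xub); rewrite -AE leNgt Aa.
Unshelve. all: by end_near. Qed.

Lemma VH_dyadic s : (1 <= s <= p)%N -> let nu := nuH mu p n s A in
  exists2 v, v \in fset_set (VH mu p n) & (nu <= v < 2 * nu)%N.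
Proof.
move=> /andP[s1 sp] nu; have A0 := AH_gt0.
have nu0 : (0 < nu)%N by exact: nuH_gt0.
exists (dyadic_ceil nu); last exact: dyadic_ceil_bounds.
rewrite in_fset_set; last exact: finite_Vset.
rewrite inE /VH VsetE//=; apply/mapP; exists s => //.
by rewrite mem_iota s1 add1n ltnS.
Qed.

Lemma VH_gt0 v : v \in fset_set (VH mu p n) -> (0 < v)%N.
Proof. by move=> /(mem_Vset AH_gt0)[k -> _]; rewrite expn_gt0. Qed.

Let pA1 : 1 <= Num.sqrt (p%:R * A).
Proof.
rewrite -[leLHS]sqrtr1 ler_wsqrtr//; have : 1 <= p%:R :> R by rewrite ler1n.
by have := AH_ge1; nra.
Qed.

Definition ngrid := `|Num.ceil (ln (Num.sqrt (p%:R * A)) / ln 2)|%N.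

Lemma ngridP k : (k < ngrid)%N = ((2 ^ k)%:R < Num.sqrt (p%:R * A)).
Proof.
have l2 : 0 < ln 2 :> R by rewrite ln_gt0// ltr1n.
have x0 : 0 <= ln (Num.sqrt (p%:R * A)) / ln 2.
  by apply: divr_ge0; [exact: ln_ge0|exact: ltW].
have c0 : 0 <= Num.ceil (ln (Num.sqrt (p%:R * A)) / ln 2).
  by rewrite ceil_ge0; apply: lt_le_trans x0; rewrite ltrN10.
rewrite -ltz_nat /ngrid gez0_abs// ceil_gt_int ltr_pdivlMr// natrX.
have -> : k%:~R * ln 2 = ln (2 ^+ k) :> R by rewrite mulrzl -pmulrn lnXn.
by rewrite ltr_ln ?posrE ?exprn_gt0//; apply: lt_le_trans pA1.
Qed.

Lemma SgridE : Sgrid mu p n = [seq (2 ^ k)%N | k <- iota 0 ngrid] ++ [:: p].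
Proof. by []. Qed.

Lemma mem_Sgrid_p : p \in Sgrid mu p n.
Proof. by rewrite SgridE mem_cat mem_seq1 eqxx orbT. Qed.

Lemma mem_Sgrid_pow k : (2 ^ k)%:R < Num.sqrt (p%:R * A) -> (2 ^ k)%N \in Sgrid mu p n.
Proof.
rewrite -ngridP => kn; rewrite SgridE mem_cat map_f//.
by rewrite mem_iota.
Qed.

Lemma sqrt_pAH_le : Num.sqrt (p%:R * A) <= p%:R.
Proof.
rewrite -[leRHS]ger0_norm// -sqrtr_sqr ler_wsqrtr// expr2 ler_wpM2l//; exact: AH_le_p.
Qed.

Lemma sparse_ratio s : (0 < s)%N -> s%:R < Num.sqrt (p%:R * A) -> 1 < p%:R * A / s%:R ^+ 2.
Proof.
move=> s0 sA; have A0 := AH_gt0; rewrite ltr_pdivlMr ?exprn_gt0 ?ltr0n// mul1r.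
rewrite -(@sqr_sqrtr _ (p%:R * A)) ?mulr_ge0//; last exact: ltW.
by rewrite ltrXn2r ?nnegrE ?sqrtr_ge0.
Qed.

Lemma ln2_ge : 2^-1 <= ln 2 :> R.
Proof.
have := @expR_ge1Dx R (- ln 2); rewrite expRN lnK ?posrE//; lra.
Qed.

Lemma sparse_log_ge s : (0 < s)%N -> s%:R < Num.sqrt (p%:R * A) -> ln 2 <= log_term p s A.
Proof.
move=> s0 /(sparse_ratio s0) u1; rewrite ler_ln ?posrE//; last first.
  by apply: log_arg_gt0; exact: ltW AH_gt0.
lra.
Qed.

Lemma dense_log_ge s : (0 < s)%N -> Num.sqrt (p%:R * A) <= s%:R ->
  p%:R * A / (2 * s%:R ^+ 2) <= log_term p s A.
Proof.
move=> s0 As; have A0 := AH_gt0.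
have s2 : 0 < s%:R ^+ 2 :> R by rewrite exprn_gt0// ltr0n.
set u := p%:R * A / s%:R ^+ 2.
have u0 : 0 <= u by rewrite divr_ge0 ?mulr_ge0 ?ltW// ltr0n.
have u1 : u <= 1.
  rewrite ler_pdivrMr// mul1r -(@sqr_sqrtr _ (p%:R * A)) ?mulr_ge0//; last exact: ltW.
  by rewrite lerXn2r ?nnegrE ?sqrtr_ge0.
have -> : p%:R * A / (2 * s%:R ^+ 2) = u / 2 by rewrite /u; field; rewrite gt_eqF// ltr0n.
rewrite -ler_expR /log_term -/u lnK ?posrE//; last lra.
have e1 := expR_ge1Dx (- (u / 2)); have e0 := expR_gt0 (u / 2).
rewrite expRN in e1; have : (1 - u / 2) * expR (u / 2) <= 1.
  by rewrite -ler_pdivlMr// mul1r.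
nra.
Qed.

(** If [p <= s^4] then [A <= 1 + log p] is at most of order [s]; otherwise
    [p / s^2 >= sqrt p], so [L] is at least [log p / 2]. *)
Lemma AH_le_sparse s : (0 < s)%N -> s%:R < Num.sqrt (p%:R * A) ->
  A <= 8 * (s%:R * log_term p s A).
Proof.
move=> s0 sA; have L2 := sparse_log_ge s0 sA; have l2 := ln2_ge.
have A0 := AH_gt0; have A1 := AH_ge1; have Ap := AH_le.
have s1 : 1 <= s%:R :> R by rewrite ler1n.
have s00 : 0 < s%:R :> R by lra.
have p00 : 0 < p%:R :> R by rewrite ltr0n.
have lnp0 : 0 <= ln p%:R :> R by rewrite ln_ge0// ler1n.
set L := log_term p s A in L2 *.
have [ps|ps] := lerP (p%:R : R) (s%:R ^+ 4).
  have : ln p%:R <= 4 * (s%:R - 1) :> R.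
    apply: (@le_trans _ _ (ln (s%:R ^+ 4))); first by rewrite ler_ln ?posrE ?exprn_gt0.
    have : ln s%:R <= s%:R - 1 :> R by have := @expR_ge1Dx R (ln s%:R); rewrite lnK ?posrE//; lra.
    rewrite lnXn// -mulr_natl; lra.
  have : s%:R * 2^-1 <= s%:R * L by rewrite ler_wpM2l; lra.
  lra.
have : ln p%:R <= 2 * L.
  rewrite mulr_natl -lnXn//; last first.
    by apply: log_arg_gt0; exact: ltW.
  rewrite ler_ln ?posrE ?exprn_gt0//; last by apply: log_arg_gt0; exact: ltW.
  have u1 : p%:R / s%:R ^+ 2 <= 1 + p%:R * A / s%:R ^+ 2.
    have : p%:R / s%:R ^+ 2 <= p%:R * A / s%:R ^+ 2.
      by rewrite ler_wpM2r ?invr_ge0 ?sqr_ge0// ler_peMr// ltW.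
    lra.
  apply: (@le_trans _ _ ((p%:R / s%:R ^+ 2) ^+ 2)).
    rewrite exprMn exprVn -exprM ler_pdivlMr ?exprn_gt0// expr2 ler_pM2l// ltW//.
  rewrite lerXn2r// ?nnegrE; first by rewrite divr_ge0 ?sqr_ge0// ltW.
  by apply/ltW/log_arg_gt0/ltW.
have : L <= s%:R * L by rewrite ler_peMl//; lra.
lra.
Qed.

(** [1 + 4 u <= (1 + u)^4]. *)
Lemma log_term_double s t : (0 < s)%N -> (t < 2 * s)%N -> (s <= t)%N ->
  log_term p s A <= 4 * log_term p t A.
Proof.
move=> s0 ts st; have A0 := AH_gt0; have t0 : (0 < t)%N by exact: leq_trans st.
have s00 : 0 < s%:R :> R by rewrite ltr0n.
have t00 : 0 < t%:R :> R by rewrite ltr0n.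
have at0 : 0 < 1 + p%:R * A / t%:R ^+ 2 by apply/log_arg_gt0/ltW.
have as0 : 0 < 1 + p%:R * A / s%:R ^+ 2 by apply/log_arg_gt0/ltW.
rewrite mulr_natl -lnXn// ler_ln ?posrE ?exprn_gt0//.
set u := p%:R * A / t%:R ^+ 2.
have u0 : 0 <= u by rewrite divr_ge0 ?mulr_ge0//; exact: ltW.
have : p%:R * A / s%:R ^+ 2 <= 4 * u.
  rewrite /u mulrCA; apply: ler_wpM2l; first by apply: mulr_ge0 => //; exact: ltW.
  rewrite -[4]invrK -invfM lef_pV2 ?posrE ?mulr_gt0 ?exprn_gt0//.
  have : t%:R <= 2 * s%:R :> R by rewrite -natrM ler_nat ltnW.
  nra.
have : 1 + 4 * u <= (1 + u) ^+ 4.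
  have -> : (1 + u) ^+ 4 = 1 + 4 * u + (6 * u ^+ 2 + 4 * u ^+ 3 + u ^+ 4) by ring.
  have := exprn_ge0 2 u0; have := exprn_ge0 3 u0; have := exprn_ge0 4 u0; lra.
lra.
Qed.

End adaptation_facts.

(** * Square integrable functions *)

Section L2_theory.
Context {d : measure_display} {T : measurableType d} {R : realType}.
Variables (m : {measure set T -> \bar R}) (D : set T).
Hypothesis mD : measurable D.
Local Notation L2D := (L2 m D).
Local Notation dot := (L2dot m D).

Lemma L2_integrableM (f g : T -> R) : L2D f -> L2D g -> m.-integrable D (EFin \o (fun x => f x * g x)).
Proof.
move=> [mf f2] [mg g2].
apply: (le_integrable mD _ _ (integrableD mD f2 g2)).
  by apply/measurable_EFinP; exact: measurable_funM.
move=> x Dx; rewrite /= lee_fin (@ger0_norm _ (_ ^+ 2 + _ ^+ 2)) ?addr_ge0 ?sqr_ge0// ler_norml.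
by have := sqr_ge0 (f x + g x); have := sqr_ge0 (f x - g x);
  have := sqr_ge0 (f x); have := sqr_ge0 (g x); nra.
Qed.

Lemma L2_scale a (f : T -> R) : L2D f -> L2D (fun x => a * f x).
Proof.
move=> [mf f2]; split; first exact: measurable_funM.
have -> : EFin \o (fun x => (a * f x) ^+ 2) = (fun x => (a ^+ 2)%:E * (EFin \o (fun x => f x ^+ 2)%R) x)%E.
  by apply/funext => x /=; rewrite -EFinM exprMn.
exact: integrableZl.
Qed.

Lemma L2_add (f g : T -> R) : L2D f -> L2D g -> L2D (fun x => f x + g x).
Proof.
move=> Lf Lg; have [mf f2] := Lf; have [mg g2] := Lg; split; first exact: measurable_funD.
have -> : EFin \o (fun x => (f x + g x) ^+ 2) = ((EFin \o (fun x => f x ^+ 2)%R) \+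
    (EFin \o (fun x => g x ^+ 2)%R) \+ (fun x => 2%:E * (EFin \o (fun x => f x * g x)%R) x))%E.
  by apply/funext => x /=; rewrite -EFinM -!EFinD; congr EFin; ring.
apply: integrableD => //; first exact: integrableD.
by apply: integrableZl => //; exact: L2_integrableM.
Qed.

Lemma L2_cst0 : L2D (fun=> 0).
Proof.
split; first exact: measurable_cst.
rewrite (_ : _ \o _ = cst 0%E); first exact: integrable0.
by apply/funext => x /=; rewrite expr0n.
Qed.

Lemma L2_sum {I : eqType} (r : seq I) (f : I -> T -> R) :
  (forall i, i \in r -> L2D (f i)) -> L2D (fun x => \sum_(i <- r) f i x).
Proof.
elim: r => [|i r IH] H.
  by rewrite (_ : (fun _ => _) = (fun=> 0)); [exact: L2_cst0|apply/funext => x; rewrite big_nil].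
rewrite (_ : (fun _ => _) = (fun x => f i x + \sum_(i <- r) f i x)).
  apply: L2_add; first by apply: H; rewrite mem_head.
  by apply: IH => j jr; apply: H; rewrite inE jr orbT.
by apply/funext => x; rewrite big_cons.
Qed.

Lemma L2_sub (f g : T -> R) : L2D f -> L2D g -> L2D (fun x => f x - g x).
Proof.
move=> Lf Lg; rewrite (_ : (fun _ => _) = (fun x => f x + -1 * g x)).
  by apply: L2_add => //; exact: L2_scale.
by apply/funext => x; rewrite mulN1r.
Qed.

Lemma L2_eq (f g : T -> R) : {in D, f =1 g} -> L2D f -> L2D g.
Proof.
move=> fg [mf f2]; split; first exact: eq_measurable_fun mf.
by apply: eq_integrable f2 => // x xD /=; rewrite fg.
Qed.

Lemma L2dotC f g : dot f g = dot g f.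
Proof. by apply: eq_Rintegral => x _; rewrite mulrC. Qed.

Lemma L2dot_eq (f f' g g' : T -> R) : {in D, f =1 f'} -> {in D, g =1 g'} -> dot f g = dot f' g'.
Proof. by move=> H1 H2; apply: eq_Rintegral => x xD; rewrite H1// H2. Qed.

Lemma L2dotZl a (f g : T -> R) : L2D f -> L2D g -> dot (fun x => a * f x) g = a * dot f g.
Proof.
move=> Lf Lg; rewrite /L2dot -RintegralZl//; last exact: L2_integrableM.
by apply: eq_Rintegral => x _; rewrite mulrA.
Qed.

Lemma L2dotDl (f g h : T -> R) : L2D f -> L2D g -> L2D h ->
  dot (fun x => f x + g x) h = dot f h + dot g h.
Proof.
move=> Lf Lg Lh; rewrite /L2dot -RintegralD//; try exact: L2_integrableM.
by apply: eq_Rintegral => x _; rewrite mulrDl.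
Qed.

Lemma L2dot0l g : dot (fun=> 0) g = 0.
Proof.
rewrite /L2dot (_ : \int[m]_(x in D) _ = \int[m]_(x in D) 0).
  by rewrite /Rintegral integral0.
by apply: eq_Rintegral => x _; rewrite mul0r.
Qed.

Lemma L2dot_suml {I : eqType} (r : seq I) (f : I -> T -> R) g :
  (forall i, i \in r -> L2D (f i)) -> L2D g ->
  dot (fun x => \sum_(i <- r) f i x) g = \sum_(i <- r) dot (f i) g.
Proof.
move=> + Lg; elim: r => [|i r IH] H.
  rewrite big_nil -[RHS](L2dot0l g); apply: L2dot_eq => // x _; by rewrite big_nil.
have Hr j : j \in r -> L2D (f j) by move=> jr; apply: H; rewrite inE jr orbT.
rewrite big_cons -IH// -L2dotDl//; last exact: L2_sum; last by apply: H; rewrite mem_head.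
by apply: L2dot_eq => // x _; rewrite big_cons.
Qed.

Lemma L2dot_sumr {I : eqType} (r : seq I) (f : I -> T -> R) g :
  (forall i, i \in r -> L2D (f i)) -> L2D g ->
  dot g (fun x => \sum_(i <- r) f i x) = \sum_(i <- r) dot g (f i).
Proof.
move=> Lf Lg; rewrite L2dotC L2dot_suml//; by apply: eq_bigr => i _; rewrite L2dotC.
Qed.

Lemma L2dot_ge0 f : 0 <= dot f f.
Proof. by apply: Rintegral_ge0 => x _; rewrite -expr2 sqr_ge0. Qed.

Lemma L2dotE f : L2D f -> (\int[m]_(x in D) (f x ^+ 2)%:E = (dot f f)%:E)%E.
Proof.
move=> [_ f2]; rewrite /L2dot /Rintegral fineK.
  by apply: eq_integral => x _; rewrite expr2.
rewrite [X in X \is a fin_num](_ : _ = \int[m]_(x in D) (f x ^+ 2)%:E)%E.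
  exact: integrable_fin_num.
by apply: eq_integral => x _; rewrite expr2.
Qed.

Lemma L2norm_sqr f : L2norm m D f ^+ 2 = dot f f.
Proof. by rewrite sqr_sqrtr// L2dot_ge0. Qed.

Section orthonormal.
Context {I : eqType}.
Variables (r : seq I) (e : I -> T -> R).
Hypothesis ur : uniq r.
Hypothesis Le : forall i, i \in r -> L2D (e i).
Hypothesis orth : forall i j, i \in r -> j \in r -> dot (e i) (e j) = (i == j)%:R.

Lemma L2_orthonormal_comb (c : I -> R) : L2D (fun x => \sum_(i <- r) c i * e i x).
Proof. by apply: L2_sum => i ir; exact: L2_scale (Le ir). Qed.

Lemma orthonormal_dot_comb (c : I -> R) i : i \in r ->
  dot (e i) (fun x => \sum_(j <- r) c j * e j x) = c i.
Proof.
move=> ir; rewrite L2dot_sumr; last 2 first.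
- by move=> j jr; exact: L2_scale (Le jr).
- exact: Le.
rewrite (bigD1_seq i)//= big1_seq ?addr0; last first.
  by move=> j /andP[ji jr]; rewrite L2dotC L2dotZl ?orth ?(negbTE ji) ?mulr0//; exact: Le.
by rewrite L2dotC L2dotZl ?orth ?eqxx ?mulr1//; exact: Le.
Qed.

Lemma orthonormal_comb_sqr (c : I -> R) :
  dot (fun x => \sum_(j <- r) c j * e j x) (fun x => \sum_(j <- r) c j * e j x) =
  \sum_(j <- r) c j ^+ 2.
Proof.
rewrite [LHS]L2dot_suml; last exact: L2_orthonormal_comb; last first.
  by move=> j jr; exact: L2_scale (Le jr).
rewrite big_seq [RHS]big_seq; apply: eq_bigr => j jr.
rewrite L2dotZl; last exact: L2_orthonormal_comb; last exact: Le.
by rewrite orthonormal_dot_comb// expr2.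
Qed.

(** The Fourier coefficients give the best approximation. *)
Lemma orthonormal_best_approx (u : T -> R) (c : I -> R) : L2D u ->
  dot u u - \sum_(i <- r) dot (e i) u ^+ 2 <=
  dot (fun x => u x - \sum_(i <- r) c i * e i x) (fun x => u x - \sum_(i <- r) c i * e i x).
Proof.
move=> Lu; set q := fun x => \sum_(i <- r) c i * e i x.
have Lq : L2D q by exact: L2_orthonormal_comb.
have LNq : L2D (fun x => -1 * q x) by exact: L2_scale.
have -> : dot (fun x => u x - q x) (fun x => u x - q x) = dot u u - 2 * dot q u + dot q q.
  rewrite (L2dot_eq (f' := fun x => u x + -1 * q x) (g' := fun x => u x + -1 * q x)); last 2 first.
  - by move=> x _; rewrite mulN1r.
  - by move=> x _; rewrite mulN1r.
  have Luq : L2D (fun x => u x + -1 * q x) by exact: L2_add.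
  rewrite L2dotDl// [dot u _]L2dotC L2dotDl// [dot (fun x => -1 * q x) (fun x => _ + _)]L2dotC.
  rewrite L2dotDl// !L2dotZl// [dot u (fun x => -1 * q x)]L2dotC [dot q (fun x => -1 * q x)]L2dotC !L2dotZl//.
  by ring.
rewrite -addrA lerD2l orthonormal_comb_sqr.
have -> : dot q u = \sum_(i <- r) c i * dot (e i) u.
  rewrite /q L2dot_suml//; last by move=> j jr; exact: L2_scale (Le jr).
  by rewrite big_seq [RHS]big_seq; apply: eq_bigr => j jr; rewrite L2dotZl//; exact: Le.
rewrite mulr_sumr -!sumrN -big_split/=; apply: ler_sum => i _.
by have := sqr_ge0 (c i - dot (e i) u); nra.
Qed.

End orthonormal.

(** From [(a + b)^2 <= 2 a^2 + 2 b^2]. *)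
Lemma L2dot_sub_le (u v w : T -> R) : L2D u -> L2D v -> L2D w ->
  dot (fun x => u x - w x) (fun x => u x - w x) <=
  2 * dot (fun x => v x - w x) (fun x => v x - w x) +
  2 * dot (fun x => v x - u x) (fun x => v x - u x).
Proof.
move=> Lu Lv Lw; rewrite -lee_fin EFinD !EFinM -!L2dotE; try exact: L2_sub.
have [mu' _] := Lu; have [mv' _] := Lv; have [mw' _] := Lw.
rewrite -!ge0_integralZl//; last 4 first.
- by apply/measurable_EFinP/measurable_funX; exact: measurable_funB.
- by move=> x _; rewrite lee_fin sqr_ge0.
- by apply/measurable_EFinP/measurable_funX; exact: measurable_funB.
- by move=> x _; rewrite lee_fin sqr_ge0.
rewrite -ge0_integralD//; last 4 first.
- by move=> x _; rewrite -EFinM lee_fin mulr_ge0 ?sqr_ge0.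
- by apply: emeasurable_funM => //; apply/measurable_EFinP/measurable_funX; exact: measurable_funB.
- by move=> x _; rewrite -EFinM lee_fin mulr_ge0 ?sqr_ge0.
- by apply: emeasurable_funM => //; apply/measurable_EFinP/measurable_funX; exact: measurable_funB.
apply: ge0_le_integral => //.
- by move=> x _; rewrite lee_fin sqr_ge0.
- by apply/measurable_EFinP/measurable_funX; exact: measurable_funB.
- by apply: emeasurable_funD; apply: emeasurable_funM => //; apply/measurable_EFinP/measurable_funX; exact: measurable_funB.
move=> x _; rewrite -!EFinM -EFinD lee_fin.
by have := sqr_ge0 (v x - w x + (v x - u x)); nra.
Qed.

(** Fatou's lemma for a convergent sequence whose integrals are eventually
    bounded. *)
Lemma fatou_bound (f : nat -> T -> R) (g : T -> R) (B : R) N0 :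
  (forall n, measurable_fun D (f n)) -> (forall n x, 0 <= f n x) ->
  (forall x, D x -> f ^~ x @ \oo --> g x) ->
  (forall n, (N0 <= n)%N -> (\int[m]_(x in D) (f n x)%:E <= B%:E)%E) ->
  (\int[m]_(x in D) (g x)%:E <= B%:E)%E.
Proof.
move=> mf f0 fg fB.
have -> : (\int[m]_(x in D) (g x)%:E = \int[m]_(x in D) limn_einf (fun n => (f n x)%:E))%E.
  apply: eq_integral => x /set_mem Dx.
  have := cvg_limn_einf_sup (u := fun n => (f n x)%:E) (l := (g x)%:E).
  case=> [|-> _//].
  by apply: cvg_EFin; [exact: nearW|exact: fg].
apply: (le_trans (fatou _ _ _ _)) => //.
- by move=> n; apply/measurable_EFinP.
- by move=> n x _; rewrite lee_fin.
rewrite limn_einf_lim; apply: lime_le; first exact: is_cvg_einfs.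
exists N0 => // n /= Nn; apply: le_trans (fB n Nn); apply: ereal_inf_lbound.
by exists n => //=.
Qed.

End L2_theory.

(** * Approximation in the reproducing kernel Hilbert space *)

Section hilbert_fun_theory.
Context {R : realType} (H : @hilbert_fun R).
Implicit Types f g h : H.

Lemma hdotC g h : hdot g h = hdot h g.
Proof. by case: H g h. Qed.

Lemma hdot_linear a f g h : hdot (a *: f + g) h = a * hdot f h + hdot g h.
Proof. by case: H f g h. Qed.

Lemma hdot_norm g : hdot g g = `|g| ^+ 2.
Proof. by case: H g. Qed.

Lemma ev_linear a g h x : unit_itv x -> ev (a *: g + h) x = a * ev g x + ev h x.
Proof. by case: H g h => V dot e ? ? ? evl ? ? g h; exact: evl. Qed.

Lemma ev_L2 g : L2 lebesgue01 unit_itv (ev g).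
Proof. by case: H g. Qed.

Lemma hdot0l h : hdot 0 h = 0.
Proof. by have := hdot_linear (-1) 0 0 h; rewrite scaler0 addr0; lra. Qed.

Lemma hdotDl f g h : hdot (f + g) h = hdot f h + hdot g h.
Proof. by rewrite -[f]scale1r hdot_linear mul1r scale1r. Qed.

Lemma hdotZl a g h : hdot (a *: g) h = a * hdot g h.
Proof. by rewrite -[a *: g]addr0 hdot_linear hdot0l addr0. Qed.

Lemma ev0 x : unit_itv x -> ev (0 : H) x = 0.
Proof. by move=> ux; have := ev_linear (-1) 0 0 ux; rewrite scaler0 addr0; lra. Qed.

Lemma evD g h x : unit_itv x -> ev (g + h) x = ev g x + ev h x.
Proof. by move=> ux; rewrite -[g]scale1r ev_linear// mul1r scale1r. Qed.

Lemma evZ a g x : unit_itv x -> ev (a *: g) x = a * ev g x.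
Proof. by move=> ux; rewrite -[a *: g]addr0 ev_linear// ev0// addr0. Qed.

Lemma norm_addZ_sqr a f g : `|f + a *: g| ^+ 2 =
  `|f| ^+ 2 + 2 * a * hdot f g + a ^+ 2 * `|g| ^+ 2.
Proof.
rewrite -!hdot_norm hdotDl [hdot f _]hdotC hdotDl !hdotZl [hdot g (_ + _)]hdotC hdotDl hdotZl.
by rewrite (hdotC g f); ring.
Qed.

Lemma parallelogram f g : `|f - g| ^+ 2 + `|f + g| ^+ 2 = 2 * `|f| ^+ 2 + 2 * `|g| ^+ 2.
Proof.
have := norm_addZ_sqr 1 f g; have := norm_addZ_sqr (-1) f g.
by rewrite scale1r scaleN1r => -> ->; ring.
Qed.

End hilbert_fun_theory.

Section kernel_tail.
Context {R : realType} (H : @hilbert_fun R).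
Variables (mu : nat -> R) (psi : nat -> R -> R) (k0 : R -> H).
Hypothesis rep : reproducing (@H0 R H) k0.
Hypothesis mer : mercer_expansion (fun x y => ev (k0 x) y) mu psi.
Local Notation leb := (@lebesgue01 R).
Local Notation I01 := (@unit_itv R).
Local Notation dot := (L2dot leb I01).

Let mI : measurable I01. Proof. exact: measurable_itv. Qed.

Let psiL2 k : (1 <= k)%N -> L2 leb I01 (psi k). Proof. by have [] := mer; move=> h _ _ _; exact: h. Qed.
Let psi_orth k l : (1 <= k)%N -> (1 <= l)%N -> dot (psi k) (psi l) = (k == l)%:R.
Proof. by have [_ h _ _] := mer; exact: h. Qed.
Let mu_mon k : (1 <= k)%N -> 0 <= mu k.+1 <= mu k.
Proof. by have [_ _ h _] := mer; exact: h. Qed.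

Let mu0 k : (1 <= k)%N -> 0 <= mu k. Proof. exact: mu_ge0. Qed.
Let mu_le j k : (1 <= j)%N -> (j <= k)%N -> mu k <= mu j. Proof. exact: mu_antitone. Qed.

(** For combinations of kernel sections, the expansion of the kernel makes the
    eigenfunction coefficients explicit: that of index [k] is [mu k * kcoef s k]. *)
Definition kcomb (s : seq (R * R)) : H := \sum_(z <- s) z.1 *: k0 z.2.
Definition kcoef (s : seq (R * R)) (k : nat) : R := \sum_(z <- s) z.1 * psi k z.2.
Definition valid (s : seq (R * R)) : Prop := forall z, z \in s -> I01 z.2.

Let validS z s : valid (z :: s) -> I01 z.2 /\ valid s.
Proof.
move=> v; split; first by apply: v; rewrite mem_head.
by move=> y ys; apply: v; rewrite inE ys orbT.
Qed.

Let kcomb_cons z s : kcomb (z :: s) = z.1 *: k0 z.2 + kcomb s.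
Proof. by rewrite /kcomb big_cons. Qed.

Let kcoef_cons z s k : kcoef (z :: s) k = z.1 * psi k z.2 + kcoef s k.
Proof. by rewrite /kcoef big_cons. Qed.

Let kcomb_cat s t : kcomb (s ++ t) = kcomb s + kcomb t.
Proof. by rewrite /kcomb big_cat. Qed.

Definition kscale (a : R) (s : seq (R * R)) := [seq (a * z.1, z.2) | z <- s].

Let kcomb_scale a s : kcomb (kscale a s) = a *: kcomb s.
Proof. by rewrite /kcomb big_map scaler_sumr; apply: eq_bigr => z _; rewrite scalerA. Qed.

Let valid_scale a s : valid s -> valid (kscale a s).
Proof. by move=> v z /mapP[y ys ->]; exact: v ys. Qed.

Let valid_cat s t : valid s -> valid t -> valid (s ++ t).
Proof. by move=> vs vt z; rewrite mem_cat => /orP[]; [exact: vs|exact: vt]. Qed.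

Lemma hdot_kcomb s x : valid s -> I01 x -> hdot (kcomb s) (k0 x) = ev (kcomb s) x.
Proof.
move=> + ux; elim: s => [|z s IH] v; first by rewrite /kcomb big_nil hdot0l ev0.
have [uz vs] := validS v; rewrite kcomb_cons hdot_linear ev_linear// IH//.
by congr (_ * _ + _); have [Hz _] := rep uz; have [_ ->] := rep ux.
Qed.

Lemma kcomb_mercer s y : valid s -> I01 y ->
  (fun N : nat => \sum_(1 <= k < N.+1) mu k * kcoef s k * psi k y) @ \oo --> ev (kcomb s) y.
Proof.
move=> + uy; elim: s => [|z s IH] v.
  rewrite /kcomb big_nil ev0//; under eq_fun => N.
    under eq_bigr do rewrite /kcoef big_nil mulr0 mul0r.
    rewrite big1//. over.
  exact: cvg_cst.
have [uz vs] := validS v; rewrite kcomb_cons ev_linear//.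
have [_ _ _ M] := mer.
rewrite (_ : (fun _ => _) = (fun N => z.1 * (\sum_(1 <= k < N.+1) mu k * psi k z.2 * psi k y) +
    \sum_(1 <= k < N.+1) mu k * kcoef s k * psi k y)).
  by apply: cvgD; [apply: cvgM; [exact: cvg_cst|exact: M]|exact: IH].
apply/funext => N; rewrite mulr_sumr -big_split/=; apply: eq_bigr => k _.
by rewrite kcoef_cons; ring.
Qed.

Lemma kcomb_norm s : valid s ->
  (fun N : nat => \sum_(1 <= k < N.+1) mu k * kcoef s k ^+ 2) @ \oo --> `|kcomb s| ^+ 2.
Proof.
move=> v; rewrite -hdot_norm.
suff : forall t, valid t ->
  (fun N : nat => \sum_(1 <= k < N.+1) mu k * kcoef s k * kcoef t k) @ \oo --> hdot (kcomb s) (kcomb t).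
  move=> /(_ s v); apply: cvg_trans; apply: near_eq_cvg; apply: nearW => N /=.
  by apply: eq_bigr => k _; rewrite expr2 mulrA.
elim => [|z t IH] vt.
  rewrite hdotC /kcomb big_nil hdot0l; under eq_fun => N.
    under eq_bigr do rewrite /kcoef big_nil mulr0.
    rewrite big1//. over.
  exact: cvg_cst.
have [uz vt'] := validS vt; rewrite kcomb_cons hdotC hdot_linear -(hdotC (kcomb s)) hdot_kcomb//.
rewrite -(hdotC (kcomb s)).
rewrite (_ : (fun _ => _) = (fun N => z.1 * (\sum_(1 <= k < N.+1) mu k * kcoef s k * psi k z.2) +
    \sum_(1 <= k < N.+1) mu k * kcoef s k * kcoef t k)).
  by apply: cvgD; [apply: cvgM; [exact: cvg_cst|exact: kcomb_mercer]|exact: IH].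
apply/funext => N; rewrite mulr_sumr -big_split/=; apply: eq_bigr => k _.
by rewrite kcoef_cons; ring.
Qed.

Let partial_le s N : valid s ->
  \sum_(1 <= k < N.+1) mu k * kcoef s k ^+ 2 <= `|kcomb s| ^+ 2.
Proof.
move=> v; have C := kcomb_norm v; have <- := cvg_lim (@Rhausdorff R) C.
apply: (@nondecreasing_cvgn_le R (fun N : nat => \sum_(1 <= k < N.+1) mu k * kcoef s k ^+ 2)); last first.
  by apply/cvg_ex; exists (`|kcomb s| ^+ 2).
apply/nondecreasing_seqP => M; rewrite [leRHS]big_nat_recr//= lerDl mulr_ge0 ?sqr_ge0//.
exact: mu0.
Qed.

Definition kpart s d x : R := \sum_(1 <= k < d.+1) mu k * kcoef s k * psi k x.

(** In the span of the kernel sections the eigenfunction expansion is a pointwise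
    limit, so Fatou's lemma bounds its remainder. *)
Lemma kcomb_tail s d : valid s ->
  dot (fun x => ev (kcomb s) x - kpart s d x) (fun x => ev (kcomb s) x - kpart s d x) <=
  mu d.+1 * `|kcomb s| ^+ 2.
Proof.
move=> v; set q := kpart s d.
have Lcomb a b : (1 <= a)%N -> L2 leb I01 (fun x => \sum_(a <= k < b) mu k * kcoef s k * psi k x).
  move=> a1; apply: L2_orthonormal_comb => // k.
  by rewrite mem_index_iota => /andP[ak _]; apply: psiL2; exact: leq_trans ak.
have Lq : L2 leb I01 q by exact: Lcomb.
have Lr : L2 leb I01 (fun x => ev (kcomb s) x - q x) by apply: L2_sub => //; exact: ev_L2.
rewrite -lee_fin -L2dotE//.
apply: (@fatou_bound _ _ _ leb _ mI (fun N x => (\sum_(1 <= k < N.+1) mu k * kcoef s k * psi k x - q x) ^+ 2) _ _ d).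
- move=> N; apply: measurable_funX; apply: measurable_funB; last by case: Lq.
  by have [] := Lcomb 1%N N.+1 isT.
- by move=> N x; exact: sqr_ge0.
- move=> x ux.
  have C : (fun N : nat => \sum_(1 <= k < N.+1) mu k * kcoef s k * psi k x - q x) @ \oo --> ev (kcomb s) x - q x.
    by apply: cvgB; [exact: kcomb_mercer|exact: cvg_cst].
  exact: (cvgM C C).
move=> N dN.
have E : forall x, \sum_(1 <= k < N.+1) mu k * kcoef s k * psi k x - q x =
    \sum_(d.+1 <= k < N.+1) mu k * kcoef s k * psi k x.
  by move=> x; rewrite /q /kpart (@big_cat_nat _ _ _ d.+1 1 N.+1)//= addrAC subrr add0r.
under eq_integral do rewrite E.
rewrite (L2dotE mI (Lcomb d.+1 N.+1 isT)) lee_fin orthonormal_comb_sqr//; last 3 first.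
- exact: iota_uniq.
- by move=> k; rewrite mem_index_iota => /andP[ak _]; apply: psiL2; exact: leq_trans ak.
- move=> k l; rewrite !mem_index_iota => /andP[ak _] /andP[al _].
  by apply: psi_orth; [exact: leq_trans ak|exact: leq_trans al].
apply: (@le_trans _ _ (mu d.+1 * \sum_(d.+1 <= k < N.+1) mu k * kcoef s k ^+ 2)).
  rewrite mulr_sumr big_nat_cond [leRHS]big_nat_cond; apply: ler_sum => k /andP[/andP[dk _] _].
  rewrite exprMn expr2 -mulrA; apply: ler_wpM2r; last exact: mu_le.
  by apply: mulr_ge0; [apply: mu0; exact: leq_trans dk|exact: sqr_ge0].
apply: ler_wpM2l; first exact: mu0.
apply: le_trans (partial_le N v); rewrite [leRHS](@big_cat_nat _ _ _ d.+1)//= lerDr.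
rewrite big_nat_cond; apply: sumr_ge0 => k /andP[/andP[k1 _] _].
by apply: mulr_ge0; [exact: mu0|exact: sqr_ge0].
Qed.

Let kcomb_L2_le s : valid s -> dot (ev (kcomb s)) (ev (kcomb s)) <= mu 1%N * `|kcomb s| ^+ 2.
Proof.
move=> v; apply: le_trans (kcomb_tail 0 v); rewrite le_eqVlt; apply/predU1P; left.
by apply: L2dot_eq => x _; rewrite /kpart big_geq// subr0.
Qed.

Section approximation.
Variable g : H.
Hypothesis Hg : @H0 R H g.

Let dist2 := [set r : R | exists2 s, valid s & r = `|g - kcomb s| ^+ 2].
Let delta := inf dist2.

Let dist2_lb : has_lbound dist2.
Proof. by exists 0 => r [s _ ->]; exact: sqr_ge0. Qed.

Let delta_le s : valid s -> delta <= `|g - kcomb s| ^+ 2.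
Proof. by move=> v; apply: ge_inf => //; exists s. Qed.

Let valid_nil : valid [::]. Proof. by []. Qed.

Let delta_g : delta <= `|g| ^+ 2.
Proof. by have := delta_le valid_nil; rewrite /kcomb big_nil subr0. Qed.

Let eps (i : nat) : R := i.+1%:R^-1.

Let minseq_ex (i : nat) : exists s, valid s /\ `|g - kcomb s| ^+ 2 <= delta + eps i.
Proof.
have i0 : 0 < eps i by rewrite invr_gt0.
have hi : has_inf dist2 by split => //; exists (`|g - kcomb [::]| ^+ 2), [::].
have [r [s v ->] lt] := inf_adherent i0 hi.
by exists s; split => //; exact: ltW.
Qed.

Let G := projT1 (choice minseq_ex).
Let Gv i : valid (G i). Proof. by have [] := projT2 (choice minseq_ex) i. Qed.
Let Gd i : `|g - kcomb (G i)| ^+ 2 <= delta + eps i.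
Proof. by have [] := projT2 (choice minseq_ex) i. Qed.

(** First-order optimality in the direction of a kernel section. *)
Let G_pointwise i x : I01 x ->
  (ev g x - ev (kcomb (G i)) x) ^+ 2 <= eps i * (`|k0 x| ^+ 2 + 1).
Proof.
move=> ux; set c := ev g x - _; set K := `|k0 x| ^+ 2.
have K0 : 0 <= K by exact: sqr_ge0.
have cE : c = hdot (g - kcomb (G i)) (k0 x).
  have [_ /(_ _ Hg) gx] := rep ux.
  have -> : g - kcomb (G i) = g + (-1) *: kcomb (G i) by rewrite scaleN1r.
  by rewrite hdotDl hdotZl mulN1r (hdot_kcomb (@Gv i) ux) /c gx.
(* Nearly the optimal step c / K, which is undefined if K = 0. *)
pose t := c / (K + 1).
have vt : valid ((t, x) :: G i).
  by move=> z; rewrite inE => /orP[/eqP ->//|]; exact: Gv.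
have := delta_le vt; rewrite kcomb_cons/= opprD addrCA addrC -scaleNr norm_addZ_sqr -cE.
have := Gd i; set e := eps i; move=> h1 h2.
have h3 : 2 * t * c <= e + t ^+ 2 * K by rewrite -/K in h2; nra.
have tc : c = t * (K + 1) by rewrite /t divfK// gt_eqF//; lra.
rewrite tc in h3 *; have : t ^+ 2 * (K + 1) <= e by have := sqr_ge0 t; nra.
by nra.
Qed.

Let G_cvg x : I01 x -> (fun i => ev (kcomb (G i)) x) @ \oo --> ev g x.
Proof.
move=> ux; apply/cvgrPdist_lt => e e0.
set K := `|k0 x| ^+ 2 + 1; have K0 : 0 < K by rewrite ltr_wpDl ?sqr_ge0.
have d0 : 0 < e ^+ 2 / K by rewrite divr_gt0// exprn_gt0.
have := near_infty_natSinv_lt (PosNum d0).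
apply: filterS => i /=; rewrite ltr_pdivlMr// => lt.
have := G_pointwise i ux; rewrite -/K => le.
have := le_lt_trans le lt; rewrite -real_normK ?num_real//.
by move=> lt2; rewrite -(ltr_pXn2r (n := 2))// ?nnegrE// ltW.
Qed.

Let eps_le i j : (i <= j)%N -> eps j <= eps i.
Proof. by move=> ij; rewrite lef_pV2 ?posrE// ler_nat. Qed.

(** Minimizing sequences for a distance are Cauchy, by the parallelogram law. *)
Let G_cauchy i j : (i <= j)%N -> `|kcomb (G j) - kcomb (G i)| ^+ 2 <= 4 * eps i.
Proof.
move=> ij; have := parallelogram (g - kcomb (G i)) (g - kcomb (G j)).
have -> : g - kcomb (G i) - (g - kcomb (G j)) = kcomb (G j) - kcomb (G i).
  by rewrite opprB addrC addrA subrK.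
pose s := kscale 2^-1 (G i ++ G j).
have vs : valid s by apply: valid_scale; exact: valid_cat (@Gv _) (@Gv _).
have := delta_le vs.
have -> : g - kcomb (G i) + (g - kcomb (G j)) = 2 *: (g - kcomb s).
  rewrite kcomb_scale kcomb_cat scalerBr scalerA mulfV// scale1r.
  by rewrite scaler_nat mulr2n opprD addrACA.
rewrite normrZ exprMn ger0_norm//.
by have := Gd i; have := Gd j; have := eps_le ij; lra.
Qed.

Let G_L2 i : dot (fun x => ev (kcomb (G i)) x - ev g x) (fun x => ev (kcomb (G i)) x - ev g x) <=
  mu 1%N * (4 * eps i).
Proof.
have L : L2 leb I01 (fun x => ev (kcomb (G i)) x - ev g x) by apply: L2_sub => //; exact: ev_L2.
rewrite -lee_fin -L2dotE//.
apply: (@fatou_bound _ _ _ leb _ mI (fun j x => (ev (kcomb (G i)) x - ev (kcomb (G j)) x) ^+ 2) _ _ i).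
- move=> j; apply: measurable_funX; apply: measurable_funB.
    by have [] := ev_L2 (kcomb (G i)).
  by have [] := ev_L2 (kcomb (G j)).
- by move=> j x; exact: sqr_ge0.
- move=> x ux; have C : (fun j : nat => ev (kcomb (G i)) x - ev (kcomb (G j)) x) @ \oo --> ev (kcomb (G i)) x - ev g x.
    by apply: cvgB; [exact: cvg_cst|exact: G_cvg].
  exact: (cvgM C C).
move=> j ij; pose s := G j ++ kscale (-1) (G i).
have vs : valid s by exact: valid_cat (@Gv j) (valid_scale (a := -1) (@Gv i)).
have sE : kcomb s = kcomb (G j) - kcomb (G i) by rewrite kcomb_cat kcomb_scale scaleN1r.
rewrite (_ : (\int[leb]_(x in I01) _)%E = (\int[leb]_(x in I01) (ev (kcomb s) x ^+ 2)%:E)%E); last first.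
  apply: eq_integral => x /set_mem ux; congr EFin.
  have -> : kcomb s = kcomb (G j) + (-1) *: kcomb (G i) by rewrite sE scaleN1r.
  by rewrite evD// evZ// mulN1r -sqrrN opprB.
rewrite L2dotE//; last exact: ev_L2.
rewrite lee_fin; apply: le_trans (kcomb_L2_le vs) _; rewrite ler_wpM2l ?mu0//.
by rewrite sE G_cauchy.
Qed.

(** The minimizing sequence converges pointwise to [g] ([G_pointwise]) and in L^2
    (by Fatou's lemma and [kcomb_tail] at [d = 0]), and [kcomb_tail] bounds the
    remainder of each of its terms. The bound holds with constant one; the weaker
    constant lets the sequence be handled by crude inequalities. *)
Lemma rkhs_tail d :
  dot (ev g) (ev g) - \sum_(1 <= k < d.+1) dot (psi k) (ev g) ^+ 2 <= 8 * mu d.+1 * `|g| ^+ 2.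
Proof.
have m1 : 0 <= mu 1%N by exact: mu0.
have md : 0 <= mu d.+1 by exact: mu0.
set c := 4 * mu d.+1 + 8 * mu 1%N; have c0 : 0 <= c by rewrite /c; lra.
suff : forall i, dot (ev g) (ev g) - \sum_(1 <= k < d.+1) dot (psi k) (ev g) ^+ 2 <=
    8 * mu d.+1 * `|g| ^+ 2 + c * eps i.
  move=> Hi; apply/ler_addgt0Pr => e e0.
  have e1 : 0 < e / (c + 1) by rewrite divr_gt0//; lra.
  have [N _ /(_ N (leqnn N)) /=] := near_infty_natSinv_lt (PosNum e1).
  have y0 : 0 <= eps N by rewrite invr_ge0.
  rewrite ltr_pdivlMr; last lra.
  move=> lt; apply: le_trans (Hi N) _; rewrite lerD2l.
  by move: lt y0; rewrite -/(eps N); move: (eps N) => y; nra.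
move=> i.
have ri k : k \in index_iota 1 d.+1 -> (1 <= k)%N by rewrite mem_index_iota => /andP[].
have := @orthonormal_best_approx _ _ _ leb I01 mI _ (index_iota 1 d.+1) psi (iota_uniq _ _)
  (fun k kr => psiL2 (ri k kr)) (fun k l kr lr => psi_orth (ri k kr) (ri l lr))
  (ev g) (fun k => mu k * kcoef (G i) k) (ev_L2 g).
move=> h; apply: (le_trans h); clear h.
rewrite -/(kpart (G i) d); set q := kpart (G i) d.
have Lq : L2 leb I01 q.
  by apply: L2_orthonormal_comb => // k kr; apply: psiL2; exact: ri.
apply: le_trans (L2dot_sub_le mI (ev_L2 g) (ev_L2 (kcomb (G i))) Lq) _.
have h1 := kcomb_tail d (@Gv i); rewrite -/q in h1.
have h2 := G_L2 i.
have h3 : `|kcomb (G i)| ^+ 2 <= 4 * `|g| ^+ 2 + 2 * eps i.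
  have := parallelogram g (g - kcomb (G i)); have -> : g - (g - kcomb (G i)) = kcomb (G i) by rewrite opprB addrC subrK.
  have := sqr_ge0 `|g + (g - kcomb (G i))|; have := Gd i; have := delta_g; lra.
have h4 : mu d.+1 * `|kcomb (G i)| ^+ 2 <= mu d.+1 * (4 * `|g| ^+ 2 + 2 * eps i).
  by rewrite ler_wpM2l.
rewrite /c; lra.
Qed.

End approximation.
End kernel_tail.

(** * Additive functions on the cube *)

Section cube_geometry.
Context {R : realType}.
Local Notation leb := (@lebesgue01 R).
Local Notation I01 := (@unit_itv R).
Local Notation Q p := (@lebesgue_cube R p).
Local Notation C p := (@cube R p).
Local Notation pt p := (p.-tuple (measurableTypeR R)).

Lemma measurable_unit_itv : measurable I01. Proof. exact: measurable_itv. Qed.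

Lemma lebesgue01_unit : leb I01 = 1%E.
Proof. by rewrite /lebesgue01 /uniform_prob; exact: integral_uniform_pdf1. Qed.

Lemma measurable_cube p : measurable (C p).
Proof.
rewrite (_ : C p = \bigcap_(j in [set: 'I_p]) ((fun x : pt p => tnth x j) @^-1` I01)).
  apply: fin_bigcap_measurable => // j _.
  by rewrite -[X in measurable X]setTI; exact: measurable_tnth measurable_unit_itv.
by apply/seteqP; split => x /= H j; [move=> _; exact: H|exact: H].
Qed.

Lemma cube_full p : Q p (C p) = 1%E.
Proof.
have -> : Q p (C p) = (\prod_(j < p) leb I01)%E.
  by apply: (prod_prob_box leb (A := fun=> I01)) => _; exact: measurable_unit_itv.
by rewrite big1// => j _; exact: lebesgue01_unit.
Qed.

Lemma integral_cube p (F : pt p -> R) : (Q p).-integrable setT (EFin \o F) ->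
  (\int[Q p]_(x in C p) (F x)%:E = \int[Q p]_x (F x)%:E)%E.
Proof.
move=> Fi; have mC := @measurable_cube p.
rewrite [RHS](@negligible_integral _ _ _ _ _ (~` C p))//; last 2 first.
- exact: measurableC.
- transitivity (1 - Q p (C p))%E; first exact: probability_setC.
  by rewrite [X in (_ - X)%E]cube_full subee.
by rewrite setTD setCK.
Qed.

Definition oncoord p (f : R -> R) (j : 'I_p) (x : pt p) : R := f (tnth x j).
Local Notation patch01 f := ((f : measurableTypeR R -> R) \_ I01).

Let coord_patch p f (j : 'I_p) : {in C p, oncoord f j =1 oncoord (patch01 f) j}.
Proof. by move=> x /set_mem Cx; rewrite /oncoord patchE mem_set//; exact: Cx. Qed.

Let patch_measurable f : measurable_fun I01 f -> measurable_fun setT (patch01 f).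
Proof. by move/(measurable_restrictT _ measurable_unit_itv). Qed.

Let patch_prod f g : EFin \o (fun x => patch01 f x * patch01 g x) = (EFin \o (fun x => f x * g x)) \_ I01.
Proof. by apply/funext => x /=; rewrite !patchE; case: ifP; rewrite ?mulr0. Qed.

Let patch_prod_integrable f g : L2 leb I01 f -> L2 leb I01 g ->
  leb.-integrable setT (EFin \o (fun x => patch01 f x * patch01 g x)).
Proof.
move=> Lf Lg; rewrite patch_prod -integrable_mkcond; last exact: measurable_unit_itv.
exact: (L2_integrableM measurable_unit_itv Lf Lg).
Qed.

Lemma L2_cst1 : L2 leb I01 (cst 1).
Proof.
split; first exact: measurable_cst.
rewrite (_ : _ \o _ = cst 1%E); last by apply/funext => x /=; rewrite expr1n.
by apply: finite_measure_integrable_cst; exact: measurable_unit_itv.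
Qed.

Let patch1 f : EFin \o patch01 f = (EFin \o (fun x => f x * 1)) \_ I01.
Proof. by apply/funext => x /=; rewrite !patchE; case: (x \in I01); rewrite /= ?mulr1. Qed.

Let patch_integrable f : L2 leb I01 f -> leb.-integrable setT (EFin \o patch01 f).
Proof.
move=> Lf; rewrite patch1 -integrable_mkcond; last exact: measurable_unit_itv.
exact: (L2_integrableM measurable_unit_itv Lf L2_cst1).
Qed.

Let patch_integral0 f : L2 leb I01 f -> mean_zero f -> (\int[leb]_x (patch01 f x)%:E = 0)%E.
Proof.
move=> Lf f0; have -> : (\int[leb]_x (patch01 f x)%:E = \int[leb]_(x in I01) (f x * 1)%:E)%E.
  by rewrite [RHS]integral_mkcond; apply: eq_integral => x _; have /= -> := congr1 (@^~ x) (patch1 f).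
rewrite -[LHS]fineK; last first.
  apply: integrable_fin_num; first exact: measurable_unit_itv.
  exact: (L2_integrableM measurable_unit_itv Lf L2_cst1).
by move: f0; rewrite /mean_zero /L2dot /Rintegral => ->.
Qed.

Lemma coord_L2 p f (j : 'I_p) : L2 leb I01 f -> L2 (Q p) (C p) (oncoord f j).
Proof.
move=> Lf; have mC := @measurable_cube p.
have E : {in C p, oncoord (patch01 f) j =1 oncoord f j} by move=> x xC; rewrite -coord_patch.
apply: (L2_eq mC E).
split.
  apply: measurable_funTS; apply: (measurableT_comp (patch_measurable _)); last exact: measurable_tnth.
  by case: Lf.
apply: (@integrableS _ _ _ (Q p) setT (C p)) => //.
exact: (@integrable_prod_prob_tnth R _ _ leb p j (fun x => patch01 f x * patch01 f x) (patch_prod_integrable Lf Lf)).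
Qed.

Lemma coord_dot_eq p f g (j : 'I_p) : L2 leb I01 f -> L2 leb I01 g ->
  L2dot (Q p) (C p) (oncoord f j) (oncoord g j) = L2dot leb I01 f g.
Proof.
move=> Lf Lg; rewrite (L2dot_eq _ (@coord_patch _ f j) (@coord_patch _ g j)).
rewrite /L2dot /Rintegral; congr fine.
have pfg := patch_prod_integrable Lf Lg.
rewrite integral_cube; last exact: (integrable_prod_prob_tnth j pfg).
rewrite (@integral_prod_prob_tnth R _ _ leb p j (fun x => patch01 f x * patch01 g x) pfg).
rewrite [RHS]integral_mkcond; apply: eq_integral => x _.
by have /= -> := congr1 (@^~ x) (patch_prod f g).
Qed.

Lemma coord_dot_neq p f g (i j : 'I_p) : i != j -> L2 leb I01 f -> L2 leb I01 g ->
  mean_zero f -> L2dot (Q p) (C p) (oncoord f i) (oncoord g j) = 0.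
Proof.
move=> ij Lf Lg f0; rewrite (L2dot_eq _ (@coord_patch _ f i) (@coord_patch _ g j)).
have [hi hE] := @integral_prod_prob_tnth2 R _ _ leb p i j _ _ ij (patch_integrable Lf) (patch_integrable Lg).
rewrite /L2dot /Rintegral integral_cube//.
by rewrite [X in fine X]hE patch_integral0// mul0e.
Qed.

(** Centred univariate components are orthogonal, so the geometry of an additive
    function is that of its components. *)
Section additive.
Variables (p : nat) (S : {set 'I_p}) (g : 'I_p -> R -> R).
Hypothesis gL2 : forall j, j \in S -> L2 leb I01 (g j).
Hypothesis g0 : forall j, j \in S -> mean_zero (g j).
Let f (x : pt p) : R := \sum_(j in S) g j (tnth x j).

Let fE : f = fun x => \sum_(j <- enum S) oncoord (g j) j x.
Proof. by apply/funext => x; rewrite big_enum. Qed.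

Lemma additive_L2 : L2 (Q p) (C p) f.
Proof.
rewrite fE; apply: L2_sum; first exact: measurable_cube.
by move=> j; rewrite mem_enum => jS; apply: coord_L2; exact: gL2.
Qed.

Lemma coord_dot_additive u (j : 'I_p) : L2 leb I01 u -> mean_zero u ->
  L2dot (Q p) (C p) (oncoord u j) f = if j \in S then L2dot leb I01 u (g j) else 0.
Proof.
move=> Lu u0; rewrite fE L2dot_sumr; last 3 first.
- exact: measurable_cube.
- by move=> i; rewrite mem_enum => iS; apply: coord_L2; exact: gL2.
- exact: coord_L2.
rewrite big_enum/=; case: ifP => jS.
  rewrite (bigD1 j)//= coord_dot_eq//; last exact: gL2.
  rewrite big1 ?addr0// => i /andP[iS ij]; apply: coord_dot_neq => //; last exact: gL2.
  by rewrite eq_sym.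
rewrite big1// => i iS; apply: coord_dot_neq => //; last exact: gL2.
by apply/eqP => ji; rewrite ji iS in jS.
Qed.

Lemma additive_dot : L2dot (Q p) (C p) f f = \sum_(j in S) L2dot leb I01 (g j) (g j).
Proof.
rewrite {1}fE L2dot_suml; last 3 first.
- exact: measurable_cube.
- by move=> i; rewrite mem_enum => iS; apply: coord_L2; exact: gL2.
- exact: additive_L2.
rewrite big_enum/=; apply: eq_bigr => j jS.
by rewrite coord_dot_additive ?jS//; [exact: gL2|exact: g0].
Qed.

End additive.

Section orthonormal_array.
Variables (psi : nat -> R -> R) (p d : nat).
Hypothesis psiL2 : forall k, (1 <= k)%N -> L2 leb I01 (psi k).
Hypothesis psi0 : forall k, (1 <= k)%N -> mean_zero (psi k).
Hypothesis psi_orth : forall k l, (1 <= k)%N -> (1 <= l)%N ->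
  L2dot leb I01 (psi k) (psi l) = (k == l)%:R.

Let h (z : 'I_p * 'I_d) := oncoord (psi z.2.+1) z.1.

Lemma coord_array_orth (z z' : 'I_p * 'I_d) :
  L2dot (Q p) (C p) (h z) (h z') = (z == z')%:R.
Proof.
case: z z' => [j k] [j' k']; rewrite /h/= xpair_eqE.
have [<-|jj] := eqVneq j j'; first by rewrite coord_dot_eq ?psi_orth//; exact: psiL2.
by rewrite coord_dot_neq//; [exact: psiL2|exact: psiL2|exact: psi0].
Qed.

(** The [oncoord (psi k) j] are orthonormal, so the linear combinations of
    their noise have the variances required by [array_law]. *)
Lemma white_noise_array {d' : measure_display} {Omega : measurableType d'}
    (P : probability Omega R) (B : (pt p -> R) -> Omega -> R) :
  white_noise P (Q p) (C p) B ->
  let Z (j : 'I_p) (k : 'I_d) := B (oncoord (psi k.+1) j) in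
  measurable_fun setT (array Z) /\
  forall A, measurable A -> P (array Z @^-1` A) = prod_prob (@gauss_vec R d) p A.
Proof.
move=> wn Z; have mC := @measurable_cube p.
have hL2 z : L2 (Q p) (C p) (h z) by apply: coord_L2; exact: psiL2.
apply: array_law.
  move=> j k; have [] := wn 1%N (fun=> 1) (fun=> h (j, k)) (fun=> hL2 (j, k)).
  by under eq_fun do rewrite big_ord1 mul1r.
move=> a; have := wn #|{: 'I_p * 'I_d}| (fun i => a (enum_val i).1 (enum_val i).2) (fun i => h (enum_val i)) (fun i => hL2 _).
have E1 (F : 'I_p * 'I_d -> R) : \sum_(i < #|{: 'I_p * 'I_d}|) F (enum_val i) = \sum_(j < p) \sum_(k < d) F (j, k).
  by rewrite -(big_enum_val F) pair_big/=; apply: eq_big => -[].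
rewrite L2norm_sqr.
have -> : L2dot (Q p) (C p) (fun x => \sum_(i < #|{: 'I_p * 'I_d}|) a (enum_val i).1 (enum_val i).2 * h (enum_val i) x)
   (fun x => \sum_(i < #|{: 'I_p * 'I_d}|) a (enum_val i).1 (enum_val i).2 * h (enum_val i) x) =
   \sum_(j < p) \sum_(k < d) a j k ^+ 2.
  rewrite orthonormal_comb_sqr//; last 2 first.
  - exact: index_enum_uniq.
  - move=> i i' _ _; rewrite coord_array_orth; congr (nat_of_bool _)%:R.
    exact: (inj_eq enum_val_inj).
  exact: (E1 (fun z => a z.1 z.2 ^+ 2)).
have -> // : (fun w => \sum_(i < #|{: 'I_p * 'I_d}|) a (enum_val i).1 (enum_val i).2 * B (h (enum_val i)) w) =
  (fun w => \sum_(j < p) \sum_(k < d) a j k * Z j k w).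
apply/funext => w; exact: (E1 (fun z => a z.1 z.2 * B (h z) w)).
Qed.

End orthonormal_array.
End cube_geometry.

(** * Numerical bounds and the union bound *)

Section numeric_bounds.
Context {R : realType}.

Lemma expRN_le_inv (x : R) : 0 < x -> expR (- x) <= x^-1.
Proof.
move=> x0; rewrite expRN lef_pV2 ?posrE ?expR_gt0//.
by apply: le_trans (expR_ge1Dx _); rewrite lerDr.
Qed.

Lemma sum_half_pow K : \sum_(0 <= k < K) ((2 ^ k)%:R)^-1 <= 2 :> R.
Proof.
suff : \sum_(0 <= k < K) ((2 ^ k)%:R)^-1 = 2 - 2 * ((2 ^ K)%:R)^-1 :> R.
  by move=> ->; rewrite gerDl oppr_le0 mulr_ge0// invr_ge0.
elim: K => [|K IH]; first by rewrite big_geq// invr1; ring.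
rewrite big_nat_recr//= IH expnS natrM invfM.
by move: (_%:R^-1) => y; field.
Qed.

Lemma sum_four_pow K : \sum_(0 <= k < K) ((2 ^ k)%:R) ^+ 2 <= ((2 ^ K)%:R) ^+ 2 / 3 :> R.
Proof.
elim: K => [|K IH]; first by rewrite big_geq// divr_ge0// sqr_ge0.
rewrite big_nat_recr//= expnS natrM.
by move: IH; set S := \sum_(_ <= _ < _) _; move: (_%:R) => y; lra.
Qed.

Definition sparse_term (p : nat) (A C : R) (s : nat) (L : R) : R :=
  expR (- ((C - 1) / 128 * (s%:R * L))) +
  expR (- ((C - 1) / 128 ^+ 2 * (L ^+ 2 * A * expR L))).

(** The factor [expR A] pays for the number of resolutions. *)
Lemma sparse_term_le p (A C : R) s L : (0 < p)%N -> (0 < s)%N -> 1 <= A -> 256 * 256 * 8 <= C ->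
  L = ln (1 + p%:R * A / s%:R ^+ 2) -> 2^-1 <= L -> A <= 8 * (s%:R * L) ->
  expR A * sparse_term p A C s L <=
  512 / C * s%:R^-1 + 256 * 512 / C * (s%:R ^+ 2 / (p%:R * A)).
Proof.
move=> p0 s0 A1 C19 LE L2 A8.
have s00 : 0 < s%:R :> R by rewrite ltr0n.
have p00 : 0 < p%:R :> R by rewrite ltr0n.
have C0 : 0 < C by lra.
rewrite /sparse_term mulrDr -!expRD; apply: lerD.
  apply: (@le_trans _ _ (expR (- (C / 256 * (s%:R * L))))).
    rewrite ler_expR; have : 0 < s%:R * L by rewrite mulr_gt0//; lra.
    by move: (s%:R * L) A8 => y A8 y0; nra.
  apply: le_trans (expRN_le_inv _) _; first by apply: mulr_gt0; [lra|apply: mulr_gt0 => //; lra].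
  have -> : 512 / C * s%:R^-1 = (C / 256 * (s%:R * 2^-1))^-1.
    by field; rewrite !gt_eqF.
  rewrite lef_pV2 ?posrE; last 2 first.
  - by apply: mulr_gt0; [lra|apply: mulr_gt0 => //; lra].
  - by apply: mulr_gt0; [lra|apply: mulr_gt0 => //; lra].
  rewrite ler_pM2l; last by rewrite divr_gt0.
  by rewrite ler_pM2l.
set u := p%:R * A / s%:R ^+ 2.
have A0 : 0 < A by lra.
have u0 : 0 < u by rewrite divr_gt0 ?mulr_gt0 ?exprn_gt0.
have eL : expR L = 1 + u by rewrite LE -/u lnK// posrE; lra.
apply: (@le_trans _ _ (expR (- (C / (256 * 512) * u)))).
  rewrite ler_expR eL.
  have L4 : 4^-1 <= L ^+ 2 by nra.
  have h : 4^-1 * (A * (1 + u)) <= L ^+ 2 * (A * (1 + u)) 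
    by apply: ler_wpM2r => //; apply: mulr_ge0; lra.
  have Au : u <= A * u by rewrite ler_peMl// ltW.
  have c0 : 4 <= (C - 1) / 128 ^+ 2.
    rewrite ler_pdivlMr ?exprn_gt0//; lra.
  have c1 : C / (128 * 256) <= (C - 1) / 128 ^+ 2.
    lra.
  have h2 : (C - 1) / 128 ^+ 2 * (4^-1 * (A * (1 + u))) <= (C - 1) / 128 ^+ 2 * (L ^+ 2 * (A * (1 + u))).
    by rewrite ler_wpM2l//; lra.
  have -> : C / (256 * 512) = C / (128 * 256) / 4 by field.
  rewrite -(mulrA (L ^+ 2)); move: c0 c1 h2; set K := (C - 1) / 128 ^+ 2; set K' := C / _.
  by move=> c0 c1 h2; nra.
have q0 : 0 < C / (256 * 512) by lra.
apply: le_trans (expRN_le_inv (mulr_gt0 q0 u0)) _.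
rewrite le_eqVlt; apply/predU1P; left; rewrite /u; field.
by rewrite !gt_eqF.
Qed.

Lemma dense_term_le (A C : R) : 1 <= A -> 256 * 256 * 8 <= C ->
  expR A * expR (- ((C - 1) / 4 * A)) <= 8 / C.
Proof.
move=> A1 C19.
rewrite -expRD; apply: (@le_trans _ _ (expR (- (C / 8)))); first by rewrite ler_expR; nra.
apply: le_trans (expRN_le_inv _) _; first by lra.
by rewrite invf_div.
Qed.

Lemma null_total (c : R) : 0 <= c ->
  512 * c * 2 + 256 * 512 * 4 / 3 * c + 8 * c <= (256 * 512 * 2 + 2048) * c.
Proof. by move=> c0; lra. Qed.

Lemma power_term_le (C : R) : 256 * 256 * 8 <= C -> expR (1 - C / 256) <= 512 / C.
Proof.
move=> C19.
apply: (@le_trans _ _ (expR (- (C / 512)))); first by rewrite ler_expR; lra.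
apply: le_trans (expRN_le_inv _) _; first by lra.
by rewrite invf_div.
Qed.

End numeric_bounds.

Section union_bound.
Context {R : realType} {d : measure_display} {T : measurableType d}.

Lemma union_bound (P : probability T R) (I : eqType) (r : seq I) (A : I -> set T) :
  (forall i, i \in r -> measurable (A i)) ->
  measurable (\big[setU/set0]_(i <- r) A i) /\
  (P (\big[setU/set0]_(i <- r) A i) <= \sum_(i <- r) P (A i))%E.
Proof.
elim: r => [|i r IH] mA; first by rewrite !big_nil measure0.
have [mr Pr] := IH (fun j jr => mA j (@mem_behead _ (i :: r) j jr)).
have mi := mA i (mem_head _ _).
rewrite !big_cons; split; first exact: measurableU.
by apply: le_trans (measureU2 _ mi mr) _; rewrite leeD2l.
Qed.

Lemma mem_bigsetU (I : eqType) (r : seq I) (A : I -> set T) x :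
  (\big[setU/set0]_(i <- r) A i) x <-> exists2 i, i \in r & A i x.
Proof.
elim: r => [|i r IH]; first by rewrite big_nil; split=> // -[].
rewrite big_cons; split.
  move=> [Ai|/IH[j jr Aj]]; first by exists i; rewrite ?mem_head.
  by exists j => //; rewrite inE jr orbT.
move=> [j]; rewrite inE => /orP[/eqP -> Ai|jr Aj]; first by left.
by right; apply/IH; exists j.
Qed.

End union_bound.

Section max_test_facts.
Context {R : realType} {p : nat} (n : nat) (X : nat -> 'I_p -> R).
Variables (D K2 K2' K3 C : R) (mu : nat -> R).
Local Notation test := (max_test n X D K2 K2' K3 C mu).
Local Notation ph := (phi n X D K2 K2' K3 C mu).

Lemma max_test_neq0P : test <> 0%N <->
  exists2 z : nat * nat, z \in [seq (v, s) | v <- fset_set (VH mu p n), s <- Sgrid mu p n] & ph z.1 z.2.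
Proof.
split.
  move=> t0; apply: contrapT => nH; apply: t0; rewrite /max_test.
  apply/eqP; rewrite -leqn0; apply/bigmax_leqP_seq => v vV _.
  apply/bigmax_leqP_seq => s sS _; case E : (ph v s) => //.
  by case: nH; exists (v, s) => //; apply: allpairs_f.
move=> [[v s] /allpairsP[[v' s'] [/= vV sS [-> ->]]] phs] /eqP.
rewrite /max_test -leqn0 => /bigmax_leqP_seq/(_ v' vV isT).
by move=> /bigmax_leqP_seq/(_ s' sS isT); rewrite phs.
Qed.

Lemma max_test_le1 : (test <= 1)%N.
Proof.
rewrite /max_test; apply/bigmax_leqP_seq => v _ _; apply/bigmax_leqP_seq => s _ _.
exact: leq_b1.
Qed.

Lemma max_test_neq1E : test <> 1%N <-> ~ (test <> 0%N).
Proof. have := max_test_le1; case: test => [|[|//]] _; split.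
- by move=> _; apply.
- by [].
- by move=> /(_ erefl).
- by move=> H; case: H.
 Qed.

End max_test_facts.

(** * Risk of the test *)

Section model_risk.
Context {R : realType}.
Variables (p n : nat) (H : @hilbert_fun R) (mu : nat -> R) (psi : nat -> R -> R).
Hypothesis p0 : (0 < p)%N.
Hypothesis n0 : (0 < n)%N.
Hypothesis HS : H0_mercer_system H mu psi.
Hypothesis mu1 : mu 1%N = 1.
Context {d : measure_display} {Omega : measurableType d}.
Variables (P : (p.-tuple (measurableTypeR R) -> R) -> probability Omega R)
  (Y : (p.-tuple (measurableTypeR R) -> R) -> Omega -> R).
Hypothesis wnm : white_noise_model n P Y.
Variable C : R.
Hypothesis C19 : 256 * 256 * 8 <= C.

Local Notation leb := (@lebesgue01 R).
Local Notation I01 := (@unit_itv R).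
Local Notation Q := (@lebesgue_cube R p).
Local Notation cub := (@cube R p).
Local Notation law m := (prod_prob (@gauss_vec R m) p).
Local Notation arr m := (p.-tuple (m.-tuple (measurableTypeR R))).
Local Notation A := (AH mu p n).
Local Notation L s := (log_term p s A).
Local Notation stat w := (Xstat psi Y w).
Local Notation ph w := (phi n (stat w) 1 4 16 8^-1 C mu).
Local Notation test w := (max_test n (stat w) 1 4 16 8^-1 C mu).
Local Notation coef f j k := (L2dot Q cub (oncoord (psi k) j) f).

Let mon k : (1 <= k)%N -> 0 <= mu k.+1 <= mu k.
Proof. by have [[k0 [_ [_ _ h _]]] _] := HS; exact: h. Qed.
Let psiL2 k : (1 <= k)%N -> L2 leb I01 (psi k).
Proof. by have [[k0 [_ [h _ _ _]]] _] := HS; exact: h. Qed.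
Let psi_orth k l : (1 <= k)%N -> (1 <= l)%N -> L2dot leb I01 (psi k) (psi l) = (k == l)%:R.
Proof. by have [[k0 [_ [_ h _ _]]] _] := HS; exact: h. Qed.
Let psi0 k : (1 <= k)%N -> mean_zero (psi k).
Proof. by have [_ h] := HS; exact: h. Qed.

Let C0 : 0 < C. Proof. by move: C19; lra. Qed.
Let n00 : 0 < n%:R :> R. Proof. by rewrite ltr0n. Qed.
Let A1 : 1 <= A. Proof. exact: AH_ge1. Qed.
Let A0 : 0 < A. Proof. exact: AH_gt0. Qed.

(** Multiplication by [sqrt n] turns an observation with noise of variance [1 / n]
    into a standard Gaussian shifted by the rescaled coefficient. *)
Lemma model_law f m (b : 'I_p -> 'I_m -> R) : L2 Q cub f ->
  (forall j k, b j k = Num.sqrt n%:R * coef f j k.+1) ->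
  exists t : Omega -> arr m, [/\ measurable_fun setT t,
    forall E, measurable E -> P f (t @^-1` E) = law m E &
    forall w j, Estat n (stat w) j m = \sum_(k < m) (b j k + tnth (tnth (t w) j) k) ^+ 2].
Proof.
move=> Lf bE; have [B wn YE] := wnm Lf.
have [mt tlaw] := white_noise_array m psiL2 psi0 psi_orth wn.
exists (array (fun j k => B (oncoord (psi k.+1) j))); split => // w j.
rewrite /Estat big_add1/= big_mkord mulr_sumr; apply: eq_bigr => k _.
have LX : L2 Q cub (oncoord (psi k.+1) j) by apply: coord_L2; exact: psiL2.
rewrite tnth_array bE /Xstat -/(oncoord (psi k.+1) j) YE//.
have s0 : Num.sqrt n%:R != 0 :> R by rewrite gt_eqF// sqrtr_gt0.
rewrite -[X in X * _](@sqr_sqrtr _ n%:R)// -exprMn; congr (_ ^+ 2).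
by rewrite mulrDr mulrA mulfV// mul1r.
Qed.

Let dnu1 v : (0 < v)%N -> dnu (1 : R) v = v.
Proof. by move=> v0; rewrite /dnu ceil1; apply/maxn_idPl. Qed.

Let L_ge s : (0 < s)%N -> s%:R < Num.sqrt (p%:R * A) -> 2^-1 <= L s.
Proof.
by move=> s0 sA; apply: (le_trans (@ln2_ge R)); exact: (sparse_log_ge p0 n0 mon mu1).
Qed.

Lemma phi_sparseE v s : (0 < v)%N -> (0 < s)%N -> s%:R < Num.sqrt (p%:R * A) ->
  exists r w, [/\ 0 < r, calibrated v r (L s) w, w = Num.sqrt (v%:R * L s) \/ w = L s &
    forall X, phi n X 1 4 16 8^-1 C mu v s = (C * s%:R * w < @Tstat R p n X r v)].
Proof.
move=> v0 s0 sA; have Lh := L_ge s0 sA.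
have L0 : 0 < L s by lra.
have v00 : 0 < v%:R :> R by rewrite ltr0n.
have [bulk|tail] := lerP (Num.sqrt (L s)) (8^-1 * Num.sqrt v%:R).
  exists (rnu p n 1 4 mu v s), (Num.sqrt (v%:R * L s)).
  have vL0 : 0 < v%:R * L s by rewrite mulr_gt0.
  have r0 : 0 < rnu p n 1 4 mu v s by rewrite /rnu dnu1// mulr_gt0// powR_gt0.
  split => //; last 2 first.
  - by left.
  - by move=> X; rewrite /phi dnu1// sA bulk.
  apply: calibrated_bulk => //.
  rewrite /rnu dnu1// exprMn; have -> : 4 ^+ 2 = 16 :> R by ring.
  congr (_ * _); rewrite -powR_mulrn ?powR_ge0// -powRrM -powR12_sqrt ?ltW//.
  by congr (_ `^ _); field.
exists (rs p n 16 mu s), (L s).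
have r0 : 0 < rs p n 16 mu s by rewrite /rs mulr_gt0// sqrtr_gt0.
split => //; last 2 first.
- by right.
- by move=> X; rewrite /phi dnu1// sA leNgt tail.
apply: calibrated_tail => //.
by rewrite /rs exprMn sqr_sqrtr ?ltW//; ring.
Qed.

Lemma phi_denseE v s : (0 < v)%N -> Num.sqrt (p%:R * A) <= s%:R ->
  forall X, phi n X 1 4 16 8^-1 C mu v s =
    (v%:R * p%:R + C * Num.sqrt (v%:R * p%:R * A) < \sum_(j < p) @Estat R p n X j v).
Proof.
move=> v0 sA X; rewrite /phi ltNge sA/=; congr (_ < _).
by rewrite mulr_sumr.
Qed.

Lemma null_sparse v s : (0 < v)%N -> (0 < s)%N -> s%:R < Num.sqrt (p%:R * A) ->
  measurable [set w | ph w v s] /\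
  (P (cst 0%R) [set w | ph w v s] <= (sparse_term p A C s (L s))%:E)%E.
Proof.
move=> v0 s0 sA; have [r [w [r0 cal _ phE]]] := phi_sparseE v0 s0 sA.
have Lh := L_ge s0 sA.
have Lf : L2 Q cub (cst 0) by exact: L2_cst0.
have [|t [mt tlaw tE]] := @model_law (cst 0) v (fun _ _ => 0) Lf.
  by move=> j k; rewrite L2dotC L2dot0l mulr0.
have mE : measurable [set u : arr v | C * s%:R * w < \sum_(j < p) truncated r (tnth u j)].
  apply: measurable_gt_cst; apply: measurable_sum => j.
  by apply: (measurableT_comp (@measurable_truncated R v r)); exact: measurable_tnth.
have E : [set w | ph w v s] = t @^-1` [set u : arr v | C * s%:R * w < \sum_(j < p) truncated r (tnth u j)].
  apply/funext => x /=; rewrite phE -shifted_tstat0; congr (is_true (_ < _)).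
  by apply: eq_bigr => j _; rewrite tE.
split; first by rewrite E -[X in measurable X]setTI; exact: mt.
rewrite E tlaw//; apply: sparse_null_tail => //; move: C19; lra.
Qed.

Lemma null_dense v s : (0 < v)%N -> Num.sqrt (p%:R * A) <= s%:R ->
  measurable [set w | ph w v s] /\
  (P (cst 0%R) [set w | ph w v s] <= (expR (- ((C - 1) / 4 * A)))%:E)%E.
Proof.
move=> v0 sA; have phE := phi_denseE v0 sA.
have Lf : L2 Q cub (cst 0) by exact: L2_cst0.
have [|t [mt tlaw tE]] := @model_law (cst 0) v (fun _ _ => 0) Lf.
  by move=> j k; rewrite L2dotC L2dot0l mulr0.
have E : [set w | ph w v s] = t @^-1` [set u : arr v | v%:R * p%:R + C * Num.sqrt (v%:R * p%:R * A)
      < shifted_sqnorm finset.setT (fun _ _ => 0) u].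
  apply/funext => x /=; rewrite phE; congr (is_true (_ < _)).
  by apply: eq_big => [j|j _]; rewrite ?finset.in_setT// tE.
have mE : measurable [set u : arr v | v%:R * p%:R + C * Num.sqrt (v%:R * p%:R * A)
      < shifted_sqnorm finset.setT (fun _ _ => 0) u].
  by apply: measurable_gt_cst; exact: measurable_shifted_sqnorm_set.
split; first by rewrite E -[X in measurable X]setTI; exact: mt.
by rewrite E tlaw//; apply: dense_null_tail => //; exact: AH_le_p.
Qed.

Let Sgrid_gt0 s : s \in Sgrid mu p n -> (0 < s)%N.
Proof.
rewrite SgridE mem_cat mem_seq1 => /orP[/mapP[k _ ->]|/eqP ->//].
by rewrite expn_gt0.
Qed.

Let pA_le : Num.sqrt (p%:R * A) <= p%:R. Proof. exact: sqrt_pAH_le. Qed.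

Let grid := [seq (v, s) | v <- fset_set (VH mu p n), s <- Sgrid mu p n].

Let measurable_phi z : z \in grid -> measurable [set w | ph w z.1 z.2].
Proof.
move=> /allpairsP[[v s] [/= vV sS ->]] /=.
have v0 : (0 < v)%N by exact: VH_gt0 vV.
have s0 := Sgrid_gt0 sS.
have [sA|sA] := ltP s%:R (Num.sqrt (p%:R * A)).
  by have [] := null_sparse v0 s0 sA.
by have [] := null_dense v0 sA.
Qed.

Let testE : [set w | test w <> 0%N] = \big[setU/set0]_(z <- grid) [set w | ph w z.1 z.2].
Proof.
apply/seteqP; split => w /=.
  by move=> /max_test_neq0P[z zg zp]; apply/mem_bigsetU; exists z.
by move=> /mem_bigsetU[z zg zp]; apply/max_test_neq0P; exists z.
Qed.

Let measurable_test0 : measurable [set w | test w <> 0%N].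
Proof. by rewrite testE; have [] := union_bound (P (cst 0)) measurable_phi. Qed.

Let measurable_test1 : measurable [set w | test w <> 1%N].
Proof.
rewrite (_ : [set w | _] = ~` [set w | test w <> 0%N]); first exact: measurableC.
by apply/seteqP; split => w /= /max_test_neq1E.
Qed.

(** After multiplication by the number of resolutions, the terms of index [2^k]
    are geometric: one part decreases like [2^-k], the other increases like
    [4^k] up to [p A]. *)
Lemma null_risk : (P (cst 0%R) [set w | test w <> 0%N] <= ((256 * 512 * 2 + 2048) / C)%:E)%E.
Proof.
rewrite testE; have [_ h] := union_bound (P (cst 0)) measurable_phi.
apply: (le_trans h); rewrite big_allpairs/=.
pose K := ngrid mu p n.
pose bnd := \sum_(0 <= k < K) sparse_term p A C (2 ^ k) (L (2 ^ k)) + expR (- ((C - 1) / 4 * A)).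
have vb v : v \in fset_set (VH mu p n) ->
  (\sum_(s <- Sgrid mu p n) P (cst 0%R) [set w | ph w v s] <= bnd%:E)%E.
  move=> vV; have v0 : (0 < v)%N by exact: VH_gt0 vV.
  rewrite SgridE big_cat big_seq1/= EFinD; apply: leeD; last first.
    by have [] := null_dense v0 pA_le.
  rewrite big_map -sumEFin /index_iota subn0 big_seq [leRHS]big_seq.
  apply: lee_sum => k; rewrite mem_iota add0n /= => kK.
  have [] // := null_sparse v0 (s := (2 ^ k)%N) _ _; first by rewrite expn_gt0.
  by rewrite -ngridP.
apply: (@le_trans _ _ (\sum_(v <- fset_set (VH mu p n)) bnd%:E)%E).
  by rewrite big_seq [leRHS]big_seq; apply: lee_sum.
rewrite sumEFin lee_fin big_const_seq count_predT iter_addr_0.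
have bnd0 : 0 <= bnd.
  apply: addr_ge0; last exact: expR_ge0.
  by apply: sumr_ge0 => k _; apply: addr_ge0; exact: expR_ge0.
have cV := card_VH p0 n0 mon mu1.
have cV' : #|` fset_set (VH mu p n)|%:R <= expR A by apply: le_trans cV _; rewrite ler_expR; lra.
rewrite -[bnd *+ _]mulr_natl; apply: (le_trans (ler_wpM2r bnd0 cV')).
rewrite mulrDr mulr_sumr.
have p00 : 0 < p%:R :> R by rewrite ltr0n.
have pA0 : 0 < p%:R * A by rewrite mulr_gt0.
have kb k : (k < K)%N -> expR A * sparse_term p A C (2 ^ k) (L (2 ^ k)) <=
    512 / C * ((2 ^ k)%:R)^-1 + 256 * 512 / C / (p%:R * A) * ((2 ^ k)%:R ^+ 2).
  move=> kK; have k0 : (0 < 2 ^ k)%N by rewrite expn_gt0.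
  have kA : (2 ^ k)%:R < Num.sqrt (p%:R * A) by rewrite -ngridP.
  apply: le_trans (sparse_term_le p0 k0 A1 C19 (erefl _) (L_ge k0 kA) (AH_le_sparse p0 n0 mon mu1 k0 kA)) _.
  by rewrite lerD2l [leRHS]mulrAC mulrA.
have h4 : ((2 ^ K)%:R : R) ^+ 2 <= 4 * (p%:R * A).
  have := ngridP p0 n0 mon mu1 K.-1; rewrite -/K.
  case: (K) => [_|k]; last first.
    rewrite /= ltnSn => /esym kA; rewrite expnS natrM exprMn.
    rewrite (_ : 2 ^+ 2 = 4 :> R); last by ring.
    rewrite ler_pM2l//; have <- : Num.sqrt (p%:R * A) ^+ 2 = p%:R * A by rewrite sqr_sqrtr//; exact: ltW.
    by apply: lerXn2r; rewrite ?nnegrE ?sqrtr_ge0//; exact: ltW kA.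
  rewrite expn0 expr1n; have := A1; have : 1 <= p%:R :> R by rewrite ler1n.
  by nra.
apply: (@le_trans _ _ (512 / C * 2 + 256 * 512 / C / (p%:R * A) * (4 * (p%:R * A) / 3) + 8 / C)).
  apply: lerD; last exact: dense_term_le.
  apply: (@le_trans _ _ (\sum_(0 <= k < K) (512 / C * ((2 ^ k)%:R)^-1 +
      256 * 512 / C / (p%:R * A) * ((2 ^ k)%:R ^+ 2)))).
    by rewrite big_nat [leRHS]big_nat; apply: ler_sum => k /andP[_ kK]; exact: kb.
  rewrite big_split/= -!mulr_sumr; apply: lerD; apply: ler_wpM2l.
  - by apply: mulr_ge0; [exact: ler0n|rewrite invr_ge0; exact: ltW].
  - exact: sum_half_pow.
  - by apply: mulr_ge0; [apply: mulr_ge0; [apply: mulr_ge0; exact: ler0n|]|]; rewrite invr_ge0; exact: ltW.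
  - apply: (le_trans (@sum_four_pow R K)).
    by apply: ler_wpM2r => //; rewrite invr_ge0.
have -> : 256 * 512 / C / (p%:R * A) * (4 * (p%:R * A) / 3) = 256 * 512 * 4 / 3 / C.
  by field; rewrite !gt_eqF.
by apply: null_total; rewrite invr_ge0; exact: ltW.
Qed.

(** Each of the at most [s] active components loses at most [8 mu_(m+1)] by
    [rkhs_tail]. *)
Lemma signal_energy s f : sparse_additive_class H s f ->
  L2 Q cub f /\ exists2 S : {set 'I_p}, (#|S| <= s)%N &
    (forall j k, (0 < k)%N -> j \notin S -> coef f j k = 0) /\
    forall m, L2dot Q cub f f - 8 * s%:R * mu m.+1 <=
      \sum_(j in S) \sum_(k < m) coef f j k.+1 ^+ 2.
Proof.
move=> [S Ss [g gH fE]].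
have [[k0 [rep mer]] _] := HS.
pose ge j := ev (g j).
have gL2 j : j \in S -> L2 leb I01 (ge j) by move=> _; exact: ev_L2.
have g0 j : j \in S -> mean_zero (ge j) by move=> /gH[].
have fE' : {in cub, (fun x => \sum_(j in S) ge j (tnth x j)) =1 f}.
  by move=> x /set_mem xC; rewrite fE.
have fE'' : {in cub, f =1 (fun x => \sum_(j in S) ge j (tnth x j))}.
  by move=> x xC; rewrite fE'.
have coefE j k : (0 < k)%N -> coef f j k = if j \in S then L2dot leb I01 (psi k) (ge j) else 0.
  move=> k1; rewrite -(coord_dot_additive gL2 j (psiL2 k1) (psi0 k1)).
  exact: L2dot_eq.
split; first by apply: (L2_eq (@measurable_cube R p) fE'); exact: additive_L2.
exists S => //; split; first by move=> j k k1 jS; rewrite coefE// (negbTE jS).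
move=> m; rewrite (L2dot_eq _ fE'' fE'') (additive_dot gL2 g0).
have mu0 : 0 <= mu m.+1 by exact: mu_ge0.
apply: (@le_trans _ _ (\sum_(j in S) (L2dot leb I01 (ge j) (ge j) - 8 * mu m.+1))).
  rewrite sumrB sumr_const lerD2l lerN2 -[leLHS]mulr_natl.
  have : #|S|%:R <= s%:R :> R by rewrite ler_nat.
  have -> : 8 * s%:R * mu m.+1 = s%:R * (8 * mu m.+1) by ring.
  by apply: ler_wpM2r; exact: mulr_ge0.
apply: ler_sum => j jS; have [gj g1] := gH j jS.
have := rkhs_tail rep mer gj m.
have -> : \sum_(1 <= k < m.+1) L2dot leb I01 (psi k) (ev (g j)) ^+ 2 = \sum_(k < m) coef f j k.+1 ^+ 2.
  by rewrite big_add1/= big_mkord; apply: eq_bigr => k _; rewrite coefE// jS.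
have : `|g j| ^+ 2 <= 1 by rewrite -(expr1n R 2) lerXn2r// nnegrE.
rewrite /ge; have := sqr_ge0 `|g j|; nra.
Qed.

Let M s : R := s%:R * Num.sqrt ((nuH mu p n s A)%:R * L s).

Lemma tau_adapt_ge s : (0 < s)%N ->
  0 <= tau_adapt_sq mu p n s /\ M s <= n%:R * tau_adapt_sq mu p n s /\
  (s%:R < Num.sqrt (p%:R * A) -> s%:R * L s <= n%:R * tau_adapt_sq mu p n s).
Proof.
move=> s0; have bulk0 : 0 <= s%:R / n%:R * Num.sqrt ((nuH mu p n s A)%:R * L s).
  by rewrite mulr_ge0 ?sqrtr_ge0// divr_ge0.
have nE (x : R) : n%:R * (s%:R / n%:R * x) = s%:R * x by field; rewrite gt_eqF.
rewrite /tau_adapt_sq; case: ifP => sA; split.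
- by rewrite le_max bulk0 orbT.
- split; first by rewrite /M -[leLHS]nE ler_pM2l// le_max lexx orbT.
  by move=> _; rewrite -[leLHS]nE ler_pM2l// le_max lexx.
- exact: bulk0.
- by split; [rewrite nE|].
Qed.

(** At a resolution above [nuH s] the loss is at most eight times [M s], which is
    itself at most [n] times the squared separation rate. *)
Lemma detectable_energy s f v : (1 <= s <= p)%N -> sparse_additive_class H s f ->
  C * tau_adapt mu p n s <= L2norm Q cub f -> (nuH mu p n s A <= v)%N ->
  L2 Q cub f /\ exists2 S : {set 'I_p}, (#|S| <= s)%N &
   let b (j : 'I_p) (k : 'I_v) := Num.sqrt n%:R * coef f j k.+1 in
   (forall j k, j \notin S -> b j k = 0) /\
   (C ^+ 2 - 8) * (n%:R * tau_adapt_sq mu p n s) <= \sum_(j in S) \sum_(k < v) b j k ^+ 2.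
Proof.
move=> /andP[s1 sp] fS fC nuv.
have [Lf [S Ss [cS en]]] := signal_energy fS; split=> //; exists S => // b; split.
  by move=> j k jS; rewrite /b cS// mulr0.
have -> : \sum_(j in S) \sum_(k < v) b j k ^+ 2 = n%:R * \sum_(j in S) \sum_(k < v) coef f j k.+1 ^+ 2.
  rewrite mulr_sumr; apply: eq_bigr => j _; rewrite mulr_sumr; apply: eq_bigr => k _.
  by rewrite /b exprMn sqr_sqrtr.
have [t0 [tM _]] := tau_adapt_ge s1.
have [[nu0 nuc] _] := nuHP p0 n0 mon mu1 s1 A0.
have muv : mu v.+1 <= Num.sqrt ((nuH mu p n s A)%:R * L s) / n%:R.
  by apply: le_trans nuc; apply: mu_antitone => //; exact: leqW.
have h1 : s%:R * (n%:R * mu v.+1) <= M s.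
  rewrite /M ler_wpM2l//; move: muv; rewrite ler_pdivlMr// mulrC; exact.
have h2 : C ^+ 2 * tau_adapt_sq mu p n s <= L2dot Q cub f f.
  rewrite -L2norm_sqr -(sqr_sqrtr t0) -exprMn lerXn2r ?nnegrE ?sqrtr_ge0//.
  by apply: mulr_ge0; [exact: ltW|exact: sqrtr_ge0].
have h3 : n%:R * (L2dot Q cub f f - 8 * s%:R * mu v.+1) <= n%:R * \sum_(j in S) \sum_(k < v) coef f j k.+1 ^+ 2.
  by rewrite ler_pM2l.
have h4 : n%:R * (C ^+ 2 * tau_adapt_sq mu p n s) <= n%:R * L2dot Q cub f f by rewrite ler_pM2l.
lra.
Qed.

Lemma power_risk_of v s (f : p.-tuple (measurableTypeR R) -> R) (b : 'I_p -> 'I_v -> R) (E : set (arr v)) :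
  v \in fset_set (VH mu p n) -> s \in Sgrid mu p n -> L2 Q cub f ->
  (forall j k, b j k = Num.sqrt n%:R * coef f j k.+1) -> measurable E ->
  (forall w (u : arr v), (forall j, Estat n (stat w) j v = \sum_(k < v) (b j k + tnth (tnth u j) k) ^+ 2) ->
     ~~ ph w v s -> E u) ->
  (P f [set w | test w <> 1%N] <= law v E)%E.
Proof.
move=> vV sS Lf bE mE HE; have [t [mt tlaw tE]] := model_law Lf bE.
rewrite -tlaw//; apply: le_measure; rewrite ?inE//.
  by rewrite -[X in measurable X]setTI; exact: mt.
move=> w /= /max_test_neq1E t1; apply: (HE w); first by move=> j; exact: tE.
apply/negP => phw; apply: t1; apply/max_test_neq0P; exists (v, s) => //.
exact: allpairs_f.
Qed.

(** The test with the dyadic resolution following [nuH s] and the dyadic sparsity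
    preceding [s] (or [p] in the dense case) suffices: replacing [s] and [nuH s] by
    dyadic neighbours changes thresholds by constant factors only. *)
Lemma power_risk s f : (1 <= s <= p)%N -> sparse_additive_class H s f ->
  C * tau_adapt mu p n s <= L2norm Q cub f ->
  (P f [set w | test w <> 1%N] <= (1024 / C)%:E)%E.
Proof.
move=> sp fS fC; have /andP[s1 sp'] := sp.
have [v vV /andP[nuv v2nu]] := VH_dyadic p0 n0 mon mu1 sp.
have v0 : (0 < v)%N by exact: VH_gt0 vV.
have [Lf [S Ss [bS en]]] := detectable_energy sp fS fC nuv.
pose b (j : 'I_p) (k : 'I_v) : R := Num.sqrt n%:R * coef f j k.+1.
change (forall j k, j \notin S -> b j k = 0) in bS.
change (is_true ((C ^+ 2 - 8) * (n%:R * tau_adapt_sq mu p n s) <= \sum_(j in S) \sum_(k < v) b j k ^+ 2)) in en.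
have C19' := C19.
have [t0 [tM tL]] := tau_adapt_ge s1.
set tau := n%:R * tau_adapt_sq mu p n s in en tM tL.
have tau0 : 0 <= tau by rewrite mulr_ge0.
have pw := power_term_le C19.
have Ls0 : 0 < L s by apply: log_term_gt0.
have v2 : v%:R <= 2 * (nuH mu p n s A)%:R :> R by rewrite -natrM ler_nat ltnW.
have [sA|sA] := ltP s%:R (Num.sqrt (p%:R * A)); last first.
  have phE := phi_denseE v0 pA_le.
  apply: (le_trans (@power_risk_of v p f b
    [set u | shifted_sqnorm finset.setT b u <= v%:R * p%:R + C * Num.sqrt (v%:R * p%:R * A)]
    vV (mem_Sgrid_p mu p n) Lf (fun _ _ => erefl) _ _)).
  - by apply: measurable_le_cst; exact: measurable_shifted_sqnorm_set.
  - move=> w u uE; rewrite phE -leNgt /=; congr (is_true (_ <= _)).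
    by apply: eq_big => [j|j _]; rewrite ?finset.in_setT// uE.
  apply: le_trans (dense_power_tail p0 v0 A1 (ltW C0) _) _; last first.
    by rewrite lee_fin; apply: le_trans pw _; rewrite ler_pM2r ?invr_gt0//; lra.
  apply: (@le_trans _ _ (\sum_(j in S) \sum_(k < v) b j k ^+ 2)); last first.
    rewrite [leRHS](bigID (mem S))/= lerDl; apply: sumr_ge0 => j _; apply: sumr_ge0 => k _.
    exact: sqr_ge0.
  apply: le_trans en.
  have h : Num.sqrt (v%:R * p%:R * A) <= 2 * M s.
    have -> : 2 * M s = Num.sqrt ((2 * s%:R) ^+ 2 * ((nuH mu p n s A)%:R * L s)).
      by rewrite sqrtrM ?sqr_ge0// sqrtr_sqr ger0_norm ?mulr_ge0// mulrA.
    have s00 : 0 < s%:R :> R by rewrite ltr0n.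
    apply: ler_wsqrtr; have := dense_log_ge p0 n0 mon mu1 s1 sA.
    rewrite ler_pdivrMr; last by rewrite mulr_gt0// exprn_gt0.
    move=> dl; apply: (@le_trans _ _ (2 * (nuH mu p n s A)%:R * (p%:R * A))).
      by rewrite -mulrA ler_wpM2r// mulr_ge0// ltW.
    have : 2 * (nuH mu p n s A)%:R * (p%:R * A) <= 2 * (nuH mu p n s A)%:R * (L s * (2 * s%:R ^+ 2)).
      by rewrite ler_wpM2l// mulr_ge0.
    move=> h; apply: (le_trans h); rewrite le_eqVlt; apply/predU1P; left; ring.
  have q0 := sqrtr_ge0 (v%:R * p%:R * A).
  have : 2 * C * Num.sqrt (v%:R * p%:R * A) <= 2 * C * (2 * tau).
    by rewrite ler_wpM2l//; lra.
  have : 4 * C * tau <= (C ^+ 2 - 8) * tau 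
    by apply: ler_wpM2r; [exact: tau0|nra].
  lra.
pose s' := (2 ^ trunc_log 2 s)%N.
have /andP[s's ss'] := trunc_log_bounds (isT : 1 < 2)%N s1.
rewrite -/s' expnS -/s' in s's ss'.
have s'0 : (0 < s')%N by rewrite expn_gt0.
have s'A : s'%:R < Num.sqrt (p%:R * A) by apply: le_lt_trans sA; rewrite ler_nat.
have Lh := L_ge s'0 s'A.
have [r [w [r0 cal wE phE]]] := phi_sparseE v0 s'0 s'A.
apply: (le_trans (@power_risk_of v s' f b [set u | shifted_tstat r b u <= C * s'%:R * w]
    vV _ Lf (fun _ _ => erefl) _ _)).
- exact: mem_Sgrid_pow.
- by apply: measurable_le_cst; exact: measurable_shifted_tstat.
- move=> x u uE; rewrite phE -leNgt /=; congr (is_true (_ <= _)).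
  by apply: eq_bigr => j _; rewrite uE.
apply: le_trans (sparse_power_tail (S := S) v0 r0 s'0 A1 (erefl _) Lh (ltW C0) cal _ bS _) _.
- by apply: leq_trans Ss _; exact: ltnW.
- apply: le_trans en.
  have L4 := log_term_double p0 n0 mon mu1 s'0 ss' s's.
  have s'sR : s'%:R <= s%:R :> R by rewrite ler_nat.
  have sw : s'%:R * w <= 4 * tau.
    case: wE => ->.
      have : Num.sqrt (v%:R * L s') <= 4 * Num.sqrt ((nuH mu p n s A)%:R * L s).
        have -> : 4 * Num.sqrt ((nuH mu p n s A)%:R * L s) = Num.sqrt (4 ^+ 2 * ((nuH mu p n s A)%:R * L s)).
          by rewrite [RHS]sqrtrM ?sqr_ge0// sqrtr_sqr ger0_norm.
        apply: ler_wsqrtr.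
        have : v%:R * L s' <= 2 * (nuH mu p n s A)%:R * (4 * L s).
          by apply: ler_pM => //; lra.
        have : 0 <= (nuH mu p n s A)%:R * L s by rewrite mulr_ge0// ltW.
        lra.
      move=> h; have q0 := sqrtr_ge0 ((nuH mu p n s A)%:R * L s).
      apply: (@le_trans _ _ (s%:R * (4 * Num.sqrt ((nuH mu p n s A)%:R * L s)))).
        by apply: ler_pM => //; exact: sqrtr_ge0.
      by rewrite mulrCA ler_pM2l.
    apply: (@le_trans _ _ (s%:R * (4 * L s))); first by apply: ler_pM => //; lra.
    by rewrite mulrCA ler_pM2l//; exact: tL.
  have : (4 * C + 2048) * (s'%:R * w) <= (4 * C + 2048) * (4 * tau) 
    by apply: ler_wpM2l; [lra|exact: sw].
  have : (16 * C + 8192) * tau <= (C ^+ 2 - 8) * tau.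
    by apply: ler_wpM2r; [exact: tau0|nra].
  lra.
rewrite lee_fin; apply: (@le_trans _ _ (512 / C + 512 / C)); first exact: lerD.
by rewrite -mulrDl ler_pM2r ?invr_gt0//; lra.
Qed.

Lemma total_risk (eta : R) : 256 * 256 * 8 / eta < C -> 0 < eta ->
  (P (cst 0%R) [set w | test w <> 0%N]
   + \big[maxe/0]_(1 <= s < p.+1)
       ereal_sup [set P f [set w | test w <> 1%N] | f in
         [set f | sparse_additive_class H s f /\
            (C * tau_adapt mu p n s <= L2norm Q cub f)%R]] <= eta%:E)%E.
Proof.
move=> Ceta eta0.
apply: (@le_trans _ _ (((256 * 512 * 2 + 2048) / C)%:E + (1024 / C)%:E)%E).
  apply: leeD; first exact: null_risk.
  rewrite big_nat; apply: (big_ind (fun x => (x <= (1024 / C)%:E)%E)).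
  - by rewrite lee_fin; apply: mulr_ge0; [exact: ler0n|rewrite invr_ge0; exact: ltW].
  - by move=> x y xC yC; rewrite ge_max xC.
  - move=> s sp; apply: ge_ereal_sup => _ [f [fS fC] <-].
    by apply: (power_risk (s := s)) => //; rewrite -ltnS.
rewrite -EFinD lee_fin -mulrDl ler_pdivrMr//.
move: Ceta; rewrite ltr_pdivrMr// => Ceta; lra.
Qed.

End model_risk.

Theorem theorem3 (R : realType) :
  exists D K2 K2' K3 : R,
    [/\ 0 < D, 0 < K2, 0 < K2' & 0 < K3] /\
    forall eta : R, 0 < eta < 1 ->
    exists2 Ceta : R, 0 < Ceta &
    forall (p n : nat), (0 < p)%N -> (0 < n)%N ->
    forall (H : @hilbert_fun R) (mu : nat -> R) (psi : nat -> R -> R),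
      is_mercer_rkhs H -> H0_mercer_system H mu psi -> mu 1%N = 1 ->
    forall (d : measure_display) (Omega : measurableType d)
      (P : (p.-tuple (measurableTypeR R) -> R) -> probability Omega R)
      (Y : (p.-tuple (measurableTypeR R) -> R) -> Omega -> R),
      white_noise_model n P Y ->
    forall C : R, Ceta < C ->
      let test := fun w : Omega =>
        max_test n (Xstat psi Y w) D K2 K2' K3 C mu in
      (P (cst 0%R) [set w | test w <> 0%N]
       + \big[maxe/0]_(1 <= s < p.+1)
           ereal_sup [set P f [set w | test w <> 1%N] | f in
             [set f | sparse_additive_class H s f /\
                (C * tau_adapt mu p n s
                  <= L2norm (lebesgue_cube p) (@cube R p) f)%R]]
       <= eta%:E)%E.
Proof.
(* With D = 1, [dnu] leaves the resolutions unchanged; 16 and 256, the squares of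
   the next two constants, are those of [calibrated_bulk] and [calibrated_tail]. *)
exists 1, 4, 16, 8^-1; split; first by split.
move=> eta /andP[eta0 eta1]; have eta0' := eta0.
have Ceta0 : 0 < 256 * 256 * 8 / eta.
  by apply: divr_gt0 eta0; lra.
exists (256 * 256 * 8 / eta) => // p n p0 n0 H mu psi _ HS mu1 d Omega P Y wnm C CC.
apply: total_risk => //; apply: ltW; apply: le_lt_trans CC.
rewrite ler_pdivlMr//; lra.
Qed.
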